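(* For a graph $G$ the following conditions are equivalent: \begin{itemize} \item[(i)] $G$ is a graph with convex balls; \item[(ii)] the triangle-pentagon complex $X_{\triangle,\mathrm{pent}}(G)$ is simply connected, $\mathrm{TPC}^0_{\leq 3}$ and $\mathrm{INC}_{\leq 3}$ hold and every induced subgraph isomorphic to $\mathrm{PP}_1$ has diameter at most $3$; \item[(iii)] the triangle-pentagon complex $X_{\triangle,\mathrm{pent}}(G)$ is simply connected and every ball of radius at most $3$ is convex. \end{itemize} Furthermore, if $G$ is a graph in which all balls of radius at most $3$ are convex, then the 1-skeleton $\widetilde{G}$ of the universal cover of $X_{\triangle,\mathrm{pent}}(G)$ is a graph with convex balls.
   Context: Graphs are simple, connected, with all cliques finite; $d$ is the graph distance, $B_r(v)$ the ball, $I(u,v)=\{x: d(u,x)+d(x,v)=d(u,v)\}$ the interval. A set is convex if it contains $I(u,v)$ for all $u,v$ in it; a graph with convex balls (CB-graph) has all balls convex. A pentagon is an induced $C_5$, a triangle an induced $C_3$. The triangle-pentagon complex $X_{\triangle,\mathrm{pent}}(G)$ is the 2-dimensional cell complex with 1-skeleton $G$ whose 2-cells are solid triangles and pentagons glued along the triangles and pentagons of $G$. $\mathrm{PP}_1$ is the graph obtained by gluing two pentagons along a common edge. $\mathrm{INC}(u,v)$: the neighbors of $u$ in $I(u,v)$ form a clique, and for any two such neighbors $w,w'$ there is $z\in I(w,v)\cap I(w',v)$ with $z\sim w,w'$; $\mathrm{INC}_{\le 3}$ means $\mathrm{INC}(u,v)$ holds for all $u,v$ with $d(u,v)\le 3$.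 Triangle condition $\mathrm{TC}(v,xy)$: for $d(v,x)=d(v,y)=k$, $x\sim y$, there is $z$ with $d(v,z)\le k-1$ adjacent to $x,y$. Pentagon condition $\mathrm{PC}^0(v,xy)$: there exist $w,w',z$ with $d(v,z)\le k-2$ such that $xwzw'y$ is a pentagon. $\mathrm{TPC}^0_{\le 3}$: for all $v,x,y$ with $x\sim y$ and $d(v,x)=d(v,y)=k\le 3$, either $\mathrm{TC}(v,xy)$ or $\mathrm{PC}^0(v,xy)$ holds. *)

(* Defs.v *)
From HB Require Import structures.
From mathcomp Require Import all_boot all_order all_algebra.
From mathcomp Require Import all_classical all_reals all_analysis.
Import Order.TTheory GRing.Theory Num.Theory.
Import numFieldNormedType.Exports.

Set Implicit Arguments.
Unset Strict Implicit.
Unset Printing Implicit Defensive.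

Local Open Scope classical_set_scope.

Record sgraph := SGraph {
  vert :> choiceType;
  adj : rel vert;
  adj_sym : symmetric adj;
  adj_irr : irreflexive adj }.

Arguments adj {s} : rename.

Section Graphs.
Variable G : sgraph.
Implicit Types (u v w x y z : G) (A : set G) (r k n : nat).

Definition has_walk u v n : Prop :=
  exists p : seq G, [/\ path adj u p, last u p = v & size p = n].

(* A graph is required to have at least one vertex in order to be connected. *)
Definition connected_graph : Prop :=
  [set: G] !=set0 /\ forall u v, exists n, has_walk u v n.

Definition clique A : Prop := forall u v, A u -> A v -> u <> v -> adj u v.

Definition admissible_graph : Prop :=
  connected_graph /\ forall A, clique A -> finite_set A.

(* Junk value 0 if u and v lie in different connected components. *)
Definition gdist u v : nat :=
  if pselect (exists n, `[< has_walk u v n >]) is left e then ex_minn e else 0.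

Definition vball r v : set G := [set x | gdist v x <= r].

Definition vinterval u v : set G := [set x | gdist u x + gdist x v = gdist u v].

Definition convex_vset A : Prop :=
  forall u v, A u -> A v -> vinterval u v `<=` A.

Definition convex_balls : Prop := forall r v, convex_vset (vball r v).

Definition convex_balls_upto n : Prop :=
  forall r v, r <= n -> convex_vset (vball r v).

Definition CB_graph : Prop := admissible_graph /\ convex_balls.

Definition cyc_adj n (i j : 'I_n) : bool :=
  (i.+1 %% n == j) || (j.+1 %% n == i).

Definition induced_cycle n (c : n.-tuple G) : Prop :=
  injective (tnth c) /\
  forall i j, adj (tnth c i) (tnth c j) = cyc_adj i j.

Definition pentagon (c : 5.-tuple G) : Prop := induced_cycle c.

Definition triangle (c : 3.-tuple G) : Prop := induced_cycle c.

(* The two neighbours in the second clause are taken to be distinct: for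
   u ~ v and w = w' = v no vertex z as required can exist. *)
Definition INC u v : Prop :=
  let N := [set w | adj u w /\ vinterval u v w] in
  clique N /\
  forall w w', N w -> N w' -> w <> w' ->
    exists z, [/\ vinterval w v z, vinterval w' v z, adj z w & adj z w'].

Definition INC_upto n : Prop := forall u v, gdist u v <= n -> INC u v.

(* [gdist v z + 1 <= k] and [gdist v z + 2 <= k] avoid truncated subtraction. *)
Definition TC v x y k : Prop :=
  exists z, [/\ gdist v z + 1 <= k, adj z x & adj z y].

Definition PC0 v x y k : Prop :=
  exists w w' z, gdist v z + 2 <= k /\ pentagon [tuple x; w; z; w'; y].

Definition TPC0_upto n : Prop :=
  forall v x y k, adj x y -> gdist v x = k -> gdist v y = k -> k <= n ->
    TC v x y k \/ PC0 v x y k.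

(* PP_1: the pentagons 0-1-2-3-4 and 0-1-5-6-7 glued along 01. *)
Definition PP1_edges : seq (nat * nat) :=
  [:: (0, 1); (1, 2); (2, 3); (3, 4); (4, 0);
      (1, 5); (5, 6); (6, 7); (7, 0)].

Definition PP1_adj (i j : 'I_8) : bool :=
  ((i : nat, j : nat) \in PP1_edges) || ((j : nat, i : nat) \in PP1_edges).

Definition induced_PP1 (h : 'I_8 -> G) : Prop :=
  injective h /\ forall i j, adj (h i) (h j) = PP1_adj i j.

(* The diameter is measured in G: as a graph on its own PP_1 has diameter 4. *)
Definition PP1_diameter_le n : Prop :=
  forall h : 'I_8 -> G, induced_PP1 h -> forall i j, gdist (h i) (h j) <= n.

End Graphs.

Arguments gdist {G} u v.
Arguments cyc_adj {n} i j.

(* A complex with a simple graph as 1-skeleton, whose 2-cells are solid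
   polygons attached along embedded cycles of the 1-skeleton; [side f u v]
   means that uv is an edge of the boundary polygon of the 2-cell f. Several
   2-cells may share the same boundary. *)
Record cell_complex := CellComplex {
  skeleton : sgraph;
  face : choiceType;
  side : face -> rel skeleton;
  side_adj : forall f u v, side f u v -> adj u v;
  side_cycle : forall f, exists n, exists c : n.-tuple skeleton,
    [/\ 3 <= n, injective (tnth c) &
        forall u v, side f u v <->
          exists i j, [/\ cyc_adj i j, u = tnth c i & v = tnth c j]] }.

Definition incident (X : cell_complex) (f : face X) (u : skeleton X) : Prop :=
  exists v, side f u v.

(* Every n-gonal 2-cell f is realized as the cone, with apex a barycentre
   [inr f], over its boundary n-cycle, that is, as n solid triangles.
   The points of the realization are given by their barycentric coordinates
   in the resulting simplicial complex. *)

Definition node (X : cell_complex) : choiceType := (skeleton X + face X)%type.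

Inductive simplex (X : cell_complex) : seq (node X) -> Prop :=
| SVertex (u : skeleton X) : simplex [:: inl u]
| SEdge (u v : skeleton X) of adj u v : simplex [:: inl u; inl v]
| SCorner (f : face X) (u v : skeleton X) of side f u v :
    simplex [:: inr f; inl u; inl v].

Section Realization.
Variables (R : realType) (X : cell_complex).
Local Open Scope ring_scope.

Definition in_simplex (s : seq (node X)) (w : node X -> R) : Prop :=
  [/\ forall a, 0 <= w a, forall a, a \notin s -> w a = 0
    & \sum_(a <- s) w a = 1].

Record realization := Point {
  bary : node X -> R;
  baryP : exists2 s, simplex s & in_simplex s bary }.

HB.instance Definition _ := gen_eqMixin realization.
HB.instance Definition _ := gen_choiceMixin realization.

(* The weak (CW) topology: a set is open if and only if its trace on every
   closed simplex is open for the Euclidean topology of that simplex. *)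
Definition realization_open (U : set realization) : Prop :=
  forall s (x : realization), simplex s -> in_simplex s (bary x) -> U x ->
    exists2 e : R, 0 < e &
      forall y : realization, in_simplex s (bary y) ->
        (forall a, `|bary x a - bary y a| < e) -> U y.

Lemma realization_openT : realization_open setT.
Proof. by move=> s x _ _ _; exists 1. Qed.

Lemma realization_openI : setI_closed realization_open.
Proof.
move=> U V oU oV s x ss xs [Ux Vx].
have [e e0 eU] := oU s x ss xs Ux; have [d d0 dV] := oV s x ss xs Vx.
exists (Num.min e d); first by rewrite lt_min e0 d0.
move=> y ys xy; split; [apply: eU|apply: dV] => // a; have := xy a;
  by rewrite lt_min => /andP[].
Qed.

Lemma realization_open_bigU (I : Type) (f : I -> set realization) :
  (forall i, realization_open (f i)) -> realization_open (\bigcup_i f i).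
Proof.
move=> of_ s x ss xs [i _ fix_]; have [e e0 ef] := of_ i s x ss xs fix_.
by exists e => // y ys xy; exists i => //; apply: ef.
Qed.

HB.instance Definition _ := isOpenTopological.Build realization
  realization_openT realization_openI realization_open_bigU.

End Realization.

Section SimplyConnected.
Variable R : realType.
Local Open Scope ring_scope.

Definition unit_circle : set (R * R) := [set z | z.1 ^+ 2 + z.2 ^+ 2 = 1].

Definition unit_disk : set (R * R) := [set z | z.1 ^+ 2 + z.2 ^+ 2 <= 1].

Definition path_connected_space (T : topologicalType) : Prop :=
  [set: T] !=set0 /\
  forall x y : T, exists f : R -> T,
    [/\ {within `[0, 1], continuous f}, f 0 = x & f 1 = y].

Definition simply_connected_space (T : topologicalType) : Prop :=
  path_connected_space T /\
  forall f : R * R -> T, {within unit_circle, continuous f} ->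
    exists2 g : R * R -> T, {within unit_disk, continuous g} &
      forall z, unit_circle z -> g z = f z.

Definition simply_connected (X : cell_complex) : Prop :=
  simply_connected_space (realization R X).

End SimplyConnected.

(* A cellular map given by its action on vertices and on 2-cells. It is a
   covering if it is an isomorphism on each 2-cell ([cov_cell]), and maps the
   edges, resp. the 2-cells, incident to any vertex u bijectively to those
   incident to its image. *)
Record covering (Y X : cell_complex) (p : skeleton Y -> skeleton X)
    (q : face Y -> face X) : Prop := Covering {
  cov_adj : forall u v, adj u v -> adj (p u) (p v);
  cov_side : forall f u v, side f u v -> side (q f) (p u) (p v);
  cov_cell : forall f u v, incident f u -> incident f v -> p u = p v -> u = v;
  cov_edge : forall u y, adj (p u) y -> exists! v, adj u v /\ p v = y;
  cov_face : forall u g, incident g (p u) ->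
    exists! f, incident f u /\ q f = g }.

Definition universal_cover (R : realType) (Y X : cell_complex)
    (p : skeleton Y -> skeleton X) (q : face Y -> face X) : Prop :=
  covering p q /\ simply_connected R Y.

Section TrianglePentagon.
Variable G : sgraph.

(* Triangles and pentagons are identified with their vertex sets: being
   induced, their edges are determined. *)
Definition tp_cells : set (set G) :=
  [set A | (exists2 c : 3.-tuple G, triangle c & A = [set` c]) \/
           (exists2 c : 5.-tuple G, pentagon c & A = [set` c])].

Definition tp_face : choiceType := set_type tp_cells.

Definition tp_side (A : tp_face) : rel G :=
  fun u v => [&& u \in val A, v \in val A & adj u v].

Lemma tp_side_adj A u v : tp_side A u v -> adj u v.
Proof. by case/and3P. Qed.

Lemma tp_side_cycle (A : tp_face) : exists n, exists c : n.-tuple G,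
  [/\ 3 <= n, injective (tnth c) &
      forall u v, tp_side A u v <->
        exists i j, [/\ cyc_adj i j, u = tnth c i & v = tnth c j]].
Proof.
have H n (c : n.-tuple G) : induced_cycle c -> val A = [set` c] ->
    forall u v, tp_side A u v <->
      exists i j, [/\ cyc_adj i j, u = tnth c i & v = tnth c j].
  move=> [_ cE] AE u v; rewrite /tp_side AE; split.
    case/and3P => /set_mem/= /tnthP[i ->] /set_mem/= /tnthP[j ->] uv.
    by exists i, j; split=> //; rewrite -cE.
  case=> i [j [ij -> ->]]; apply/and3P; split; last by rewrite cE.
    by apply/mem_set; rewrite /= mem_tnth.
  by apply/mem_set; rewrite /= mem_tnth.
case: (set_mem (valP A)) => -[c cc AE].
  by exists 3, c; split=> //; [case: cc|exact: H].
by exists 5, c; split=> //; [case: cc|exact: H].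
Qed.

Definition tp_complex : cell_complex := CellComplex tp_side_adj tp_side_cycle.

End TrianglePentagon.

(* Main.v *)
Require Import Defs.
From mathcomp Require Import all_boot all_order all_algebra.
From mathcomp Require Import all_classical all_reals all_analysis.
From mathcomp Require Import zify ring lra.

(** The covering is built in finite stages: a homotopy has finitely many elementary steps and a
    lifted walk climbs at most two levels per step, so one stage of sufficient depth settles each
    closed path and no limit is taken. The obstacle in adding a level is that new vertices are
    determined by their parents alone, whereas a pentagon whose lift must close may reach two levels
    above its centre c. It is closed inside the ball of radius 3 about a vertex r two levels below
    c, on which the map to G is injective and reflects edges. A vertex of the pentagon may seem out
    of reach of r; then there is a second pentagon below an edge at c with r as its far vertex, and
    the bound on PP_1 gives distance 3 again. Triples at pairwise distance at most 2 occur because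
    any two vertices of a triangle or pentagon are that close: sending the barycentre of a 2-cell to
    one of its vertices maps simplices to such triples. *)

(* For a base point v, INC says that the neighbours of a vertex one level closer
   to v form a clique whose members pairwise have common lower neighbours, and TPC
   that two adjacent vertices of one level close up below by a triangle or by a
   pentagon. Convexity of the balls of radius at most n gives both up to level
   n + 1, by induction on the level; conversely the two conditions at all levels
   exclude a geodesic that stays on a level between two lower ends, hence make
   balls convex.
   From radius 3 to all radii: over a fixed base point one builds level by level,
   as for universal covers, a covering of G in which INC and TPC hold; INC and TPC
   at levels at most 3, together with the diameter bound on PP_1, are what is needed
   to add a level. Edge paths lift to this covering, and lifts respect
   homotopies across triples of vertices at pairwise distances at most 2. As simple
   connectivity makes every closed path null under such homotopies, the covering is
   trivial and G satisfies INC and TPC. The local conditions pass to coverings,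
   so the same argument applies to the universal cover.
   Simple connectivity is compared with edge paths through open stars and Lebesgue
   numbers: a disk is cut into a grid whose nodes are sent to vertices of the
   barycentric subdivision, and a loop in the realization is homotopic, star by star,
   to an edge path. Under INC and TPC every closed edge path contracts along geodesics
   to the base point. *)

Set Implicit Arguments.
Unset Strict Implicit.
Unset Printing Implicit Defensive.

Local Open Scope classical_set_scope.

(** * Distances and local conditions *)

(* [lia] slows down badly in the presence of irrelevant boolean hypotheses. *)
Ltac nlia :=
  repeat match goal with
  | H : ?T |- _ =>
      match T with
      | is_true (leq _ _) => fail 1
      | is_true (_ && _) => fail 1
      | is_true (~~ (leq _ _)) => fail 1
      | is_true (~~ (@eq_op nat _ _)) => fail 1
      | leq _ _ = _ => fail 1
      | @eq_op _ _ _ = _ => fail 1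
      | @eq bool _ _ => clear H
      | @eq _ _ _ => fail 1
      | ~ (@eq _ _ _) => fail 1
      | is_true (leq _ _) /\ _ => fail 1
      | (@eq _ _ _) /\ _ => fail 1
      | _ => match type of T with Prop => clear H end
      end
  end; lia.

Section GraphBasics.
Variable G : sgraph.
Hypothesis hc : forall u v : G, exists n, has_walk u v n.
Implicit Types (u v w x y z : G).

Lemma gdist_walk u v : has_walk u v (gdist u v).
Proof.
rewrite /gdist; case: pselect => [e|]; first by case: ex_minnP => n /asboolP.
by case; have [n h] := hc u v; exists n; apply/asboolP.
Qed.

Lemma gdist_le u v n : has_walk u v n -> gdist u v <= n.
Proof.
move=> h; rewrite /gdist; case: pselect => [e|]; last first.
  by case; exists n; apply/asboolP.
by case: ex_minnP => m _; apply; apply/asboolP.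
Qed.

Lemma gdistxx u : gdist u u = 0.
Proof. by apply/eqP; rewrite -leqn0; apply: gdist_le; exists [::]. Qed.

Lemma gdist_eq0 u v : gdist u v = 0 -> u = v.
Proof.
by move=> h; have [p [_ lp]] := gdist_walk u v; rewrite h; case: p lp.
Qed.

Lemma gdistC u v : gdist u v = gdist v u.
Proof.
suff h x y : gdist x y <= gdist y x by apply/eqP; rewrite eqn_leq !h.
apply: gdist_le; have [p [pp lp sp]] := gdist_walk y x.
exists (rev (belast y p)); split; last by rewrite size_rev size_belast.
- rewrite -lp rev_path; congr (is_true _): pp; apply: eq_path => a b /=.
  exact: adj_sym.
- case: p lp {pp sp} => [|a p] //= _.
  by rewrite rev_cons last_rcons.
Qed.

Lemma gdist_tri u v w : gdist u w <= gdist u v + gdist v w.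
Proof.
have [p [pp lp sp]] := gdist_walk u v; have [q [pq lq sq]] := gdist_walk v w.
apply: gdist_le; exists (p ++ q); split.
- by rewrite cat_path pp lp.
- by rewrite last_cat lp.
- by rewrite size_cat sp sq.
Qed.

Lemma adj_gdist u v : adj u v -> gdist u v = 1.
Proof.
move=> uv; have : gdist u v <= 1.
  by apply: gdist_le; exists [:: v]; rewrite /= uv.
case E : (gdist u v) => [|[|]] // _.
by move: uv; rewrite (gdist_eq0 E) adj_irr.
Qed.

Lemma gdist1 u v : gdist u v = 1 -> adj u v.
Proof.
move=> h; have [p [pp lp]] := gdist_walk u v; rewrite h.
by case: p lp pp => [|a []] //= ->; rewrite andbT.
Qed.

Lemma gdist_le1 u v : gdist u v <= 1 -> u = v \/ adj u v.
Proof.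
case E : (gdist u v) => [|[|]] // _; first by left; apply: gdist_eq0.
by right; apply: gdist1.
Qed.

Lemma gdist_step v u w : adj u w -> gdist v w <= gdist v u + 1.
Proof. by move=> /adj_gdist e; rewrite -e; apply: gdist_tri. Qed.

Lemma gdist_split u v m n : gdist u v = m + n ->
  exists w, gdist u w = m /\ gdist w v = n.
Proof.
move=> h; have [p [pp lp sp]] := gdist_walk u v.
exists (last u (take m p)).
move: pp lp; rewrite -{1 2}(cat_take_drop m p) cat_path last_cat => /andP[p1 p2] l2.
have h1 : gdist u (last u (take m p)) <= m.
  apply: gdist_le; exists (take m p); split=> //; rewrite size_takel //; lia.
have h2 : gdist (last u (take m p)) v <= n.
  apply: gdist_le; exists (drop m p); split=> //; rewrite size_drop; lia.
have := gdist_tri u (last u (take m p)) v; lia.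
Qed.

Definition par (v x y : G) := adj x y /\ gdist v y + 1 = gdist v x.

Lemma par_exists v x k : gdist v x = k.+1 -> exists y, par v x y.
Proof.
rewrite -addn1 => h; have [w [h1 h2]] := gdist_split h.
by exists w; split; [rewrite adj_sym; apply: gdist1 | lia].
Qed.

Lemma gdist2 x y z : adj x y -> adj y z -> x <> z -> ~~ adj x z -> gdist x z = 2.
Proof.
move=> xy yz nxz axz; have := gdist_step x yz; rewrite (adj_gdist xy) => h.
case E : (gdist x z) h => [|[|[|]]] //; first by move/gdist_eq0: E.
by move/gdist1: E => E; rewrite E in axz.
Qed.

Lemma gdist2_mid x z : gdist x z = 2 -> exists y, adj x y /\ adj y z.
Proof.
by move=> h; have [w [h1 h2]] := @gdist_split x z 1 1 h; exists w; split; apply: gdist1.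
Qed.

Definition pent (a b c d e : G) : bool :=
  [&& adj a b, adj b c, adj c d, adj d e & adj e a] &&
  [&& ~~ adj a c, ~~ adj a d, ~~ adj b d, ~~ adj b e & ~~ adj c e].

Lemma pentE (a b c d e : G) :
  adj a b -> adj b c -> adj c d -> adj d e -> adj e a ->
  ~~ adj a c -> ~~ adj a d -> ~~ adj b d -> ~~ adj b e -> ~~ adj c e ->
  pent a b c d e.
Proof. by rewrite /pent => -> -> -> -> -> -> -> -> -> ->. Qed.

Lemma pent_rot (a b c d e : G) : pent a b c d e = pent b c d e a.
Proof.
rewrite /pent (adj_sym a c) (adj_sym a d) (adj_sym b e).
by do ![case: (adj _ _) => //=].
Qed.

Lemma pent_rev (a b c d e : G) : pent a b c d e = pent e d c b a.
Proof.
rewrite /pent (adj_sym e d) (adj_sym d c) (adj_sym c b) (adj_sym b a) (adj_sym a e).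
rewrite (adj_sym e c) (adj_sym e b) (adj_sym d b) (adj_sym d a) (adj_sym c a).
by do ![case: (adj _ _) => //=].
Qed.

Lemma pentagonP (a b c d e : G) : pentagon [tuple a; b; c; d; e] <-> pent a b c d e.
Proof.
split.
  case=> _ h.
  have g i j : i < 5 -> j < 5 ->
      adj (nth a [:: a; b; c; d; e] i) (nth a [:: a; b; c; d; e] j) =
      (i.+1 %% 5 == j) || (j.+1 %% 5 == i).
    move=> i5 j5; have := h (Ordinal i5) (Ordinal j5).
    by rewrite !(tnth_nth a).
  apply: pentE; [move: (g 0 1)|move: (g 1 2)|move: (g 2 3)|move: (g 3 4)
    |move: (g 4 0)|move: (g 0 2)|move: (g 0 3)|move: (g 1 3)|move: (g 1 4)
    |move: (g 2 4)]; by move=> /= ->.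
move=> /andP[/and5P[ab bc cd de ea] /and5P[/negbTE ac /negbTE ad /negbTE bd /negbTE be /negbTE ce]].
have H i j : i < 5 -> j < 5 ->
      adj (nth a [:: a; b; c; d; e] i) (nth a [:: a; b; c; d; e] j) =
      (i.+1 %% 5 == j) || (j.+1 %% 5 == i).
  case: i => [|[|[|[|[|//]]]]] _; case: j => [|[|[|[|[|//]]]]] _ //=;
  rewrite ?adj_irr ?ab ?bc ?cd ?de ?ea ?ac ?ad ?bd ?be ?ce //;
  by rewrite adj_sym ?ab ?bc ?cd ?de ?ea ?ac ?ad ?bd ?be ?ce.
have H' i j : adj (tnth [tuple a; b; c; d; e] i) (tnth [tuple a; b; c; d; e] j) = cyc_adj i j.
  by rewrite !(tnth_nth a); apply: H.
split=> // i j eij; apply/val_inj => /=.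
(* Equal vertices have equal neighbours: j is adjacent to the successor of i and i to the successor
   of j, which in a 5-cycle forces i = j. *)
have e1 := H' i (inord (i.+1 %% 5)); have e2 := H' j (inord (i.+1 %% 5)).
have e3 := H' i (inord (j.+1 %% 5)); have e4 := H' j (inord (j.+1 %% 5)).
have l1 := ltn_pmod i.+1 (isT : 0 < 5); have l2 := ltn_pmod j.+1 (isT : 0 < 5).
move: e1 e2 e3 e4; rewrite eij => e1 e2 e3 e4.
have {}e1 : cyc_adj i (inord (i.+1 %% 5) : 'I_5) = cyc_adj j (inord (i.+1 %% 5) : 'I_5) by rewrite -e1 -e2.
have {}e3 : cyc_adj i (inord (j.+1 %% 5) : 'I_5) = cyc_adj j (inord (j.+1 %% 5) : 'I_5) by rewrite -e3 -e4.
move: e1 e3; rewrite /cyc_adj !inordK //.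
case: i {e2 e4 eij l1 l2} => -[|[|[|[|[|//]]]]] ? ; case: j => -[|[|[|[|[|//]]]]] ? //=.
Qed.

(* [INC] and [TPC0] at the pair (u, v), read from the base point v. *)
Definition incp v u := forall w w', par v u w -> par v u w' ->
  w = w' \/ adj w w' /\ exists z, par v w z /\ par v w' z.

Definition tcp v x y := exists z, par v x z /\ par v y z.

Definition tpcp v x y := tcp v x y \/ exists a t b,
  [/\ par v x a, par v a t, par v y b, par v b t & pent x a t b y].

Lemma incpE u v : INC u v <-> incp v u.
Proof.
have pE x y : adj x y /\ vinterval x v y <-> par v x y.
  rewrite /vinterval /par /= (gdistC y v) (gdistC x v).
  split=> -[xy h]; split => //; have := adj_gdist xy; lia.
split.
- case=> cl h w w' /pE hw /pE hw'.
  have [->|/eqP ne] := eqVneq w w'; [by left|right]; split; first exact: cl.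
  have [z [h1 h2 zw zw']] := h w w' hw hw' ne.
  by exists z; split; apply/pE; split=> //; rewrite adj_sym.
- move=> h; split.
    by move=> w w' /pE hw /pE hw' ne; case: (h w w' hw hw') => // -[].
  move=> w w' /pE hw /pE hw' ne; case: (h w w' hw hw') => // -[_ [z [/pE[a b] /pE[c e]]]].
  by exists z; rewrite adj_sym a adj_sym c.
Qed.

Lemma tpcpE v x y k : adj x y -> gdist v x = k -> gdist v y = k ->
  TC v x y k \/ PC0 v x y k <-> tpcp v x y.
Proof.
move=> xy hx hy; split.
- case=> [[z [h zx zy]]|[a [b [t [h /pentagonP pe]]]]].
    left; exists z; split; split; rewrite 1?adj_sym //;
    by have := gdist_step v zx; have := gdist_step v zy; lia.
  right; exists a, t, b; move: (pe) => /andP[/and5P[xa at_ tb bY yx] _].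
  have := gdist_step v at_; have := gdist_step v tb.
  have := gdist_step v xa; have := gdist_step v bY.
  rewrite adj_sym in at_; have := gdist_step v at_.
  rewrite adj_sym in tb; have := gdist_step v tb.
  rewrite adj_sym in xa; have := gdist_step v xa.
  rewrite adj_sym in bY; have := gdist_step v bY.
  move=> *; split=> //; split; rewrite 1?(adj_sym x) 1?(adj_sym a t) //; lia.
- case=> [[z [[xz h1] [yz h2]]]|[a [t [b [[xa h1] [at_ h2] [yb h3] [bt h4] pe]]]]].
    by left; exists z; split; [lia|rewrite adj_sym|rewrite adj_sym].
  by right; exists a, b, t; split; [lia|apply/pentagonP].
Qed.

End GraphBasics.

(** * From convexity of small balls to INC and TPC *)

Section LocalConditions.
Variable G : sgraph.
Hypothesis hc : forall u v : G, exists n, has_walk u v n.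
Implicit Types (q u v w x y z a b c : G).

Definition square_free := forall a b c e : G,
  adj a b -> adj b c -> adj c e -> adj e a -> [\/ a = c, b = e, adj a c | adj b e].

Definition par_clique q u := forall a b : G, par q u a -> par q u b -> a = b \/ adj a b.

Lemma incp_clique q u : incp q u -> par_clique q u.
Proof. by move=> h a b pa pb; case: (h a b pa pb) => [|[? _]]; [left|right]. Qed.

Lemma adj_neq a b : adj a b -> a <> b.
Proof. by move=> ab e; move: ab; rewrite e adj_irr. Qed.

Lemma gdist_adj2 v a b : adj a b -> gdist v a <= gdist v b + 1 /\ gdist v b <= gdist v a + 1.
Proof.
by move=> ab; split; apply: gdist_step; rewrite // adj_sym.
Qed.

Lemma gdist_step2 v a b c : adj a b -> adj b c -> gdist v c <= gdist v a + 2.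
Proof. by move=> ab bc; have := gdist_step hc v ab; have := gdist_step hc v bc; nlia. Qed.

(** Without diagonals, a and c are at distance 2, and b, e are two parents of c seen from a. *)
Lemma square_free_of_clique : (forall q u, gdist q u <= 2 -> par_clique q u) -> square_free.
Proof.
move=> cl a b c e ab bc ce ea.
have [->|/eqP nac] := eqVneq a c; first by constructor 1.
case nadj : (adj a c); first by constructor 3.
have d2 := gdist2 hc ab bc nac (negbT nadj).
case: (cl a c _ b e); rewrite ?d2 //.
- by split; [rewrite adj_sym|rewrite (adj_gdist hc ab) d2].
- by split; [|rewrite adj_sym in ea; rewrite (adj_gdist hc ea) d2].
- by constructor 2.
- by constructor 4.
Qed.

(* A form of the triangle-pentagon condition in which the neighbour b of x
   may be prescribed. *)
Lemma tpcp_prescribed q x y b k :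
  (forall q u, gdist q u <= 3 -> par_clique q u) ->
  incp q x -> (forall a, par q x a -> incp q a) -> tpcp q x y ->
  2 <= k -> gdist q x = k -> gdist q y = k -> adj x y -> par q x b ->
  exists w t, [/\ par q y w, par q b t & par q w t].
Proof.
move=> cl3 incx incP tp k2 dx dy xy pxb.
case: tp => [[z [pxz pyz]]|[a [t [c [pxa pat pyc pct pe]]]]].
  case: (incx b z pxb pxz) => [bz|[bz [t [pbt pzt]]]]; last by exists z, t.
  have [t pt] := @par_exists _ hc q b (k - 2) ltac:(case: pxb; nlia).
  by exists z, t; rewrite -bz; split=> //; rewrite bz.
case: (incx a b pxa pxb) => [ab|[ab [k0 [pak pbk]]]].
  by exists c, t; rewrite -ab.
case: (incP a pxa k0 t pak pat) => [e|[k0t _]].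
  by exists c, t; split=> //; rewrite -e.
have [xa dxa] := pxa; have [xb dxb] := pxb; have [at_ dat] := pat.
have [yc dyc] := pyc; have [ct dct] := pct; have [bk dbk] := pbk.
case bt : (adj b t); first by exists c, t; split=> //; split=> //; nlia.
case yb : (adj y b); first by exists b, k0; split=> //; split=> //; nlia.
have nyt : y <> t by move=> e; move: dyc; rewrite e; nlia.
have ayt : ~~ adj y t by apply/negP => /(gdist_adj2 q); nlia.
have dyt := gdist2 hc yc ct nyt ayt.
have nyb : y <> b by move=> e; move: dyc; rewrite e; nlia.
have yx := xy; rewrite adj_sym in yx.
have dyb := gdist2 hc yx xb nyb (negbT yb).
(* The last case changes the base point to y. If k0 were at distance 3 from y, then b and t would be
   two parents of k0 seen from y, hence adjacent. So k0 is at distance 2, and a midpoint of y and k0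
   is the parent sought. *)
have dyk : gdist y k0 <= 3 by have := gdist_step hc y bk; nlia.
have dyk2 : 2 <= gdist y k0.
  by have := gdist_tri hc q k0 y; rewrite (gdistC hc k0); nlia.
case E : (gdist y k0 == 2).
  have [n [yn nk]] := gdist2_mid hc (eqP E).
  have := gdist_adj2 q yn; have := gdist_adj2 q nk.
  by move=> *; exists n, k0; split=> //; split=> //; nlia.
case: (cl3 y k0 dyk t b).
- by split=> //; move: E; nlia.
- by split; [rewrite adj_sym|move: E; nlia].
- by move=> e; move: dat; rewrite e; nlia.
- by rewrite adj_sym bt.
Qed.

Section Convex.
Variable n : nat.
Hypothesis n3 : 3 <= n.
Hypothesis conv : convex_balls_upto G n.

Lemma conv_mid r v a b c : r <= n -> gdist v a <= r -> gdist v b <= r ->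
  gdist a c + gdist c b = gdist a b -> gdist v c <= r.
Proof. by move=> rn ha hb e; apply: (conv rn ha hb). Qed.

Lemma conv_mid2 r v a b c : r <= n -> gdist v a <= r -> gdist v b <= r ->
  adj a c -> adj c b -> gdist a b = 2 -> gdist v c <= r.
Proof.
move=> rn ha hb ac cb e; apply: (conv_mid rn ha hb).
by rewrite (adj_gdist hc ac) (adj_gdist hc cb).
Qed.

(** Two non-adjacent parents of u have u between them, but lie in a ball that does not contain u.
    Its radius is one less than the level of u, so convexity up to radius n reaches level n + 1. *)
Lemma conv_clique q u : gdist q u <= n.+1 -> par_clique q u.
Proof.
move=> h a b [ua da] [ub db].
have [->|/eqP nab] := eqVneq a b; [by left|right].
apply/negPn/negP => nadj.
have au := ua; rewrite adj_sym in au.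
have d2 := gdist2 hc au ub nab nadj.
have := @conv_mid2 (gdist q a) q a b u; rewrite d2 => /(_ _ _ _ au ub erefl).
nlia.
Qed.

Lemma conv_square_free : square_free.
Proof. by apply: square_free_of_clique => q u h; apply: conv_clique; nlia. Qed.

Section TPC.
Variables (v x y : G) (k : nat).
Hypotheses (kn : k <= n.+1) (xy : adj x y) (dx : gdist v x = k) (dy : gdist v y = k).
Hypothesis ntc : forall z, par v x z -> par v y z -> False.

(** The walk a, x, y, b bounds the distance by 3. Distance 3 would put x on a geodesic from a to b,
    against convexity of the ball of radius k - 1; distance 1 gives a square, and distance 0 a
    common parent. *)
Let opposite_dist a b : par v x a -> par v y b -> gdist a b = 2.
Proof.
move=> pa pb; have [xa da] := pa; have [yb db] := pb.
have ax := xa; rewrite adj_sym in ax.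
have h1 := gdist_step2 a xy yb; rewrite (adj_gdist hc ax) in h1.
case E : (gdist a b) h1 => [|[|[|[|//]]]] // _.
- by move/(gdist_eq0 hc): E => E; case: (@ntc b) => //; rewrite -E.
- move/(gdist1 hc): E => ab; have by_ := yb; rewrite adj_sym in by_.
  have yx := xy; rewrite adj_sym in yx.
  case: (conv_square_free xa ab by_ yx) => [e|e|xb|ay].
  + by move: dx; rewrite e; nlia.
  + by move: dy; rewrite -e; nlia.
  + by case: (@ntc b) => //; split=> //; nlia.
  + by case: (@ntc a) => //; split; [rewrite adj_sym|nlia].
- have h2 := gdist_step2 x xy yb; rewrite gdistxx in h2.
  have h3 := gdist_tri hc a x b; rewrite (adj_gdist hc ax) E in h3.
  have := @conv_mid (k - 1) v a b x; rewrite E (adj_gdist hc ax) => H.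
  have := H _ _ _ _; nlia.
Qed.

Let close_pent a b s : par v x a -> par v y b -> adj a s -> adj b s ->
  gdist v s + 2 = k -> tpcp v x y.
Proof.
move=> pa pb as_ bs ds; have [xa da] := pa; have [yb db] := pb.
right; exists a, s, b; split=> //; try by split=> //; nlia.
apply: pentE => //.
- by rewrite adj_sym.
- by rewrite adj_sym.
- by rewrite adj_sym.
- by apply/negP => /(gdist_adj2 v); nlia.
- by apply/negP => xb; apply: (@ntc b) => //; split=> //; nlia.
- by apply/negP => /(adj_gdist hc); rewrite (opposite_dist pa pb).
- by apply/negP => ay; apply: (@ntc a) => //; split; [rewrite adj_sym|nlia].
- by apply/negP => /(gdist_adj2 v); nlia.
Qed.

(** Midpoints of s, x and of s, y are parents of x and y by their levels, so [close_pent] applies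
    with apex s. *)
Let close_D s : gdist v s + 2 = k -> gdist s x <= 2 -> gdist s y <= 2 -> tpcp v x y.
Proof.
move=> ds hx hy.
have h1 := gdist_tri hc v s x; have h2 := gdist_tri hc v s y.
have [a [sa ax]] := @gdist2_mid _ hc s x ltac:(nlia).
have [b [sb by_]] := @gdist2_mid _ hc s y ltac:(nlia).
have := gdist_adj2 v sa; have := gdist_adj2 v ax.
have := gdist_adj2 v sb; have := gdist_adj2 v by_ => h3 h4 h5 h6.
apply: (@close_pent a b s); rewrite 1?adj_sym //; split; rewrite 1?adj_sym //; nlia.
Qed.

Let ndx a : par v x a -> gdist a y = 2.
Proof.
move=> pa; have [xa da] := pa; have ax := xa; rewrite adj_sym in ax.
apply: (gdist2 hc ax xy); first by move=> e; move: da; rewrite e; nlia.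
by apply/negP => ay; apply: (@ntc a) => //; split; [rewrite adj_sym|nlia].
Qed.

Let ndy b : par v y b -> gdist b x = 2.
Proof.
move=> pb; have [yb db] := pb; have by_ := yb; rewrite adj_sym in by_.
have yx := xy; rewrite adj_sym in yx.
apply: (gdist2 hc by_ yx); first by move=> e; move: db; rewrite e; nlia.
by apply/negP => ay; apply: (@ntc b) => //; split; [rewrite adj_sym|nlia].
Qed.

(** As x lies between a and y, convexity of the ball of radius 2 about s brings x within distance 2
    of s. *)
Let close_D1 a s : par v x a -> gdist v s + 2 = k -> gdist s a <= 2 ->
  gdist s y <= 2 -> tpcp v x y.
Proof.
move=> pa ds ha hy; apply: (close_D ds) => //.
have [xa _] := pa; rewrite adj_sym in xa.
by apply: (@conv_mid2 2 s a y x _ ha hy xa xy (ndx pa)); nlia.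
Qed.

Let close_D2 b s : par v y b -> gdist v s + 2 = k -> gdist s b <= 2 ->
  gdist s x <= 2 -> tpcp v x y.
Proof.
move=> pb ds ha hx; apply: (close_D ds) => //.
have [yb _] := pb; rewrite adj_sym in yb; have yx := xy; rewrite adj_sym in yx.
by apply: (@conv_mid2 2 s b x y _ ha hx yb yx (ndy pb)); nlia.
Qed.

(** If r is within 1 of z, it is within 2 of a and serves as apex. Otherwise b lies between z and r,
    both in the ball of radius 2 about s, so that s is within 2 of b and serves as apex. *)
Let close_E a z b s r : par v x a -> par v y b -> adj z a -> adj z b ->
  par v a s -> par v b r -> gdist s r <= 2 -> tpcp v x y.
Proof.
move=> pa pb za zb [as_ ds] [br dr] sr.
have [xa da] := pa; have [yb db] := pb.
have sa : adj s a by rewrite adj_sym.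
have rb : adj r b by rewrite adj_sym.
have bz : adj b z by rewrite adj_sym.
have ax : adj a x by rewrite adj_sym.
have by_ : adj b y by rewrite adj_sym.
have az : adj a z by rewrite adj_sym.
have hsz := gdist_step2 s sa az; rewrite gdistxx in hsz.
have hrz := gdist_step2 r rb bz; rewrite gdistxx in hrz.
have hry := gdist_step2 r rb by_; rewrite gdistxx in hry.
have hsx := gdist_step2 s sa ax; rewrite gdistxx in hsx.
have [rz|nrz] := leqP (gdist r z) 1.
  apply: (@close_D1 a r) => //; first nlia.
  by have := gdist_step hc r za; nlia.
apply: (@close_D2 b s) => //; first nlia.
apply: (@conv_mid2 2 s z r b) => //; first nlia.
by rewrite gdistC //; nlia.
Qed.

(** A midpoint z of the parents a and b is, at worst, on their level. Prescribed applications of TPC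
    one level down, along az and zb, produce a path s, p, q, r with s, r parents of a, b and p, q
    three levels below x. The aim is to replace it by a path of length 2, as [close_E] requires. *)
Lemma tpcp_step :
  (forall u, gdist v u <= k -> incp v u) ->
  (forall a b, adj a b -> gdist v a + 1 = k -> gdist v b + 1 = k -> tpcp v a b) ->
  tpcp v x y.
Proof.
move=> inc tpc.
have cl3 q u : gdist q u <= 3 -> par_clique q u by move=> h; apply: conv_clique; nlia.
have k0 : 0 < k.
  rewrite lt0n; apply/eqP => k0; move: dx dy; rewrite k0.
  by move=> /(gdist_eq0 hc) e1 /(gdist_eq0 hc) e2; apply: (adj_neq xy); rewrite -e1.
have [a pa] := @par_exists _ hc v x (k - 1) ltac:(nlia).
have [b pb] := @par_exists _ hc v y (k - 1) ltac:(nlia).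
have [xa da] := pa; have [yb db] := pb.
have [k1|k1] := leqP k 1.
  have e1 : v = a by apply: (gdist_eq0 hc); nlia.
  have e2 : v = b by apply: (gdist_eq0 hc); nlia.
  have e : a = b by rewrite -e1.
  by case: (@ntc a) => //; rewrite e.
have [k2|k2] := leqP k 2.
  apply: (close_pent pa pb (s := v)); rewrite ?gdistxx; last by nlia.
    by rewrite adj_sym; apply: (gdist1 hc); nlia.
  by rewrite adj_sym; apply: (gdist1 hc); nlia.
have [z [az zb]] := gdist2_mid hc (opposite_dist pa pb).
have za : adj z a by rewrite adj_sym.
have bz : adj b z by rewrite adj_sym.
have dz : gdist v z <= k - 1.
  by apply: (@conv_mid2 (k - 1) v a b z _ _ _ az zb (opposite_dist pa pb)); nlia.
have [ez|dz2] : gdist v z + 2 = k \/ gdist v z + 1 = k.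
  by have := gdist_adj2 v az; nlia.
  exact: (close_pent pa pb az bz).
have pc q w c e : adj w c -> gdist q w + 1 = k -> gdist q c + 1 = k -> q = v ->
    par q w e -> exists g t, [/\ par q c g, par q e t & par q g t].
  move=> wc h1 h2 eq; subst q => pwe; apply: (tpcp_prescribed cl3 (k := k - 1) _ _ _ _ _ _ wc pwe); try nlia.
  - by apply: inc; nlia.
  - by move=> f [_ df]; apply: inc; nlia.
  - exact: tpc.
have [s pas] := @par_exists _ hc v a (k - 2) ltac:(nlia).
have [s' [p [pzs psp ps'p]]] := pc v a z s az ltac:(nlia) dz2 erefl pas.
have [r [q [pbr ps'q prq]]] := pc v z b s' zb dz2 ltac:(nlia) erefl pzs.
have [as_ ds] := pas; have [zs' ds'] := pzs; have [br dr] := pbr.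
have [sp dp] := psp; have [s'q dq] := ps'q; have [rq drq] := prq.
have qr : adj q r by rewrite adj_sym.
have ra : adj r b by rewrite adj_sym.
have xa' : adj a x by rewrite adj_sym.
have near t : adj s t -> adj t r -> tpcp v x y.
  move=> st tr; apply: (close_E pa pb za zb pas pbr).
  by have := gdist_step2 s st tr; rewrite gdistxx.
have [e|pq] := @conv_clique v s' ltac:(nlia) p q ps'p ps'q.
  by apply: (near p); rewrite // e.
case pr : (adj p r); first exact: (near p).
have nep : p <> r by move=> e; move: dp; rewrite e; nlia.
have dpr := gdist2 hc pq qr nep (negbT pr).
have dxp : gdist x p <= 3.
  by have := gdist_step2 x as_ sp; rewrite (adj_gdist hc xa); nlia.
have dxr : gdist x r <= 3.
  by have := gdist_step2 x yb br; rewrite (adj_gdist hc xy); nlia.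
(* Here radius 3 is used, q being between p and r. So q is at distance exactly 3 from x, and a
   geodesic to it offers another parent m of x. *)
have dxq : gdist x q <= 3 by apply: (@conv_mid2 3 x p r q _ dxp dxr pq qr dpr); nlia.
have dxq3 : gdist x q = 1 + 2.
  by have := gdist_tri hc v q x; rewrite (gdistC hc q); nlia.
have [m [xm mq]] := gdist_split hc dxq3; have {}xm := gdist1 hc xm.
have [f [mf fq]] := gdist2_mid hc mq.
have mx : adj m x by rewrite adj_sym.
have := gdist_adj2 v xm; have := gdist_adj2 v mf; have := gdist_adj2 v fq => h1 h2 h3.
have pm : par v x m by split=> //; nlia.
have pf : par v m f by split=> //; nlia.
have [daq|daq] := leqP (gdist q a) 2.
  have [c [qc ca]] := @gdist2_mid _ hc q a ltac:(by have := gdist_tri hc v q a; nlia).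
  have cq : adj c q by rewrite adj_sym.
  have := gdist_adj2 v qc; have := gdist_adj2 v ca => h4 h5.
  have pc1 : par v a c by split; [rewrite adj_sym|nlia].
  apply: (close_E pa pb za zb pc1 pbr).
  by have := gdist_step2 c cq qr; rewrite gdistxx.
have [em|ma] := @conv_clique v x ltac:(nlia) m a pm pa.
  by move: daq; rewrite -em gdistC // mq.
have hmz := gdist_step2 m ma az; rewrite gdistxx in hmz.
case mz : (adj m z).
  have zm : adj z m by rewrite adj_sym.
  have fr := gdist_step2 f fq qr; rewrite gdistxx in fr.
  exact: (close_E pm pb zm zb pf pbr).
have [emz|nmz] := eqVneq m z.
  have yx : adj y x by rewrite adj_sym.
  have by_ : adj b y by rewrite adj_sym.
  have xz : adj x z by rewrite -emz.
  case: (conv_square_free xz zb by_ yx) => [e|e|e|e].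
  - by move: db; rewrite -e; nlia.
  - by move: dz2; rewrite e; nlia.
  - by case: (@ntc b) => //; split=> //; nlia.
  - by case: (@ntc z) => //; split=> //; [nlia|rewrite adj_sym|nlia].
have qs' : adj q s' by rewrite adj_sym.
have s'z : adj s' z by rewrite adj_sym.
have hqz := gdist_step2 q qs' s'z; rewrite gdistxx in hqz.
(* Otherwise a lies between m and z, which are both within 2 of q, so a would be within 2 of q as
   well. *)
have := @conv_mid2 2 q m z a _ _ hqz ma az (gdist2 hc ma az (elimN eqP nmz) (negbT mz)).
rewrite (gdistC hc q m) mq; nlia.
Qed.

End TPC.

(** The conditions feed each other: INC at level k uses TPC at level k - 1 for the edge joining two
    parents, and TPC at level k uses INC up to level k and TPC at level k - 1. *)
Lemma conv_incp_tpcp k : k <= n.+1 ->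
  (forall v u, gdist v u <= k -> incp v u) /\
  (forall v x y, adj x y -> gdist v x = k -> gdist v y = k -> tpcp v x y).
Proof.
elim/ltn_ind: k => k IH kn.
have inc v u : gdist v u <= k -> incp v u.
  rewrite leq_eqVlt => /orP[/eqP dk|lk]; last first.
    by apply: (proj1 (IH (gdist v u) lk _)) => //; nlia.
  move=> a b pa pb.
  have hku : gdist v u <= n.+1 by nlia.
  case: (@conv_clique v u hku a b pa pb) => [|ab]; [by left|right].
  split=> //; have [ua da] := pa; have [ub db] := pb.
  have [//|[c [t [e [[ac dc] [ct dt] [be de] [et de'] pe]]]]] :=
    proj2 (IH (k - 1) ltac:(nlia) ltac:(nlia)) v a b ab ltac:(nlia) ltac:(nlia).
  (* A pentagon on the parents a, b would have its apex t three levels below u, yet t lies between c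
     and e, both within 2 of u. *)
  exfalso.
  move: pe => /andP[/and5P[_ _ te _ _] /and5P[_ nae nce _ _]].
  have nec : c <> e by move=> e1; move: nae; rewrite -e1 ac.
  have hc2 := gdist_step2 u ua ac; rewrite gdistxx in hc2.
  have he2 := gdist_step2 u ub be; rewrite gdistxx in he2.
  have := @conv_mid2 2 u c e t ltac:(nlia) hc2 he2 ct te (gdist2 hc ct te nec nce).
  have := gdist_tri hc v t u; rewrite (gdistC hc t); nlia.
split=> // v x y xy dx dy.
have [//|ntc] := pselect (tcp v x y); first by left.
apply: (tpcp_step kn xy dx dy) => //.
- by move=> z p1 p2; apply: ntc; exists z.
- by move=> u; apply: inc.
- move=> a b ab h1 h2; have lk : k - 1 < k by nlia.
  have [_ IH2] := IH _ lk ltac:(nlia).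
  by apply: IH2 => //; nlia.
Qed.

End Convex.
End LocalConditions.

(** * From INC and TPC to convex balls *)

Section ConditionsToConvexity.
Variable G : sgraph.
Hypothesis hc : forall u v : G, exists n, has_walk u v n.
Hypothesis inc : forall v u : G, incp v u.
Hypothesis tpc : forall v x y : G, adj x y -> gdist v x = gdist v y -> tpcp v x y.
Implicit Types (u v w x y z a b c : G).

Let cl v u : par_clique v u. Proof. exact: incp_clique. Qed.

Let sqf : square_free G.
Proof. by apply: (square_free_of_clique hc) => q u _; apply: cl. Qed.

Let prescribed v x y b k : 2 <= k -> gdist v x = k -> gdist v y = k -> adj x y ->
  par v x b -> exists w t, [/\ par v y w, par v b t & par v w t].
Proof.
move=> k2 dx dy xy; apply: (tpcp_prescribed hc _ _ _ _ k2 dx dy xy) => //.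
by apply: tpc => //; rewrite dx dy.
Qed.

(** Otherwise the distance is 3, and seen from a the vertex b has parents y and t, where t is a
    common parent of b and n. These would be equal or adjacent although their levels seen from v
    differ by 2. *)
Let parents_dist v x y a b k : 2 <= k -> gdist v x = k -> gdist v y = k -> adj x y ->
  par v x a -> par v y b -> gdist a b <= 2.
Proof.
move=> k2 dx dy xy pa pb; have [n [c [pn ac nc]]] := prescribed k2 dx dy xy pa.
case: (inc pb pn) => [->|[bn [t [bt nt]]]].
  by have := gdist_step2 hc a (proj1 ac) (_ : adj c n); rewrite gdistxx adj_sym => /(_ (proj1 nc)).
have [xa da] := pa; have [yb db] := pb; have [yn dn] := pn.
have [ac_ dac] := ac; have [nc_ dnc] := nc; have [bt_ dbt] := bt; have [nt_ dnt] := nt.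
rewrite leqNgt; apply/negP => lab.
have ax : adj a x by rewrite adj_sym.
have h1 := gdist_step2 hc a ax xy; rewrite gdistxx in h1.
have h2 := gdist_step hc a yb.
have dat : gdist a t <= 2.
  have act := cl nc nt; case: act => [<-|ct]; first by rewrite (adj_gdist hc ac_).
  by have := gdist_step2 hc a ac_ ct; rewrite gdistxx.
have tb : adj t b by rewrite adj_sym.
have h3 := gdist_step hc a tb.
case: (@cl a b y t); try by [split; [rewrite adj_sym|nlia]|split; [|nlia]].
- by move=> e; move: dbt; rewrite -e; nlia.
- by move/(gdist_adj2 hc v); nlia.
Qed.

Let walk_dist (x : nat -> G) n : (forall i, i < n -> adj (x i) (x i.+1)) ->
  forall i j, i <= j -> j <= n -> gdist (x i) (x j) <= j - i.
Proof.
move=> ad i j; elim: j => [|j IH].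
  by rewrite leqn0 => /eqP -> _; rewrite gdistxx.
rewrite leq_eqVlt => /orP[/eqP -> _|ij jn]; first by rewrite gdistxx.
by have := gdist_step hc (x i) (ad j jn); have := IH ij (ltnW jn); nlia.
Qed.

(** Induction on the length of the plateau. Its last two vertices have no common parent, since such
    a parent would end a shorter bump. Parents are propagated along the plateau, starting with
    [x 0], up to a parent p of the last but one vertex; a midpoint m of p and the far end then
    closes a square with the last two plateau vertices. *)
Lemma no_bump v k l (x : nat -> G) : 0 < l ->
  (forall i, i <= l -> adj (x i) (x i.+1)) ->
  (forall i, 0 < i -> i <= l -> gdist v (x i) = k) ->
  gdist v (x 0) + 1 = k -> gdist v (x l.+1) + 1 = k ->
  gdist (x 0) (x l.+1) = l.+1 -> False.
Proof.
elim: l x => // l IH x _ ad lev d0 dl geo.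
have pl : par v (x l.+1) (x l.+2) by split; [apply: ad|rewrite (lev l.+1)].
have p0 : par v (x 1) (x 0) by split; [rewrite adj_sym; apply: ad|rewrite (lev 1)].
have [l0|lpos] := posnP l.
  rewrite l0 in geo pl; case: (cl pl p0) => [e|/(adj_gdist hc)].
    by rewrite e gdistxx in geo.
  by rewrite gdistC // geo.
have k2 : 2 <= k.
  rewrite leqNgt; apply/negP => k1.
  have e0 : v = x 0 by apply: (gdist_eq0 hc); nlia.
  have e1 : v = x l.+2 by apply: (gdist_eq0 hc); nlia.
  by rewrite -e0 -e1 gdistxx in geo.
have wd := walk_dist (n := l.+2) (x := x) ad.
have adl : adj (x l) (x l.+1) by apply: ad.
have ll : gdist v (x l) = k by apply: lev.
have ll1 : gdist v (x l.+1) = k by apply: lev.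
have dl1 : gdist (x 0) (x l.+1) = l.+1.
  have := wd 0 l.+1 isT (ltnW (leqnn _)); have := gdist_step hc (x 0) (proj1 pl).
  by rewrite geo; nlia.
have dll : gdist (x 0) (x l) <= l by have := wd 0 l isT; rewrite subn0; apply; nlia.
have ntc w : par v (x l) w -> par v (x l.+1) w -> False.
  move=> pw1 pw2; have [xw dw] := pw1.
  have h1 := gdist_step hc (x 0) xw.
  case: (cl pw2 pl) => [e|wb]; first by move: h1; rewrite e geo; nlia.
  have h2 := gdist_step hc (x 0) wb; rewrite geo in h2.
  apply: (IH (fun i => if i <= l then x i else w)) => //=.
  - move=> i il; rewrite il; case: ltnP => h; first by apply: ad; nlia.
    by have -> : i = l by nlia.
  - by move=> i i0 il; rewrite il; apply: lev => //; nlia.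
  - by rewrite ltnn; nlia.
  - by rewrite ltnn; nlia.
(* The parent t of p is tracked because two parents of p are equal or adjacent, so the distance from
   [x 0] to t grows by at most one per step. *)
have chain i : 0 < i -> i <= l -> exists p, par v (x i) p /\
    (p = x 0 \/ exists t, par v p t /\ gdist (x 0) t + 1 <= i).
  elim: i => // i IHi _ il; case: (posnP i) => [->|i0]; first by exists (x 0); split=> //; left.
  have [p [pp hp]] := IHi i0 (ltnW il).
  have lvi : gdist v (x i) = k by apply: lev; nlia.
  have lvi1 : gdist v (x i.+1) = k by apply: lev; nlia.
  have adi : adj (x i) (x i.+1) by apply: ad; nlia.
  have [p' [t' [pp' pt' ppt']]] := prescribed k2 lvi lvi1 adi pp.
  exists p'; split=> //; right; exists t'; split=> //.
  case: hp => [e|[t [pt dt]]].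
    by rewrite -e (adj_gdist hc (proj1 pt')); nlia.
  case: (cl pt pt') => [<-|tt']; first by nlia.
  by have := gdist_step hc (x 0) tt'; nlia.
have [p [pp hp]] := chain l lpos (leqnn l).
have dp : gdist (x 0) p + 1 <= l.+1 /\ (p = x 0 -> gdist (x 0) p = 0).
  split; last by move=> ->; rewrite gdistxx.
  case: hp => [->|[t [[pt _] dt]]]; first by rewrite gdistxx; nlia.
  rewrite adj_sym in pt; have := gdist_step hc (x 0) pt; nlia.
have hpb := parents_dist k2 ll ll1 adl pp pl.
have tri := gdist_tri hc (x 0) p (x l.+2); rewrite geo in tri.
have [m [pm mb]] := @gdist2_mid _ hc p (x l.+2) ltac:(nlia).
have h1 := gdist_step hc (x 0) pm; have h2 := gdist_step hc (x 0) mb; rewrite geo in h2.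
have [xp dxp] := pp; have [xb dxb] := pl.
(* On level k, m would have p and the far end as parents, which are too far apart. Below level k -
   1, m and [x l.+1] would be parents of the far end seen from [x 0] whose levels seen from v differ
   by 2. *)
have lm : gdist v m + 1 = k.
  have := gdist_adj2 hc v pm => h3.
  have [e|e] : gdist v m = k \/ gdist v m <= k - 1 by nlia.
    have pmp : par v m p by split; [rewrite adj_sym|nlia].
    have pmb : par v m (x l.+2) by split; [|nlia].
    case: (cl pmp pmb) => [e1|/(adj_gdist hc) e1]; last by nlia.
    by move: tri; rewrite e1 gdistxx -e1; nlia.
  have bm : adj (x l.+2) m by rewrite adj_sym.
  case: (@cl (x 0) (x l.+2) (x l.+1) m); try by [split; [rewrite adj_sym|nlia]|split=> //; nlia].
  - by move=> em; move: e; rewrite -em; nlia.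
  - by move/(gdist_adj2 hc v); nlia.
have bm : adj (x l.+2) m by rewrite adj_sym.
have xb' : adj (x l.+2) (x l.+1) by rewrite adj_sym.
case: (@cl (x 0) (x l.+2) (x l.+1) m); try by split=> //; nlia.
- by move=> em; move: lm; rewrite -em; nlia.
- move=> xm; have mx : adj m (x l.+1) by rewrite adj_sym.
  have xx : adj (x l.+1) (x l) by rewrite adj_sym.
  case: (sqf xp pm mx xx) => [e|e|e|e].
  + by move: lm; rewrite -e; nlia.
  + by move: dxp; rewrite e; nlia.
  + by apply: (ntc m); split=> //; nlia.
  + by apply: (ntc p); split=> //; [rewrite adj_sym|nlia].
Qed.

Lemma geodesic_fun x y : exists g : nat -> G,
  [/\ g 0 = x, g (gdist x y) = y & forall i, i < gdist x y -> adj (g i) (g i.+1)].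
Proof.
have [p [pp lp sp]] := gdist_walk hc x y; exists (nth x (x :: p)); split=> //.
  by rewrite -sp -lp; case: p {pp lp sp} => //= a p; rewrite (last_nth x).
by move=> i; rewrite -sp; move/(pathP x): pp => h /h.
Qed.

Lemma conditions_convex_balls : convex_balls G.
Proof.
move=> r v x y hx hy u /= hu; rewrite /vball /= in hx hy *.
rewrite leqNgt; apply/negP => ru.
have [g [g0 gl ga]] := geodesic_fun x u; have [h [h0 hl ha]] := geodesic_fun u y.
set m := gdist x u in hu gl ga; set n := gdist u y in hu hl ha.
pose f i := if i <= m then g i else h (i - m).
have fm : f m = u by rewrite /f leqnn.
have f0 : f 0 = x by [].
have fl : f (m + n) = y.
  rewrite /f; case: leqP => e; last by rewrite addnC addnK.
  have n0 : n = 0 by nlia.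
  by rewrite n0 addn0 gl -h0 -{1}n0 hl.
have fa i : i < m + n -> adj (f i) (f i.+1).
  move=> imn; rewrite /f; case: ltnP => im; first by rewrite ltnW //; apply: ga.
  case: leqP => im'.
    have -> : i = m by nlia.
    by rewrite gl -h0 subSnn; apply: ha; nlia.
  by rewrite subSn //; apply: ha; nlia.
(* The highest level k met on the geodesic through u, its first occurrence i and the first index i +
   l at which it is left cut out a bump with a plateau of length l. *)
pose P k := `[< exists2 i, i <= m + n & gdist v (f i) = k >].
have exP : exists k, P k by exists (gdist v u); apply/asboolP; exists m; rewrite ?fm //; nlia.
have ubP k : P k -> k <= gdist v x + (m + n).
  move=> /asboolP[i im <-]; have := gdist_tri hc v x (f i).
  by have := walk_dist fa (leq0n i) im; rewrite f0; nlia.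
case: (ex_maxnP exP ubP) => k /asboolP[i0 i0m ki0] kmax.
have le_k i : i <= m + n -> gdist v (f i) <= k.
  by move=> im; apply: kmax; apply/asboolP; exists i.
have rk : r < k by apply: leq_trans ru _; rewrite -fm; apply: le_k; nlia.
have exQ : exists i, (i <= m + n) && (gdist v (f i) == k) by exists i0; rewrite i0m ki0 eqxx.
case: (ex_minnP exQ) => i /andP[im /eqP ki] imin.
have ipos : 0 < i by rewrite lt0n; apply/eqP => e; move: ki; rewrite e f0; nlia.
have exR : exists l, (i < i + l) && (gdist v (f (i + l)) != k).
  exists (m + n - i); rewrite subnKC // fl; apply/andP; split.
    rewrite ltn_neqAle im andbT; apply/eqP => e; move: ki; rewrite e fl; nlia.
  by apply/eqP; nlia.
case: (ex_minnP exR) => l /andP[l0 /eqP kl] lmin.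
have lm : i + l <= m + n.
  have := lmin (m + n - i); rewrite subnKC // fl.
  have -> : gdist v y != k by apply/eqP; nlia.
  rewrite andbT; have -> : i < m + n; last by move=> /(_ isT); nlia.
  rewrite ltn_neqAle im andbT; apply/eqP => e; move: ki; rewrite e fl; nlia.
have run j : 0 < j -> j <= l -> gdist v (f (i + j - 1)) = k.
  move=> j0 jl; case: (posnP (j - 1)) => e; first by have -> : i + j - 1 = i by nlia.
  apply/eqP/negPn/negP => nk; have := lmin (j - 1).
  have -> : i + (j - 1) = i + j - 1 by nlia.
  by rewrite nk andbT => H; have := H ltac:(nlia); nlia.
have d0 : gdist v (f (i - 1)) + 1 = k.
  have := fa (i - 1) ltac:(nlia); rewrite -[(i - 1).+1]addn1 subnK // => /(gdist_adj2 hc v).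
  have := le_k (i - 1) ltac:(nlia).
  have : gdist v (f (i - 1)) <> k.
    by move=> e; have := imin (i - 1); rewrite e eqxx andbT => H; have := H ltac:(nlia); nlia.
  by rewrite ki; nlia.
have dl : gdist v (f (i + l)) + 1 = k.
  have := fa (i + l - 1) ltac:(nlia); rewrite -[(i + l - 1).+1]addn1 subnK; last by nlia.
  move/(gdist_adj2 hc v); have := le_k (i + l) ltac:(nlia).
  by rewrite run //; nlia.
apply: (@no_bump v k l (fun j => f (i + j - 1))) => //; first by nlia.
- move=> j jl; have -> : i + j.+1 - 1 = (i + j - 1).+1 by nlia.
  by apply: fa; nlia.
- by rewrite addn0.
- by have -> : i + l.+1 - 1 = i + l by nlia.
have -> : i + 0 - 1 = i - 1 by nlia.
have -> : i + l.+1 - 1 = i + l by nlia.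
have h1 := walk_dist fa (_ : i - 1 <= i + l) lm.
have h2 := walk_dist fa (leq0n (i - 1)) (_ : i - 1 <= m + n).
have h3 := walk_dist fa lm (leqnn _).
have h4 := gdist_tri hc x (f (i - 1)) y.
have h5 := gdist_tri hc (f (i - 1)) (f (i + l)) y.
rewrite f0 fl in h2 h3 h4.
have hxy : m + n = gdist x y := hu.
have := h1 ltac:(nlia); have := h2 ltac:(nlia); nlia.
Qed.

End ConditionsToConvexity.

(** * The covering built over a base point *)

(** The vertices d and d' are opposite to the common edge ab. Degenerate gluings are included, so
    the bound can be applied without checking that the union is an induced PP_1. *)
Definition pp_close (G : sgraph) := forall a b c d e c' d' e' : G,
  pent a b c d e -> pent a b c' d' e' -> gdist d d' <= 3.

Section Stages.
Variable G : sgraph.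
Hypothesis hc : forall u v : G, exists n, has_walk u v n.
Hypothesis inc3 : forall v u : G, gdist v u <= 3 -> incp v u.
Hypothesis tpc3 : forall v x y : G, adj x y -> gdist v x = gdist v y ->
  gdist v x <= 3 -> tpcp v x y.
Hypothesis pp : pp_close G.
Implicit Types (v g : G).

Let cl3 v u : gdist v u <= 3 -> par_clique v u.
Proof. by move=> h; apply/incp_clique/inc3. Qed.

Let sqf : square_free G.
Proof. by apply: (square_free_of_clique hc) => q u h; apply: cl3; nlia. Qed.

Let prescribed v x y b k : 2 <= k <= 3 -> gdist v x = k -> gdist v y = k -> adj x y ->
  par v x b -> exists w t, [/\ par v y w, par v b t & par v w t].
Proof.
move=> /andP[k2 k3] dx dy xy; apply: (tpcp_prescribed hc cl3 _ _ _ k2 dx dy xy).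
- by apply: inc3; rewrite dx.
- by move=> a [_ da]; apply: inc3; nlia.
- by apply: tpc3 => //; rewrite dx.
Qed.

Lemma pent_neq (a b c d e : G) : pent a b c d e -> a <> c /\ b <> d.
Proof.
move=> /andP[/and5P[ab bc cd de ea] /and5P[ac ad bd be ce]].
by split=> h; [move: cd ad|move: ab ad]; rewrite h => ->.
Qed.

(* A covering of G, known only on the vertices of small level: neighbours lift
   at the vertices of level less than n, and a pentagon lifts if one of its
   vertices has level at most k - 2. *)
Record pcover (n k : nat) := PCover {
  sv :> Type;
  sf : sv -> G;
  sl : sv -> nat;
  sa : sv -> sv -> Prop;
  s_sym : forall x y, sa x y -> sa y x;
  s_step : forall x y, sa x y -> sl x <= (sl y).+1;
  s_adj : forall x y, sa x y -> adj (sf x) (sf y);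
  s_li : forall x y z, sa x y -> sa x z -> sf y = sf z -> y = z;
  s_tr : forall x y z, sa x y -> sa x z -> adj (sf y) (sf z) -> sa y z;
  s_su : forall x g, sl x < n -> adj (sf x) g -> exists y, sa x y /\ sf y = g;
  s_pent : forall c x1 x0 x3 x4, sl c + 2 <= k -> sa c x1 -> sa x1 x0 ->
    sa c x3 -> sa x3 x4 -> pent (sf x0) (sf x1) (sf c) (sf x3) (sf x4) -> sa x0 x4 }.

Section Charts.
Variables (n k : nat) (Z : pcover n k).
Implicit Types (p q r s t x y z a b c : Z).

Definition spar x y := sa x y /\ sl x = (sl y).+1.

(** Balls are defined through [sa], since the level is only 1-Lipschitz and a cover carries no
    distance of its own. *)
Definition sB1 p q := p = q \/ sa p q.
Definition sB2 p q := exists m, sB1 p m /\ sB1 m q.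
Definition sB3 p q := exists m, sB2 p m /\ sB1 m q.

Lemma sB1_lvl p q : sB1 p q -> sl q <= (sl p).+1.
Proof. by case=> [->//|/s_sym/s_step]. Qed.

Lemma sB2_lvl p q : sB2 p q -> sl q <= sl p + 2.
Proof. by case=> m [/sB1_lvl h1 /sB1_lvl h2]; lia. Qed.

Lemma sB1_dist v p q : sB1 p q -> gdist v (sf q) <= gdist v (sf p) + 1.
Proof. by case=> [->|/s_adj h]; [lia|apply: gdist_step]. Qed.

Lemma sB2_dist v p q : sB2 p q -> gdist v (sf q) <= gdist v (sf p) + 2.
Proof. by case=> m [/(sB1_dist v) h1 /(sB1_dist v) h2]; lia. Qed.

Lemma sB2_1 p q : sB1 p q -> sB2 p q.
Proof. by exists q; split=> //; left. Qed.

Lemma sB3_2 p q : sB2 p q -> sB3 p q.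
Proof. by exists q; split=> //; left. Qed.

Lemma sB2_cases p x : sB2 p x -> [\/ x = p, sa p x |
  gdist (sf p) (sf x) = 2 /\ exists m, sa p m /\ sa m x].
Proof.
case=> m [[<-|pm] [<-|mx]]; [by constructor 1|by constructor 2|by constructor 2|].
have [e|/eqP ne] := eqVneq (sf x) (sf p).
  by constructor 1; apply: (s_li mx) => //; apply: s_sym.
case pxa : (adj (sf p) (sf x)).
  by constructor 2; apply: (s_tr (x := m)) => //; apply: s_sym.
constructor 3; split; last by exists m.
by apply: (gdist2 hc (s_adj pm) (s_adj mx)); [move=> e; apply: ne|rewrite pxa].
Qed.

(** Points at distance 2 from p are compared through their parents seen from [sf p]: these form a
    clique in G and lie in the star of p, where [s_li] and [s_tr] apply. An edge between two points
    at distance 2 is the case that calls for the lifting of pentagons. *)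
Lemma chart2 p x y : sl p + 2 <= k -> sB2 p x -> sB2 p y ->
  (sf x = sf y -> x = y) /\ (adj (sf x) (sf y) -> sa x y).
Proof.
move=> pk.
have c12 (u w m : Z) : sa p u -> gdist (sf p) (sf w) = 2 -> sa p m -> sa m w ->
    (sf u = sf w -> u = w) /\ (adj (sf u) (sf w) -> sa u w).
  move=> pu dw pm mw; split=> h.
    by move: dw; rewrite -h (adj_gdist hc (s_adj pu)).
  have hu := adj_gdist hc (s_adj pu); have hm := adj_gdist hc (s_adj pm).
  have hwu : adj (sf w) (sf u) by rewrite adj_sym.
  have hwm : adj (sf w) (sf m) by apply/s_adj/s_sym.
  case: (@cl3 (sf p) (sf w) _ (sf u) (sf m)); rewrite ?dw //.
  - by split=> //; rewrite hu dw.
  - by split=> //; rewrite hm dw.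
  - by move=> /(s_li pu pm) ->.
  - by move=> /(s_tr pu pm) um; apply: (s_tr (x := m)) => //; apply: s_sym.
move=> /sB2_cases hx /sB2_cases hy; case: hx => [->|px|[dx [a [pa ax]]]];
    case: hy => [->|py|[dy [b [pb by_]]]]; split=> // h.
- by rewrite adj_irr in h.
- by case: (adj_neq (s_adj py)).
- by move: dy; rewrite -h gdistxx.
- by move: dy; rewrite (adj_gdist hc h).
- by case: (adj_neq (s_adj px)).
- exact: s_sym.
- exact: (s_li px py).
- exact: (s_tr px py).
- exact: (proj1 (c12 _ _ _ px dy pb by_)).
- exact: (proj2 (c12 _ _ _ px dy pb by_)).
- by move: dx; rewrite h gdistxx.
- by rewrite adj_sym in h; move: dx; rewrite (adj_gdist hc h).
- exact/esym/(proj1 (c12 _ _ _ py dx pa ax))/esym.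
- by apply/s_sym/(proj2 (c12 _ _ _ py dx pa ax)); rewrite adj_sym.
- have ha := adj_gdist hc (s_adj pa); have hb := adj_gdist hc (s_adj pb).
  have hxa : adj (sf x) (sf a) by apply/s_adj/s_sym.
  have hxb : adj (sf x) (sf b) by rewrite h; apply/s_adj/s_sym.
  case: (@cl3 (sf p) (sf x) _ (sf a) (sf b)); rewrite ?dx //.
  + by split=> //; rewrite ha dx.
  + by split=> //; rewrite hb dx.
  + by move=> /(s_li pa pb) eab; apply: (s_li ax) => //; rewrite eab.
  + move=> ab; have sab := s_tr pa pb ab.
    have xb := s_tr ax sab hxb.
    exact: (s_li (s_sym xb) by_).
- have hba : adj (sf b) (sf y) := s_adj by_.
  have hax : adj (sf a) (sf x) := s_adj ax.
  case axy : (adj (sf a) (sf y)).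
    have ay := proj2 (c12 _ _ _ pa dy pb by_) axy.
    exact: (s_tr ax ay).
  case bxy : (adj (sf b) (sf x)).
    have bx := proj2 (c12 _ _ _ pb dx pa ax) bxy.
    exact: (s_tr bx by_).
  case ab : (adj (sf a) (sf b)).
    have yb : adj (sf y) (sf b) by rewrite adj_sym.
    have ba : adj (sf b) (sf a) by rewrite adj_sym.
    case: (sqf hax h yb ba) => [e|e|e|e].
    - by move: (adj_gdist hc (s_adj pa)); rewrite e dy.
    - by move: (adj_gdist hc (s_adj pb)); rewrite -e dx.
    - by rewrite e in axy.
    - by rewrite adj_sym e in bxy.
  apply/s_sym; apply: (s_pent pk pb by_ pa ax).
  apply: pentE; rewrite ?(adj_sym (sf y)) //.
  + by rewrite adj_sym; apply: s_adj.
  + exact: s_adj.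
  + by apply/negP => /(adj_gdist hc); rewrite dy.
  + by rewrite axy.
  + by rewrite adj_sym ab.
  + by rewrite bxy.
  + by apply/negP => /(adj_gdist hc); rewrite dx.
Qed.

Lemma lift1 p g : sl p < n -> gdist (sf p) g <= 1 -> exists y, sB1 p y /\ sf y = g.
Proof.
move=> pn /(gdist_le1 hc)[<-|h]; first by exists p; split=> //; left.
by have [y [py fy]] := s_su pn h; exists y; split=> //; right.
Qed.

Lemma lift2 p g : sl p + 2 <= n -> gdist (sf p) g <= 2 -> exists y, sB2 p y /\ sf y = g.
Proof.
move=> pn; rewrite leq_eqVlt => /orP[/eqP|] h; last first.
  by have [//|y [py fy]] := @lift1 p g ltac:(nlia); exists y; split=> //; apply: sB2_1.
have [m [pm mg]] := @gdist2_mid _ hc (sf p) g h.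
have pn' : sl p < n by nlia.
have [y [py fy]] := s_su pn' pm.
have := s_step (s_sym py); rewrite -fy in mg => hl.
have yn : sl y < n by nlia.
have [z [yz fz]] := s_su yn mg.
by exists z; split=> //; exists y; split; right.
Qed.

Lemma lift3 p g : sl p + 3 <= n -> gdist (sf p) g <= 3 -> exists y, sB3 p y /\ sf y = g.
Proof.
move=> pn; rewrite leq_eqVlt => /orP[/eqP|] h; last first.
  by have [//|y [py fy]] := @lift2 p g ltac:(nlia); exists y; split=> //; apply: sB3_2.
have [m [pm mg]] := @gdist_split _ hc (sf p) g 2 1 h.
have [|y [py fy]] := @lift2 p m ltac:(nlia); first by rewrite pm.
have hl := sB2_lvl py; rewrite -fy in mg.
have [|z [yz fz]] := @lift1 y g ltac:(nlia); first by rewrite mg.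
by exists z; split=> //; exists y.
Qed.

Lemma spar_sym x y : spar x y -> sa y x.
Proof. by case=> /s_sym. Qed.

Lemma ancestor2_dist x a s : spar x a -> spar a s ->
  gdist (sf s) (sf x) = 2.
Proof.
move=> pa ps.
case: (@sB2_cases s x); last by case.
- by exists a; split; right; apply: spar_sym.
- by move=> e; case: pa ps => _ h [_ h']; move: h; rewrite e; nlia.
- by move/s_sym/s_step; case: pa ps => _ h [_ h']; nlia.
Qed.

(* Two pentagons sharing the edge x1 c: the one above spanned by g0 .. g4 and
   the one below provided by the absence of a common parent. *)
Lemma pent_below c x1 v0' v3 v4 b b1 r :
  sa c x1 -> (forall w, spar c w -> spar x1 w -> False) ->
  spar c b -> spar x1 b1 -> spar b r -> spar b1 r ->
  pent v0' (sf x1) (sf c) v3 v4 -> gdist (sf r) v4 <= 3.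
Proof.
move=> c1 ncp pb pb1 br b1r pe.
have lc : sl c = sl x1 by case: pb pb1 br b1r => _ -> [_ ->] [_ ->] [_ ->].
have nx1b : ~~ adj (sf x1) (sf b).
  apply/negP => h; apply: (ncp b) => //; split; first exact: s_tr c1 (proj1 pb) h.
  by case: pb => _ <-.
have ncb1 : ~~ adj (sf c) (sf b1).
  apply/negP => h; apply: (ncp b1) => //; split; last by case: pb1 => _ <-.
  by apply: s_tr (s_sym c1) (proj1 pb1) h.
rewrite gdistC //.
apply: (pp (a := sf x1) (b := sf c) (c := v3) (d := v4) (e := v0')
  (c' := sf b) (d' := sf r) (e' := sf b1)).
  by rewrite -pent_rot.
apply: pentE => //.
- exact/s_adj/s_sym.
- by apply: s_adj; case: pb.
- by apply: s_adj; case: br.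
- by apply/s_adj/spar_sym.
- by apply/s_adj/spar_sym.
- apply/negP => h; have := s_tr (spar_sym pb1) (proj1 b1r) h => /s_step.
  by case: pb1 b1r => _ -> [_ ->]; nlia.
- apply/negP => h; have := s_tr (spar_sym pb) (proj1 br) h => /s_step.
  by case: pb br => _ -> [_ ->]; nlia.
- apply/negP => h.
  have h1 : adj (sf b1) (sf x1) by apply/s_adj/spar_sym.
  have h2 : adj (sf x1) (sf c) by apply/s_adj/s_sym.
  have h3 : adj (sf c) (sf b) by apply: s_adj; case: pb.
  case: (sqf h1 h2 h3 h) => [e|e|e|e].
  + by case: pb1 => q1 q2; move: q2; rewrite (s_li q1 (s_sym c1) e); nlia.
  + by case: pb => q1 q2; move: q2; rewrite -(s_li c1 q1 e); nlia.
  + by rewrite adj_sym e in ncb1.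
  + by rewrite e in nx1b.
Qed.

Hypothesis kn : k <= n.

Lemma sB3_cases p x : sl p + 2 <= k -> sB3 p x -> sB2 p x \/
  gdist (sf p) (sf x) = 3 /\ exists m, sB2 p m /\ sa m x.
Proof.
move=> pk [m [pm [<-|mx]]]; first by left.
have h1 := sB2_dist (sf p) pm; rewrite gdistxx in h1.
have h2 := gdist_step hc (sf p) (s_adj mx).
have [h|h] := leqP (gdist (sf p) (sf x)) 2; last first.
  by right; split; [nlia|exists m].
left; have [y [py fy]] := @lift2 p (sf x) ltac:(nlia) h.
have my := proj2 (chart2 pk pm py); rewrite fy in my.
by rewrite (s_li mx (my (s_adj mx)) (esym fy)).
Qed.

Lemma chart3 p x y : sl p + 3 <= k -> sB3 p x -> sB3 p y ->
  (sf x = sf y -> x = y) /\ (adj (sf x) (sf y) -> sa x y).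
Proof.
move=> pk3; have pk : sl p + 2 <= k by nlia.
have c23 (u w m : Z) : sB2 p u -> gdist (sf p) (sf w) = 3 -> sB2 p m -> sa m w ->
    (sf u = sf w -> u = w) /\ (adj (sf u) (sf w) -> sa u w).
  move=> pu dw pm mw.
  have h1 := sB2_dist (sf p) pm; rewrite gdistxx in h1.
  have h2 := gdist_step hc (sf p) (s_adj mw).
  have h3 := sB2_dist (sf p) pu; rewrite gdistxx in h3.
  split=> h; first by move: h3; rewrite h dw.
  have h4 := gdist_step hc (sf p) h.
  have p1 : par (sf p) (sf w) (sf u) by split; [rewrite adj_sym|nlia].
  have p2 : par (sf p) (sf w) (sf m) by split; [apply/s_adj/s_sym|nlia].
  case: (@cl3 (sf p) (sf w) (eq_leq dw) _ _ p1 p2).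
    by move=> /(proj1 (chart2 pk pu pm)) ->.
  by move=> /(proj2 (chart2 pk pu pm)) /s_sym um; apply: (s_tr um mw).
move=> /(sB3_cases pk) hx /(sB3_cases pk) hy.
case: hx => [px|[dx [m [pm mx]]]]; case: hy => [py|[dy [m' [pm' my]]]].
- exact: (chart2 pk px py).
- exact: (c23 _ _ _ px dy pm' my).
- have [e1 e2] := c23 _ _ _ py dx pm mx; split=> [/esym/e1/esym //|h].
  by apply/s_sym/e2; rewrite adj_sym.
have h1 := sB2_dist (sf p) pm; rewrite gdistxx in h1.
have h2 := gdist_step hc (sf p) (s_adj mx).
have h1' := sB2_dist (sf p) pm'; rewrite gdistxx in h1'.
have h2' := gdist_step hc (sf p) (s_adj my).
have p1 : par (sf p) (sf x) (sf m) by split; [apply/s_adj/s_sym|nlia].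
have p2 : par (sf p) (sf y) (sf m') by split; [apply/s_adj/s_sym|nlia].
split=> h.
  rewrite -h in p2; case: (@cl3 (sf p) (sf x) (eq_leq dx) _ _ p1 p2).
    by move=> /(proj1 (chart2 pk pm pm')) e; rewrite -e in my; apply: s_li mx my h.
  move=> /(proj2 (chart2 pk pm pm')) mm'.
  have xm' := s_tr mx mm' (proj1 p2).
  exact: (s_li (s_sym xm') my h).
(* For an edge between two points at distance 3, TPC in G gives a neighbour kap of the centre within
   2 of both. Its lift K has level at most one above that of p, so the bound with 3 leaves a chart
   of radius 2 about K. *)
have [w [kap [pw pk1 pk2]]] := @prescribed (sf p) (sf x) (sf y) (sf m) 3 isT dx dy h p1.
have dk : gdist (sf p) kap = 1 by case: pk1; nlia.
have pn : sl p < n by nlia.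
have [K [pK fK]] := s_su pn (gdist1 hc dk).
have lK := s_step (s_sym pK).
have BK : sB2 p K by apply: sB2_1; right.
have Km : sa K m.
  by apply: (proj2 (chart2 pk BK pm)); rewrite fK adj_sym; case: pk1.
have Kw : adj (sf K) w by rewrite fK adj_sym; case: pk2.
have Kn : sl K < n by nlia.
have [W [KW fW]] := s_su Kn Kw.
have BW : sB2 p W by exists K; split; right.
rewrite -fW in pw.
have Wy : sa W y.
  case: (@cl3 (sf p) (sf y) (eq_leq dy) _ _ pw p2).
    by move=> /(proj1 (chart2 pk BW pm')) ->.
  move=> /(proj2 (chart2 pk BW pm')) Wm.
  by apply: (s_tr (s_sym Wm) my); rewrite adj_sym; case: pw.
apply: (proj2 (@chart2 K x y _ _ _)) => //; first by nlia.
  by exists m; split; right.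
by exists W; split; right.
Qed.

Lemma ancestor3_dist x a s p : sl p + 2 <= k -> spar x a -> spar a s -> spar s p ->
  gdist (sf p) (sf x) = 3.
Proof.
move=> pk pa ps pp'.
have Ba : sB2 p a by exists s; split; right; apply: spar_sym.
case: (@sB3_cases p x pk); last by case.
  by exists a; split=> //; right; apply: spar_sym.
by move=> /sB2_lvl; case: pa ps pp' => _ -> [_ ->] [_ ->]; nlia.
Qed.

(** The vertices x0 and x4 are not assumed to lie in the ball about r. The lifts of their images
    inside the ball coincide with them, being neighbours of x1 and x3 with the same images. *)
Lemma chart3_close r c x1 x0 x3 x4 : sl r + 3 <= k -> sB2 r c ->
  sa c x1 -> sa x1 x0 -> sa c x3 -> sa x3 x4 ->
  gdist (sf r) (sf x0) <= 3 -> gdist (sf r) (sf x4) <= 3 ->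
  adj (sf x0) (sf x4) -> sa x0 x4.
Proof.
move=> rk rc c1 a1 c3 a3 d0 d4 a04.
have B1 : sB3 r x1 by exists c; split=> //; right.
have B3 : sB3 r x3 by exists c; split=> //; right.
have rn : sl r + 3 <= n by nlia.
have [y0 [By0 f0]] := lift3 rn d0; have [y4 [By4 f4]] := lift3 rn d4.
have h0 : sa x1 y0 by apply: (proj2 (chart3 rk B1 By0)); rewrite f0; apply: s_adj.
have h4 : sa x3 y4 by apply: (proj2 (chart3 rk B3 By4)); rewrite f4; apply: s_adj.
have <- := s_li h0 a1 f0; have <- := s_li h4 a3 f4.
by apply: (proj2 (chart3 rk By0 By4)); rewrite f0 f4.
Qed.

End Charts.

Section StageDef.
Variable v0 : G.

(* A stage of depth n models the ball of radius n around the base point of the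
   universal cover, the level being the distance to the base point. *)
Record stage (n k : nat) := Stage {
  st :> pcover n k;
  s_le : forall x : st, sl x <= n;
  s_root : exists r : st, [/\ sl r = 0, sf r = v0 & forall x : st, sl x = 0 -> x = r];
  s_par : forall x : st, 0 < sl x -> exists y, spar x y;
  s_inc : forall x y z : st, spar x y -> spar x z ->
    y = z \/ sa y z /\ exists t, spar y t /\ spar z t;
  s_tpc : forall x y b : st, 2 <= sl x -> sl x = sl y -> sa x y -> spar x b ->
    exists b' t, [/\ spar y b', spar b t & spar b' t];
  s_gp : forall x y b c t : st, spar x b -> spar y c -> spar b t -> spar c t ->
    adj (sf x) (sf y) -> sa x y }.

Lemma common_parent2 n k (Z : stage n k) (x s t : Z) : spar x s -> spar x t ->
  2 <= sl x -> exists p, spar s p /\ spar t p.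
Proof.
move=> ps pt x2; case: (s_inc ps pt) => [<-|[_ //]].
have [p psp] := @s_par _ _ Z s ltac:(case: ps => _; nlia).
by exists p.
Qed.


(** * Closing pentagons one level higher *)

Section PentStep.
Variable k : nat.
Variable Z : stage k.+1 k.
Hypothesis k3 : 3 <= k.
Implicit Types (p q r s t x y z a b c : Z).

Let kk : k <= k.+1 := leqnSn k.

Let close c x0 x1 x3 x4 :=
  sa c x1 -> sa x1 x0 -> sa c x3 -> sa x3 x4 ->
  pent (sf x0) (sf x1) (sf c) (sf x3) (sf x4) -> sa x0 x4.

Let close_sym c x0 x1 x3 x4 : close c x4 x3 x1 x0 -> close c x0 x1 x3 x4.
Proof. by move=> h c1 a1 c3 a3 pe; apply/s_sym/h => //; rewrite pent_rev. Qed.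

Let dist2 r c x1 x0 : sB2 r c -> gdist (sf r) (sf x1) <= 2 -> sa x1 x0 ->
  gdist (sf r) (sf x0) <= 3.
Proof. by move=> _ h /s_adj h'; have := gdist_step hc (sf r) h'; nlia. Qed.

Let gp_B2 x b r : spar x b -> spar b r -> sB2 r x.
Proof. by move=> h h'; exists b; split; right; apply: spar_sym. Qed.

Let gp_dist x b r : spar x b -> spar b r -> gdist (sf r) (sf x) <= 2.
Proof. by move=> h h'; rewrite (ancestor2_dist h h'). Qed.

(** With c on level k - 1, a vertex r two levels lower still has a chart of radius 3, and x0, x4
    must be shown to be within 3 of it. A parent shared by c and x1 gives this through TPC along c
    x3; if there is none, the pentagon below the edge c x1 and the bound on PP_1 do. *)
Let level_close c x0 x1 x3 x4 : sl c + 1 = k -> sl x1 = sl c -> sl x3 = sl c ->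
  close c x0 x1 x3 x4.
Proof.
move=> lc l1 l3 c1 a1 c3 a3 pe.
have a04 : adj (sf x0) (sf x4) by move: pe => /andP[/and5P[_ _ _ _ ?] _]; rewrite adj_sym.
have cpos : 2 <= sl c by nlia.
have [[w [cw x1w]]|ncp] := pselect (exists w, spar c w /\ spar x1 w).
  have [b [r [x3b wr br]]] := s_tpc cpos (esym l3) c3 cw.
  have rk : sl r + 3 <= k by case: cw wr => _ h [_ h']; nlia.
  have Bc := gp_B2 cw wr.
  by apply: (chart3_close kk rk Bc c1 a1 c3 a3) => //;
    apply: (dist2 Bc _ _); try eassumption; [apply: (gp_dist x1w wr)|apply: (gp_dist x3b br)].
have [b cb] : exists b, spar c b by apply: s_par; nlia.
have [b1 [r [x1b1 br b1r]]] := s_tpc cpos (esym l1) c1 cb.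
have rk : sl r + 3 <= k by case: cb br => _ h [_ h']; nlia.
have Bc := gp_B2 cb br.
apply: (chart3_close kk rk Bc c1 a1 c3 a3) => //.
  by apply: (dist2 Bc _ a1); apply: (gp_dist x1b1 b1r).
apply: (pent_below c1 _ cb x1b1 br b1r pe).
by move=> w h1 h2; apply: ncp; exists w.
Qed.

(** Seen from x1, whose level is low enough, the same pentagon is already known to close. This
    yields a lift of [sf x4] adjacent to both x0 and x3, which must be x4. *)
Let close_low1 c x0 x1 x3 x4 : sl c + 1 = k -> sl x1 < sl c -> close c x0 x1 x3 x4.
Proof.
move=> lc l1 c1 a1 c3 a3 pe.
have l0 := s_step (s_sym a1).
have g04 : adj (sf x0) (sf x4) by move: pe => /andP[/and5P[_ _ _ _ ?] _]; rewrite adj_sym.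
have [y [x0y fy]] := @s_su _ _ Z x0 (sf x4) ltac:(nlia) g04.
have y3 : sa y x3.
  apply: (s_pent (c := x1) (x1 := x0) (x3 := c)) => //; [nlia|exact: s_sym|].
  by rewrite fy pent_rot.
by rewrite -(s_li (s_sym y3) a3 fy).
Qed.

Let close_low0 c x0 x1 x3 x4 : sl c + 1 = k -> sl x0 < sl c -> close c x0 x1 x3 x4.
Proof.
move=> lc l0 c1 a1 c3 a3 pe.
have g04 : adj (sf x0) (sf x4) by move: pe => /andP[/and5P[_ _ _ _ ?] _]; rewrite adj_sym.
have g34 : adj (sf x4) (sf x3) by apply/s_adj/s_sym.
have [y [x0y fy]] := @s_su _ _ Z x0 (sf x4) ltac:(nlia) g04.
have ly := s_step (s_sym x0y).
rewrite -fy in g34.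
have [y3 [yy3 fy3]] := @s_su _ _ Z y (sf x3) ltac:(nlia) g34.
have cy3 : sa y3 c.
  apply: (s_pent (c := x0) (x1 := y) (x3 := x1)) => //; [nlia|exact: s_sym|exact: s_sym|].
  by rewrite fy fy3 2!pent_rot.
have e3 := s_li (s_sym cy3) c3 fy3; rewrite e3 in yy3.
by rewrite -(s_li (s_sym yy3) a3 fy).
Qed.

(** The descent from x4 to t puts [sf x4] at distance 3 from [sf t]; seen from there, the images of
    x3 and x0 are two of its parents. *)
Let top_clash c x0 x3 x4 t : sl t + 2 <= k -> spar x4 x3 -> spar x3 c -> spar c t ->
  gdist (sf t) (sf x0) <= 2 -> adj (sf x4) (sf x0) -> sf x3 = sf x0 \/ adj (sf x3) (sf x0).
Proof.
move=> tk p43 p3c pct d0 a40.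
have d4 := ancestor3_dist kk tk p43 p3c pct; have d3 := ancestor2_dist p3c pct.
have h := gdist_adj2 hc (sf t) a40.
apply: (cl3 (eq_leq d4)); split=> //; try by nlia.
by apply: s_adj; case: p43.
Qed.

Let parents_clash c x0 x1 v3 v4 : spar x1 c -> spar x1 x0 ->
  pent (sf x0) (sf x1) (sf c) v3 v4 -> False.
Proof.
move=> p1 p2 pe; have [ne _] := pent_neq pe.
case: (s_inc p1 p2) => [e|[/s_adj h _]]; first by apply: ne; rewrite e.
by move: pe => /andP[_ /and5P[]]; rewrite adj_sym h.
Qed.

(** No vertex is below c. Each distribution of levels leads to a common ancestor whose chart
    contains the missing edge, to two parents of one vertex that would be adjacent inside an induced
    pentagon, or to the flat case with centre x1. When x0 and x4 are both two levels above c, [s_gp]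
    supplies the edge: this is what that condition on stages is for. *)
Let close_main c x0 x1 x3 x4 : sl c + 1 = k -> sl c <= sl x1 -> sl x1 <= sl x3 ->
  sl c <= sl x0 -> sl c <= sl x4 -> (sl x1 = sl x3 -> sl x0 <= sl x4) ->
  close c x0 x1 x3 x4.
Proof.
move=> lc l1 l13 l0 l4 sy c1 a1 c3 a3 pe.
have h3 := s_step (s_sym c3); have h4 := s_step (s_sym a3); have h0 := s_step (s_sym a1).
have [ne1 _] := pent_neq pe.
have pe' : pent (sf x4) (sf x3) (sf c) (sf x1) (sf x0) by rewrite pent_rev.
have [ne2 _] := pent_neq pe'.
have a04 : adj (sf x0) (sf x4) by move: pe => /andP[/and5P[_ _ _ _ ?] _]; rewrite adj_sym.
have a40 : adj (sf x4) (sf x0) by rewrite adj_sym.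
have n30 : sf x3 <> sf x0 /\ ~~ adj (sf x3) (sf x0).
  split; last by move: pe => /andP[_ /and5P[_ ? _ _ _]]; rewrite adj_sym.
  have := pe; rewrite pent_rot => /pent_neq[_ h] e.
  by move: pe => /andP[/and5P[_ h1 _ _ _] /and5P[_ _ h2 _ _]]; move: h2; rewrite e adj_sym; case/negP; apply: s_adj; apply: s_sym.
have clash t : sl t + 2 <= k -> spar x4 x3 -> spar x3 c -> spar c t ->
    gdist (sf t) (sf x0) <= 2 -> False.
  move=> tk q1 q2 q3 q4; case: n30 => q5 q6.
  by case: (top_clash tk q1 q2 q3 q4 a40) => // q7; rewrite q7 in q6.
have [e3|e3] : sl x3 = sl c \/ sl x3 = (sl c).+1 by nlia.
  by apply: (@level_close c x0 x1 x3 x4) => //; nlia.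
have p3c : spar x3 c by split=> //; apply: s_sym.
have rotate : sl x1 = sl c -> sl x0 = sl c -> sa x0 x4.
  move=> e1 e0.
  have [y [x0y fy]] := @s_su _ _ Z x0 (sf x4) ltac:(nlia) a04.
  have y3 : sa y x3.
    apply: (@level_close x1 y x0 c x3) => //; try nlia; try exact: s_sym.
    by rewrite fy pent_rot.
  by rewrite -(s_li (s_sym y3) a3 fy).
have cpos : 2 <= sl c by nlia.
have by_chart (o b b' t : Z) : spar t o -> spar c t -> sa b' x0 -> sa b x4 -> sB2 o b' -> sB2 o b -> sa x0 x4.
  move=> pto pct h0' h4' B0 B4.
  have ok : sl o + 3 <= k by case: pto pct => _ q1 [_ q2]; nlia.
  have BB0 : sB3 o x0 by exists b'; split=> //; right.
  have BB4 : sB3 o x4 by exists b; split=> //; right.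
  exact: (proj2 (chart3 kk ok BB0 BB4)).
have [e4|[e4|e4]] : sl x4 = sl c \/ sl x4 = (sl c).+1 \/ sl x4 = (sl c).+2 by nlia.
- by case: (parents_clash p3c _ pe'); split=> //; nlia.
- have [b [t [x4b ct bt]]] : exists b t, [/\ spar x4 b, spar c t & spar b t].
    by apply: (@s_tpc _ _ Z x3 x4 c) => //; nlia.
  have [e1|e1] : sl x1 = sl c \/ sl x1 = (sl c).+1 by nlia.
    have [e0|e0] : sl x0 = sl c \/ sl x0 = (sl c).+1 by nlia.
      exact: rotate.
    have [t1 [om [x1t1 tto t1o]]] := s_tpc cpos (esym e1) c1 ct.
    apply: (by_chart om b x1 t) => //; first exact: spar_sym.
      exact: gp_B2 x1t1 t1o.
    exact: gp_B2 bt tto.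
  have p1c : spar x1 c by split=> //; apply: s_sym.
  have [e0|e0] : sl x0 = sl c \/ sl x0 = (sl c).+1 by have := sy ltac:(nlia); nlia.
    by case: (parents_clash p1c _ pe); split=> //; nlia.
  have [b0 [t0 [x0b0 ct0 b0t0]]] := @s_tpc _ _ Z x1 x0 c ltac:(nlia) ltac:(nlia) a1 p1c.
  have [om [tto t0o]] := common_parent2 ct ct0 cpos.
  apply: (by_chart om b b0 t) => //; try exact: spar_sym.
    exact: gp_B2 b0t0 t0o.
  exact: gp_B2 bt tto.
- have p43 : spar x4 x3 by split; [exact: s_sym|nlia].
  have [e1|e1] : sl x1 = sl c \/ sl x1 = (sl c).+1 by nlia.
    have [e0|e0] : sl x0 = sl c \/ sl x0 = (sl c).+1 by nlia.
      exact: rotate.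
    have [[w [cw x1w]]|ncp] := pselect (exists w, spar c w /\ spar x1 w).
      case: (clash w) => //; first by case: cw => _; nlia.
      have := gdist_step hc (sf w) (s_adj a1).
      by rewrite (adj_gdist hc (s_adj (spar_sym x1w))).
    have [b cb] : exists b, spar c b by apply: s_par; nlia.
    have [b1 [r [x1b1 br b1r]]] := s_tpc cpos (esym e1) c1 cb.
    have rk : sl r + 3 <= k by case: cb br => _ q1 [_ q2]; nlia.
    have d4 : gdist (sf r) (sf x4) <= 3.
      apply: (pent_below c1 _ cb x1b1 br b1r pe).
      by move=> w q1 q2; apply: ncp; exists w.
    have rn : sl r + 3 <= k.+1 by nlia.
    have [y [By fy]] := lift3 rn d4.
    have B3 : sB3 r x3 by exists c; split; [apply: gp_B2 cb br|right].
    have h34 := proj2 (chart3 kk rk B3 By); rewrite fy in h34.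
    have ey := s_li (h34 (s_adj a3)) a3 fy.
    (* By uniqueness x4 lies in the ball of radius 3 about r, but its level exceeds that of r by
       4. *)
    exfalso; case: By => m [/sB2_lvl q1 /sB1_lvl]; rewrite ey; nlia.
  have p1c : spar x1 c by split=> //; apply: s_sym.
  have [e0|[e0|e0]] : sl x0 = sl c \/ sl x0 = (sl c).+1 \/ sl x0 = (sl c).+2 by nlia.
  + by case: (parents_clash p1c _ pe); split=> //; nlia.
  + have [b0 [t0 [x0b0 ct0 b0t0]]] := @s_tpc _ _ Z x1 x0 c ltac:(nlia) ltac:(nlia) a1 p1c.
    case: (clash t0) => //; first by case: ct0 => _; nlia.
    exact: gp_dist x0b0 b0t0.
  + apply: (s_gp (b := x1) (c := x3) (t := c)) => //.
    by split; [exact: s_sym|nlia].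
Qed.

Lemma pent_step c x1 x0 x3 x4 : sl c + 2 <= k.+1 -> sa c x1 -> sa x1 x0 ->
  sa c x3 -> sa x3 x4 -> pent (sf x0) (sf x1) (sf c) (sf x3) (sf x4) -> sa x0 x4.
Proof.
move=> lc; rewrite leq_eqVlt in lc; case/orP: lc => [/eqP lc|lc]; last first.
  by move=> *; apply: (s_pent (c := c) (x1 := x1) (x3 := x3)) => //; nlia.
have {}lc : sl c + 1 = k by nlia.
suff: close c x0 x1 x3 x4 by [].
have [h|l1] := ltnP (sl x1) (sl c); first exact: close_low1.
have [h|l3] := ltnP (sl x3) (sl c); first by apply/close_sym/close_low1.
have [h|l0] := ltnP (sl x0) (sl c); first exact: close_low0.
have [h|l4] := ltnP (sl x4) (sl c); first by apply/close_sym/close_low0.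
have [h|[h|h]] : sl x1 < sl x3 \/ sl x3 < sl x1 \/ sl x1 = sl x3 by nlia.
- by apply: close_main => //; nlia.
- by apply: close_sym; apply: close_main => //; nlia.
- have [q|q] : sl x0 <= sl x4 \/ sl x4 <= sl x0 by nlia.
    by apply: close_main => //; nlia.
  by apply: close_sym; apply: close_main => //; nlia.
Qed.

End PentStep.

Section BaseStage.
Let T := {x : G | gdist v0 x <= 3}.
Let ta (x y : T) : Prop := adj (sval x) (sval y).
Let tl (x : T) := gdist v0 (sval x).

Let tpar (x y : T) : ta x y /\ tl x = (tl y).+1 <-> par v0 (sval x) (sval y).
Proof. by rewrite /ta /tl /par addn1; split=> -[h h']. Qed.

Let tinj (x y : T) : sval x = sval y -> x = y.
Proof. by case: x y => x hx [y hy] /= h; apply: eq_exist. Qed.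

Let tsym : forall x y, ta x y -> ta y x.
Proof.
by move=> x y; rewrite /ta adj_sym.
Qed.

Let tstep : forall x y, ta x y -> tl x <= (tl y).+1.
Proof.
by move=> x y /(gdist_adj2 hc v0)[h _]; rewrite addn1 in h.
Qed.

Let tadj : forall x y, ta x y -> adj (sval x) (sval y).
Proof.
by [].
Qed.

Let tli : forall x y z, ta x y -> ta x z -> sval y = sval z -> y = z.
Proof.
by move=> x y z _ _; apply: tinj.
Qed.

Let ttr : forall x y z, ta x y -> ta x z -> adj (sval y) (sval z) -> ta y z.
Proof.
by [].
Qed.

Let tsu : forall x g, tl x < 3 -> adj (sval x) g -> exists y, ta x y /\ sval y = g.
Proof.
move=> x g hx hg; have h := gdist_step hc v0 hg.
  have hy : gdist v0 g <= 3 by rewrite /tl in hx; nlia.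
  by exists (exist _ g hy).
Qed.

Let tpent : forall c x1 x0 x3 x4, tl c + 2 <= 3 -> ta c x1 -> ta x1 x0 ->
  ta c x3 -> ta x3 x4 -> pent (sval x0) (sval x1) (sval c) (sval x3) (sval x4) -> ta x0 x4.
Proof.
by move=> c x1 x0 x3 x4 _ _ _ _ _ /andP[/and5P[_ _ _ _ h] _]; rewrite /ta adj_sym.
Qed.

(** The ball of radius 3 of G is its own lift, and the assumptions at levels up to 3 are what the
    fields ask for. *)
Lemma base_stage : inhabited (stage 3 3).
Proof.
pose C := @PCover 3 3 T (fun x => sval x) tl ta tsym tstep tadj tli ttr tsu tpent.
apply: inhabits; apply: (@Stage 3 3 C).
- by case.
- have h0 : gdist v0 v0 <= 3 by rewrite gdistxx.
  exists (exist _ v0 h0); split=> //; first exact: gdistxx.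
  by move=> x /(gdist_eq0 hc) h; apply: tinj.
- move=> x; rewrite /spar /= /tl; case E : (gdist v0 (sval x)) => [//|l] _.
  have [y py] := par_exists hc E; have [_ dy] := py.
  have hy : gdist v0 y <= 3 by case: x E py dy => x /= hx E py dy; nlia.
  by exists (exist _ y hy); split; [case: py|rewrite /=; nlia].
- move=> x y z /tpar py /tpar pz; case: (inc3 (proj2_sig x) py pz) => [/tinj|[yz [t [pt pt']]]].
    by left.
  right; split=> //.
  have ht : gdist v0 t <= 3 by case: pt => _; case: y {py pt' yz} => y /= hy; nlia.
  by exists (exist _ t ht); split; apply/tpar.
- move=> x y b x2 xy axy /tpar pb.
  have [w [t [pw pt pt']]] := @prescribed v0 _ _ _ (tl x) (introT andP (conj x2 (proj2_sig x))) erefl (esym xy) axy pb.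
  have hw : gdist v0 w <= 3 by case: pw => _; case: y {xy axy} => y /= hy; nlia.
  have ht : gdist v0 t <= 3 by case: pt' => _; nlia.
  by exists (exist _ w hw), (exist _ t ht); split; apply/tpar.
- by [].
Qed.

End BaseStage.

(** * Adding a level *)

Section Grow.
Variable n : nat.
Variable Z : stage n n.
Hypothesis n3 : 3 <= n.
Implicit Types (p q r s t a b c : Z) (z : G).

(** The edge from [sf a] to z has no lift at a yet, so a vertex over z has to be added above a. *)
Definition extendable a z := [/\ sl a = n, adj (sf a) z & forall y, sa a y -> sf y <> z].

Definition siblings a z : set Z :=
  [set b | [/\ sl b = n, adj (sf b) z & b = a \/ sa a b]].

Let gp_B2 x b r : spar x b -> spar b r -> sB2 r x.
Proof. by move=> h h'; exists b; split; right; apply: spar_sym. Qed.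

Lemma extendable_parent a z s : extendable a z -> spar a s -> ~~ adj (sf s) z.
Proof.
move=> [la az nz] [as_ ls]; apply/negP => sz.
have [y [sy fy]] := @s_su _ _ Z s z ltac:(nlia) sz.
by apply: (nz y) => //; apply: s_tr (s_sym as_) sy _; rewrite fy.
Qed.

Lemma extendable_dist2 a z s : extendable a z -> spar a s -> gdist (sf s) z = 2.
Proof.
move=> h ps; have hn := extendable_parent h ps; case: h => la az nz.
apply: (gdist2 hc (s_adj (spar_sym ps)) az) => // e.
by apply: (nz s) => //; case: ps.
Qed.

Lemma extendable_dist3 a z s p : extendable a z -> spar a s -> spar s p ->
  gdist (sf p) z = 3.
Proof.
move=> [la az nz] ps pp'.
have lp : sl p + 2 = n by case: ps pp' => _ h [_ h']; nlia.
have h := gdist_step hc (sf p) az.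
have h2 := sB2_dist (sf p) (gp_B2 ps pp'); rewrite gdistxx in h2.
have [d2|d2] := leqP (gdist (sf p) z) 2; last by nlia.
have [y [py fy]] := @lift2 _ _ Z p z (eq_leq lp) d2.
case: (nz y) => //.
by apply: (proj2 (chart2 (eq_leq lp) (gp_B2 ps pp') py)); rewrite fy.
Qed.

Lemma ex_grandparent a : sl a = n -> exists s p, spar a s /\ spar s p.
Proof.
move=> la; have [s ps] := @s_par _ _ Z a ltac:(nlia).
by have [p pp'] := @s_par _ _ Z s ltac:(case: ps => _; nlia); exists s, p.
Qed.

Lemma extendable_sibling a z b : extendable a z -> siblings a z b -> extendable b z.
Proof.
move=> h [lb bz ab]; case: ab => [->//|ab]; split=> // y by_ e.
case: h => la az nz; apply: (nz y) => //.
by apply: (s_tr (s_sym ab) by_); rewrite e.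
Qed.

(** Everything is viewed from z: there t is at distance 3 with parents s and s', which are therefore
    equal or adjacent. An edge between them closes a square with a and b, and a diagonal of it gives
    a common parent. *)
Lemma sibling_parent a z b : extendable a z -> siblings a z b ->
  exists s, spar a s /\ spar b s.
Proof.
move=> h hb; have hb' := extendable_sibling h hb; case: hb => lb bz ab.
have [s [p [as_ _]]] := ex_grandparent (let: And3 la _ _ := h in la).
case: ab => [->|ab]; first by exists s.
have la : sl a = n by case: h.
have a2 : 2 <= sl a by nlia.
have [s' [t [bs' st s't]]] := s_tpc a2 (etrans la (esym lb)) ab as_.
have d3 := extendable_dist3 h as_ st.
have ds := extendable_dist2 h as_; have ds' := extendable_dist2 hb' bs'.
have p1 : par z (sf t) (sf s).
  by split; [apply/s_adj/spar_sym|rewrite !(gdistC hc z) ds d3].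
have p2 : par z (sf t) (sf s').
  by split; [apply/s_adj/spar_sym|rewrite !(gdistC hc z) ds' d3].
have d3' : gdist z (sf t) <= 3 by rewrite gdistC // d3.
case: (cl3 d3' p1 p2) => [/(s_li (spar_sym st) (spar_sym s't)) e|ss].
  by exists s; split=> //; rewrite e.
have sss := s_tr (spar_sym st) (spar_sym s't) ss.
have h1 : adj (sf a) (sf s) by apply: s_adj; case: as_.
have h3 : adj (sf s') (sf b) by apply/s_adj/spar_sym.
have h4 : adj (sf b) (sf a) by apply/s_adj/s_sym.
case: (sqf h1 ss h3 h4) => [e|e|e|e].
- by case/negP: (extendable_parent hb' bs'); rewrite -e; case: h.
- by case/negP: (extendable_parent h as_); rewrite e.
- exists s'; split=> //; split; last by case: bs' => _; rewrite la lb.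
  by apply: (s_tr (spar_sym as_) sss).
- exists s; split=> //; split; last by case: as_ => _; rewrite la lb.
  by apply: (s_tr (spar_sym bs') (s_sym sss)); rewrite adj_sym.
Qed.

(** Two siblings of a have a common grandparent p. Seen from its image, z is at distance 3 and both
    are parents of z. Hence siblings over z form equivalence classes, as [siblings_eq] records. *)
Lemma sibling_clique a z b c : extendable a z -> siblings a z b -> siblings a z c ->
  b = c \/ sa b c.
Proof.
move=> h hb hc'.
have [lb bz ab] := hb; have [lc cz ac] := hc'.
case: ab => [->|ab]; first by case: ac => [->|]; [left|right].
case: ac => [->|ac]; first by right; apply: s_sym.
have [s [as_ bs]] := sibling_parent h hb; have [s' [as' cs']] := sibling_parent h hc'.
have la : 2 <= sl a by case: h => ->; nlia.
have [p [sp s'p]] := common_parent2 as_ as' la.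
have d3 := extendable_dist3 h as_ sp.
have zb : adj z (sf b) by rewrite adj_sym.
have zc : adj z (sf c) by rewrite adj_sym.
have hb' := sB2_dist (sf p) (gp_B2 bs sp); rewrite gdistxx in hb'.
have hc2 := sB2_dist (sf p) (gp_B2 cs' s'p); rewrite gdistxx in hc2.
have := gdist_adj2 hc (sf p) bz; have := gdist_adj2 hc (sf p) cz => q1 q2.
have p1 : par (sf p) z (sf b) by split=> //; nlia.
have p2 : par (sf p) z (sf c) by split=> //; nlia.
case: (cl3 (eq_leq d3) p1 p2) => [/(s_li ab ac)|/(s_tr ab ac)]; by [left|right].
Qed.

Lemma siblings_eq a z b : extendable a z -> siblings a z b -> siblings a z = siblings b z.
Proof.
move=> h hb; apply/seteqP; split=> c hc'.
  case: (sibling_clique h hb hc') => [<-|bc]; case: hb hc' => lb bz ab [lc cz ac].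
    by split=> //; left.
  by split=> //; right.
have la : sl a = n by case: h.
have az : adj (sf a) z by case: h.
have ha : siblings b z a by case: hb => lb bz [->|ab]; split=> //; [left|right; apply: s_sym].
case: (sibling_clique (extendable_sibling h hb) ha hc') => [<-|ac]; case: hc' => lc cz _.
  by split=> //; left.
by split=> //; right.
Qed.

(* A new vertex is the set of its parents together with its image in G. *)
Definition newv := {q : set Z * G | exists a, extendable a q.2 /\ q.1 = siblings a q.2}.
Implicit Types (N M L : newv).
Definition nim N := (sval N).2.
Definition npar N : set Z := (sval N).1.

Lemma npar_ext N b : npar N b -> extendable b (nim N).
Proof.
case: N => -[S z] /= [a [h /= e]]; rewrite /npar /nim /= e => hb.
exact: extendable_sibling hb.
Qed.

Lemma npar_sib N b : npar N b -> npar N = siblings b (nim N).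
Proof.
case: N => -[S z] /= [a [h /= e]]; rewrite /npar /nim /= e => hb.
exact: siblings_eq.
Qed.

Lemma npar_ex N : exists b, npar N b.
Proof.
case: N => -[S z] /= [a [h /= e]]; exists a; rewrite /npar /= e.
by case: h => *; split=> //; left.
Qed.

Lemma newv_eq N M b : npar N b -> npar M b -> nim N = nim M -> N = M.
Proof.
move=> hN hM e; have := npar_sib hN; have := npar_sib hM.
rewrite e => <-; move: e {hN hM}; case: N M => -[S z] hz [[S' z'] hz'].
by rewrite /nim /npar /= => e1 e2; subst; apply: eq_exist.
Qed.

Lemma newv_mk a z : extendable a z -> exists N, npar N a /\ nim N = z.
Proof.
move=> h; have hq : exists b, extendable b (siblings a z, z).2 /\ (siblings a z, z).1 = siblings b (siblings a z, z).2.
  by exists a.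
exists (exist _ (siblings a z, z) hq); split=> //.
by case: h => la az nz; split=> //; left.
Qed.

Lemma npar_add N b c : npar N b -> sl c = n -> adj (sf c) (nim N) -> c = b \/ sa b c ->
  npar N c.
Proof. by move=> hN lc cz bc; rewrite (npar_sib hN); split. Qed.

Lemma npar_clique N b c : npar N b -> npar N c -> b = c \/ sa b c.
Proof.
move=> hb; rewrite (npar_sib hb) => -[lc cz [->|]]; by [left|right].
Qed.

Lemma npar_parent N b c : npar N b -> npar N c -> exists s, spar b s /\ spar c s.
Proof.
move=> hb; rewrite (npar_sib hb) => hc'.
exact: sibling_parent (npar_ext hb) hc'.
Qed.

Lemma npar_lvl N b : npar N b -> sl b = n.
Proof. by case/npar_ext. Qed.

Lemma npar_adj N b : npar N b -> adj (sf b) (nim N).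
Proof. by case/npar_ext. Qed.

Lemma npar_parG N b s p : npar N b -> spar b s -> spar s p -> par (sf p) (nim N) (sf b).
Proof.
move=> hb bs sp; have d3 := extendable_dist3 (npar_ext hb) bs sp.
split; first by rewrite adj_sym npar_adj.
by rewrite d3 (ancestor2_dist bs sp).
Qed.

(** Seen from the common grandparent p, the images of b and u are both parents of that of N; the
    chart about p lifts their equality or adjacency. *)
Lemma npar_of_common_gp N b u s t p : npar N b -> sl u = n -> adj (sf u) (nim N) ->
  spar u s -> spar s p -> spar b t -> spar t p -> npar N u.
Proof.
move=> hb lu uz us sp bt tp; apply: (npar_add hb) => //.
have d3 := extendable_dist3 (npar_ext hb) bt tp.
have p1 := npar_parG hb bt tp.
have p2 : par (sf p) (nim N) (sf u).
  by split; [rewrite adj_sym|rewrite d3 (ancestor2_dist us sp)].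
have lp : sl p + 2 <= n by case: us sp => _ h [_ h']; nlia.
have ch := chart2 lp (gp_B2 bt tp) (gp_B2 us sp).
by case: (cl3 (eq_leq d3) p1 p2) => [/(proj1 ch)|/(proj2 ch)]; [left|right].
Qed.

(** TPC in G seen from [sf p], with N and M at distance 3, is transported to the cover by the chart
    of radius 2 about p. The lift W has level n: a lower one would be a parent of c adjacent to the
    image of M, which extendability excludes. *)
Lemma npar_prescribed N M b c s t p : npar N b -> npar M c -> spar b s -> spar s p ->
  spar c t -> spar t p -> adj (nim N) (nim M) ->
  exists w k, [/\ npar M w, spar b k & spar w k].
Proof.
move=> hb hc' bs sp ct tp NM.
have d3 := extendable_dist3 (npar_ext hb) bs sp.
have d3' := extendable_dist3 (npar_ext hc') ct tp.
have p1 := npar_parG hb bs sp; have p2 := npar_parG hc' ct tp.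
have lb := npar_lvl hb; have lc := npar_lvl hc'.
have lp : sl p + 2 = n by case: bs sp => _ h [_ h']; nlia.
have [w [kap [pw pk1 pk2]]] := @prescribed (sf p) _ _ (sf b) 3 isT d3 d3' NM p1.
have dk : gdist (sf p) kap = 1 by case: pk1; rewrite (ancestor2_dist bs sp); nlia.
have [K [pK fK]] := @s_su _ _ Z p kap ltac:(nlia) (gdist1 hc dk).
have lK := s_step (s_sym pK).
have BK : sB2 p K by apply/sB2_1; right.
have Bb := gp_B2 bs sp; have Bc := gp_B2 ct tp.
have Kb : sa K b by apply: (proj2 (chart2 (eq_leq lp) BK Bb)); rewrite fK adj_sym; case: pk1.
have lK' := s_step (s_sym Kb).
have bK : spar b K by split; [apply: s_sym|nlia].
have Kw : adj (sf K) w by rewrite fK adj_sym; case: pk2.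
have [W [KW fW]] := @s_su _ _ Z K w ltac:(nlia) Kw.
have BW : sB2 p W by exists K; split; right.
have lW := s_step (s_sym KW).
rewrite -fW in pw pk2.
have ch := chart2 (eq_leq lp) Bc BW.
have hcW : c = W \/ sa c W.
  by case: (cl3 (eq_leq d3') p2 pw) => [/(proj1 ch)|/(proj2 ch)]; [left|right].
have Wz : adj (sf W) (nim M) by rewrite adj_sym; case: pw.
have lWn : sl W = n.
  case: hcW => [<-//|cW]; have lW2 := s_step cW.
  have [//|e] : sl W = n \/ sl c = (sl W).+1 by nlia.
  by case/negP: (extendable_parent (npar_ext hc') (conj cW e)).
exists W, K; split=> //; last by split; [apply: s_sym|nlia].
by apply: (npar_add hc') => //; case: hcW => [->|]; [left|right].
Qed.

(** Over an edge of G two new vertices are joined only if they have a common grandparent; by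
    [nedge_prescribed] any parent of N can then serve as witness. *)
Definition nedge N M := adj (nim N) (nim M) /\
  exists b c t, [/\ npar N b, npar M c, spar b t & spar c t].

Lemma nedge_prescribed N M b : nedge N M -> npar N b ->
  exists c t, [/\ npar M c, spar b t & spar c t].
Proof.
move=> [NM [b0 [c0 [t0 [hb0 hc0 b0t0 c0t0]]]]] hb.
have [s [b0s bs]] := npar_parent hb0 hb.
have [p [sp tp]] := common_parent2 b0s b0t0 ltac:(by rewrite (npar_lvl hb0); nlia).
have [w [k [hw bk wk]]] := npar_prescribed hb hc0 bs sp c0t0 tp NM.
by exists w, k.
Qed.

Lemma nedge_sym N M : nedge N M -> nedge M N.
Proof.
move=> [NM [b [c [t [h1 h2 h3 h4]]]]]; split; first by rewrite adj_sym.
by exists c, b, t.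
Qed.

Let T := (sv Z + newv)%type.

Definition gf (x : T) : G := match x with inl a => sf a | inr N => nim N end.
Definition gl (x : T) : nat := match x with inl a => sl a | inr _ => n.+1 end.
Definition ga (x y : T) : Prop := match x, y with
  | inl a, inl b => sa a b
  | inl a, inr N => npar N a
  | inr N, inl a => npar N a
  | inr N, inr M => nedge N M end.
Definition gpar x y := ga x y /\ gl x = (gl y).+1.

Let ga_sym x y : ga x y -> ga y x.
Proof. by case: x y => [a|N] [b|M] //=; [apply: s_sym|apply: nedge_sym]. Qed.

Let gl_le x : gl x <= n.+1.
Proof. by case: x => [a|N] //=; have := s_le a; nlia. Qed.

Let ga_step x y : ga x y -> gl x <= (gl y).+1.
Proof.
case: x y => [a|N] [b|M] //=; first exact: s_step.
- by move=> _; have := s_le a; nlia.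
- by move=> /npar_lvl ->.
Qed.

Let ga_adj x y : ga x y -> adj (gf x) (gf y).
Proof.
case: x y => [a|N] [b|M] //=; first exact: s_adj.
- exact: npar_adj.
- by move=> /npar_adj; rewrite adj_sym.
- by case.
Qed.

Let ga_root : exists r : T, [/\ gl r = 0, gf r = v0 & forall x, gl x = 0 -> x = r].
Proof.
have [r [lr fr hr]] := s_root Z; exists (inl r); split=> //.
by move=> [a|//] /= /hr ->.
Qed.

Let ga_par x : 0 < gl x -> exists y, gpar x y.
Proof.
case: x => [a|N] /= h; first by have [y [ay ly]] := s_par h; exists (inl y).
by have [b hb] := npar_ex N; exists (inl b); split=> //=; rewrite (npar_lvl hb).
Qed.

Let gparN N x : gpar (inr N) x -> exists2 b, x = inl b & npar N b.
Proof. by case: x => [b [h _]|M [_ /= h]]; [exists b|exfalso; nlia]. Qed.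

Let gparZ a x : gpar (inl a) x -> exists2 b, x = inl b & spar a b.
Proof. by case: x => [b h|M [_ /= h]]; [exists b|have hle := s_le a; exfalso; nlia]. Qed.

Let common_gp a b c t t' : sl a = n -> spar a t -> spar b t -> spar a t' -> spar c t' ->
  exists p, spar t p /\ spar t' p.
Proof. by move=> la h1 _ h2 _; apply: (common_parent2 h1 h2); nlia. Qed.

Let new_via N M b : nedge N M -> npar N b -> adj (sf b) (nim M) -> npar M b.
Proof.
move=> NM hb bM; have [c [t [hc' bt ct]]] := nedge_prescribed NM hb.
have [p tp] := @s_par _ _ Z t ltac:(case: bt => _; rewrite (npar_lvl hb); nlia).
exact: (npar_of_common_gp hc' (npar_lvl hb) bM bt tp ct tp).
Qed.

Let old_new a b N : sa a b -> npar N a -> adj (sf b) (nim N) -> npar N b.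
Proof.
move=> ab hN bN; apply: (npar_add hN) => //; last by right.
have la := npar_lvl hN; have lb := s_step ab; have lb' := s_le b.
have [//|e] : sl b = n \/ sl a = (sl b).+1 by nlia.
by case/negP: (extendable_parent (npar_ext hN) (conj ab e)).
Qed.

Let ga_li x y u0 : ga x y -> ga x u0 -> gf y = gf u0 -> y = u0.
Proof.
have clash a b N : sa a b -> npar N a -> sf b = nim N -> False.
  by move=> ab hN e; case: (npar_ext hN) => _ _ nz; apply: (nz b).
have clash2 N M b : nedge N M -> npar N b -> sf b = nim M -> False.
  move=> NM hb e; have [c [t [hc' bt ct]]] := nedge_prescribed NM hb.
  apply: (clash c b M) => //; apply: (s_tr (spar_sym ct) (spar_sym bt)).
  by rewrite e npar_adj.
case: x => [a|N]; case: y => [b|M]; case: u0 => [c|L] //=.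
- by move=> h1 h2 e; rewrite (s_li h1 h2 e).
- by move=> h1 h2 e; case: (clash a b L).
- by move=> h1 h2 e; case: (clash a c M).
- by move=> h1 h2 e; rewrite (newv_eq h1 h2 e).
- move=> h1 h2 e; case: (npar_clique h1 h2) => [->//|/s_adj].
  by rewrite e adj_irr.
- by move=> h1 h2 e; case: (clash2 N L b).
- by move=> h1 h2 e; case: (clash2 N M c).
- move=> h1 h2 e; have [a ha] := npar_ex N.
  have [b [t [hb at_ bt]]] := nedge_prescribed h1 ha.
  have [c [t' [hc' at' ct']]] := nedge_prescribed h2 ha.
  have [p [tp t'p]] := common_gp (npar_lvl ha) at_ bt at' ct'.
  have cM : adj (sf c) (nim M) by rewrite e npar_adj.
  have hcM := npar_of_common_gp hb (npar_lvl hc') cM ct' t'p bt tp.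
  by rewrite (newv_eq hcM hc' e).
Qed.

Let ga_tr x y u0 : ga x y -> ga x u0 -> adj (gf y) (gf u0) -> ga y u0.
Proof.
case: x => [a|N]; case: y => [b|M]; case: u0 => [c|L] //=.
- exact: s_tr.
- by move=> h1 h2 h; apply: old_new h1 h2 h.
- by move=> h1 h2 h; apply: old_new h2 h1 _; rewrite adj_sym.
- move=> h1 h2 h; split=> //.
  have [t at_] := @s_par _ _ Z a ltac:(by rewrite (npar_lvl h1); nlia).
  by exists a, a, t.
- move=> h1 h2 h; case: (npar_clique h1 h2) => // e.
  by move: h; rewrite e adj_irr.
- by move=> h1 h2 h; apply: new_via h2 h1 h.
- by move=> h1 h2 h; apply: new_via h1 h2 _; rewrite adj_sym.
- move=> h1 h2 ML; have [a ha] := npar_ex N.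
  have [b [t [hb at_ bt]]] := nedge_prescribed h1 ha.
  have [c [t' [hc' at' ct']]] := nedge_prescribed h2 ha.
  have [p [tp t'p]] := common_gp (npar_lvl ha) at_ bt at' ct'.
  have [w [k [hw bk wk]]] := npar_prescribed hb hc' bt tp ct' t'p ML.
  by split=> //; exists b, w, k.
Qed.

Let ga_su x g : gl x < n.+1 -> adj (gf x) g -> exists y, ga x y /\ gf y = g.
Proof.
case: x => [a|N] /=; last by rewrite ltnn.
move=> la ag; have [[y [ay fy]]|no] := pselect (exists y, sa a y /\ sf y = g).
  by exists (inl y).
have la' : sl a = n.
  have [h|//] : sl a < n \/ sl a = n by nlia.
  by case: no; apply: s_su.
have [N [hN zN]] : exists N, npar N a /\ nim N = g.
  by apply: newv_mk; split=> // y ay e; apply: no; exists y.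
by exists (inr N).
Qed.

Let ga_inc x y u0 : gpar x y -> gpar x u0 ->
  y = u0 \/ ga y u0 /\ exists t : T, gpar y t /\ gpar u0 t.
Proof.
case: x => [a|N].
  move=> /gparZ[b -> ab] /gparZ[c -> ac]; case: (s_inc ab ac) => [->|[bc [t [bt ct]]]]; first by left.
  by right; split=> //; exists (inl t).
move=> /gparN[b -> hb] /gparN[c -> hc']; case: (npar_clique hb hc') => [->|bc]; first by left.
by right; split=> //; have [s [bs cs]] := npar_parent hb hc'; exists (inl s).
Qed.

Let ga_tpc x y (b : T) : 2 <= gl x -> gl x = gl y -> ga x y -> gpar x b ->
  exists b' t : T, [/\ gpar y b', gpar b t & gpar b' t].
Proof.
case: x y => [a|N] [c|M] /= h e ac.
- move=> /gparZ[d -> ad]; have [b' [t [h1 h2 h3]]] := s_tpc h e ac ad.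
  by exists (inl b'), (inl t).
- by have hle := s_le a; exfalso; nlia.
- by have hle := s_le c; exfalso; nlia.
- move=> /gparN[d -> hd]; have [c [t [hc' dt ct]]] := nedge_prescribed ac hd.
  by exists (inl c), (inl t); split=> //; split=> //=; rewrite (npar_lvl hc').
Qed.

Let ga_gp x y (b c t : T) : gpar x b -> gpar y c -> gpar b t -> gpar c t ->
  adj (gf x) (gf y) -> ga x y.
Proof.
move=> hx hy hb hc' h.
have lev : gl x = gl y by case: hx hy hb hc' => _ -> [_ ->] [_ ->] [_ ->].
case: x y hx hy h lev => [a|N] [d|M] /=.
- move=> /gparZ[b' eb ab] /gparZ[c' ec dc] h _; rewrite eb ec in hb hc'.
  case/gparZ: hb => t' et bt; rewrite et in hc'; case/gparZ: hc' => t2 [et2] ct.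
  rewrite -et2 in ct.
  exact: (s_gp ab dc bt ct).
- by move=> _ _ _ e; have hle := s_le a; exfalso; nlia.
- by move=> _ _ _ e; have hle := s_le d; exfalso; nlia.
- move=> /gparN[b' eb ab] /gparN[c' ec dc] h _; rewrite eb ec in hb hc'.
  case/gparZ: hb => t' et bt; rewrite et in hc'; case/gparZ: hc' => t2 [et2] ct.
  rewrite -et2 in ct.
  by split=> //; exists b', c', t'.
Qed.

(** A centre of level at most n - 2 keeps the whole pentagon among the old vertices, which is why
    growing does not raise the second index. *)
Let ga_pent (c : T) x1 x0 x3 x4 : gl c + 2 <= n -> ga c x1 -> ga x1 x0 -> ga c x3 ->
  ga x3 x4 -> pent (gf x0) (gf x1) (gf c) (gf x3) (gf x4) -> ga x0 x4.
Proof.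
have old x : gl x <= n -> exists a, x = inl a.
  by case: x => [a _|N /=]; [exists a|rewrite ltnn].
move=> lc c1 a1 c3 a3.
have l1 := ga_step (ga_sym c1); have l3 := ga_step (ga_sym c3).
have l0 := ga_step (ga_sym a1); have l4 := ga_step (ga_sym a3).
have [c' ec] := old c ltac:(nlia); have [y1 e1] := old x1 ltac:(nlia).
have [y3 e3] := old x3 ltac:(nlia); have [y0 e0] := old x0 ltac:(nlia).
have [y4 e4] := old x4 ltac:(nlia); subst.
exact: (s_pent lc c1 a1 c3 a3).
Qed.

Definition grown_cover : pcover n.+1 n :=
  @PCover n.+1 n T gf gl ga ga_sym ga_step ga_adj ga_li ga_tr ga_su ga_pent.

Definition grown_stage : stage n.+1 n :=
  @Stage n.+1 n grown_cover gl_le ga_root ga_par ga_inc ga_tpc ga_gp.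

End Grow.

(** Growing raises the depth only; [pent_step] then raises the range of levels for pentagons. *)
Lemma next_stage n : 3 <= n -> stage n n -> stage n.+1 n.+1.
Proof.
move=> n3 Z; have Z' := @grown_stage n Z n3.
pose C := @PCover n.+1 n.+1 Z' (@sf _ _ Z') (@sl _ _ Z') (@sa _ _ Z') (@s_sym _ _ Z')
  (@s_step _ _ Z') (@s_adj _ _ Z') (@s_li _ _ Z') (@s_tr _ _ Z') (@s_su _ _ Z')
  (@pent_step _ Z' n3).
apply: (@Stage n.+1 n.+1 C).
- exact: s_le.
- exact: s_root.
- exact: s_par.
- exact: s_inc.
- exact: s_tpc.
- exact: s_gp.
Qed.

Lemma stage_exists n : 3 <= n -> inhabited (stage n n).
Proof.
elim: n => // n IH; rewrite leq_eqVlt => /orP[/eqP <-|n3]; first exact: base_stage.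
by case: (IH n3) => Z; apply: inhabits; apply: next_stage.
Qed.
End StageDef.
End Stages.

(* Edge-path homotopy in the simplicial complex whose triangles, degenerate
   ones included, are given by tri. *)
Inductive rh (N : Type) (tri : N -> N -> N -> Prop) : seq N -> seq N -> Prop :=
| rh_refl p : rh tri p p
| rh_sym p q of rh tri p q : rh tri q p
| rh_trans p q r of rh tri p q & rh tri q r : rh tri p r
| rh_dup p a q : rh tri (p ++ [:: a, a & q]) (p ++ a :: q)
| rh_elem p a b c q of tri a b c : rh tri (p ++ [:: a, b, c & q]) (p ++ [:: a, c & q]).

(** The bound 2 is the diameter of a pentagon. *)
Definition near_tri (G : sgraph) (a b c : G) :=
  [/\ gdist a b <= 2, gdist b c <= 2 & gdist a c <= 2].

Definition near_sc (G : sgraph) := forall (a : G) p, path adj a p -> last a p = a ->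
  rh (@near_tri G) (a :: p) [:: a].

(** * Monodromy and the passage from local to global conditions *)

Section Monodromy.
Variable G : sgraph.
Hypothesis hc : forall u v : G, exists n, has_walk u v n.
Hypothesis inc3 : forall v u : G, gdist v u <= 3 -> incp v u.
Hypothesis tpc3 : forall v x y : G, adj x y -> gdist v x = gdist v y ->
  gdist v x <= 3 -> tpcp v x y.
Hypothesis pp : pp_close G.

Let sqf : square_free G.
Proof.
apply: (square_free_of_clique hc) => q u h; apply/incp_clique/inc3.
exact: leq_trans h _.
Qed.

Fixpoint near_walk (u : G) (p : seq G) : Prop :=
  if p is g :: p' then gdist u g <= 2 /\ near_walk g p' else True.

Lemma near_walk_cat u p q : near_walk u (p ++ q) <-> near_walk u p /\ near_walk (last u p) q.
Proof. by elim: p u => [|g p IH] u /=; [tauto|have := IH g; tauto]. Qed.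

Lemma rh_near_walk p q : rh (@near_tri G) p q -> forall u, near_walk u p <-> near_walk u q.
Proof.
elim=> [//|{}p {}q _ IH u|{}p {}q r _ IH1 _ IH2 u|{}p a {}q u|{}p a b c {}q [ab bc ac] u].
- by have := IH u; tauto.
- by have := IH1 u; have := IH2 u; tauto.
- by rewrite !near_walk_cat /= gdistxx; split=> [[h1 [h2 [_ h3]]]|[h1 [h2 h3]]]; split.
- by rewrite !near_walk_cat /=; tauto.
Qed.

Lemma path_near_walk u p : path adj u p -> near_walk u p.
Proof.
elim: p u => //= g p IH u /andP[ug /IH]; split=> //.
by rewrite (adj_gdist hc ug).
Qed.

Section Lifts.
Variables (v0 : G) (n : nat) (Z : stage v0 n n).
Implicit Types (x y : Z).

(** Steps in [sB2] rather than along edges admit the walks that arise inside a homotopy, whose steps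
    have length up to 2. *)
Fixpoint lifts (x : Z) (p : seq G) (y : Z) : Prop :=
  if p is g :: p' then exists x', [/\ sB2 x x', sf x' = g & lifts x' p' y] else x = y.

Lemma lifts_cat x p q y : lifts x (p ++ q) y <-> exists m, lifts x p m /\ lifts m q y.
Proof.
elim: p x => [|g p IH] x /=; first by split=> [h|[m [-> //]]]; exists x.
split=> [[x' [h1 h2 /IH[m [h3 h4]]]]|[m [[x' [h1 h2 h3]] h4]]].
  by exists m; split=> //; exists x'.
by exists x'; split=> //; apply/IH; exists m.
Qed.

Lemma lifts_lvl x p y : lifts x p y -> sl y <= sl x + 2 * size p.
Proof.
elim: p x => [|g p IH] x /=; first by move=> ->; nlia.
by move=> [x' [/sB2_lvl h _ /IH h']]; nlia.
Qed.

Lemma lifts_ex x p : sl x + 2 * size p <= n -> near_walk (sf x) p -> exists y, lifts x p y.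
Proof.
elim: p x => [|g p IH] x /= h; first by exists x.
move=> [d w]; have [y [xy fy]] := @lift2 _ hc _ _ Z x g ltac:(nlia) d.
have hl := sB2_lvl xy.
have [z hz] := IH y ltac:(nlia) ltac:(by rewrite fy).
by exists z, y.
Qed.

Lemma lifts_uniq x p y y' : sl x + 2 * size p <= n -> lifts x p y -> lifts x p y' -> y = y'.
Proof.
elim: p x => [|g p IH] x /= h; first by move=> -> ->.
move=> [a [xa fa ha]] [b [xb fb hb]].
have e : a = b by apply: (proj1 (chart2 hc inc3 (_ : sl x + 2 <= n) xa xb)); [nlia|rewrite fa].
by apply: (IH a) => //; [have := sB2_lvl xa; nlia|rewrite e].
Qed.

Lemma sB2_sym x y : sB2 x y -> sB2 y x.
Proof.
have sym1 u w : @sB1 _ _ _ Z u w -> sB1 w u by case=> [->|/s_sym]; [left|right].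
by case=> m [/sym1 h1 /sym1 h2]; exists m.
Qed.

(** The chart is centred at y. A midpoint of the images of x and z may be at distance 3 from the
    image of y, so radius 2 would not be enough. *)
Lemma near_tri_lift x y z : sl y + 3 <= n -> sB2 x y -> sB2 y z ->
  gdist (sf x) (sf z) <= 2 -> sB2 x z.
Proof.
move=> ly xy yz; have yx := sB2_sym xy.
have cx := chart3 hc inc3 tpc3 (leqnn n) ly.
have Bx : sB3 y x := sB3_2 yx; have Bz : sB3 y z := sB3_2 yz.
rewrite leq_eqVlt => /orP[/eqP d2|]; last first.
  move=> /(gdist_le1 hc)[/(proj1 (cx _ _ Bx Bz)) ->|/(proj2 (cx _ _ Bx Bz)) h].
    by exists z; split; left.
  by exists z; split; [right|left].
have [m [xm mz]] := gdist2_mid hc d2.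
have dm := gdist_step hc (sf y) xm.
have dx := sB2_dist hc (sf y) yx; rewrite gdistxx in dx.
have [w [yw fw]] := @lift3 _ hc _ _ Z y m ly ltac:(nlia).
exists w; split; right.
  by apply: (proj2 (cx _ _ Bx yw)); rewrite fw.
by apply: (proj2 (cx _ _ yw Bz)); rewrite fw.
Qed.

Lemma lifts_path x p y : sl x + 2 * size p <= n -> path adj (sf x) p -> lifts x p y ->
  sl x <= sl y + size p /\ sl y <= sl x + size p /\
  (if p is g :: p' then exists x', [/\ sa x x', sf x' = g & lifts x' p' y] else True).
Proof.
elim: p x => [|g p IH] x /= h; first by move=> _ ->; nlia.
move=> /andP[xg pg] [x' [xx' fx' hl]].
have hxx : sB2 x x by exists x; split; left.
have a : sa x x'.
  by apply: (proj2 (chart2 hc inc3 (_ : sl x + 2 <= n) hxx xx')); [nlia|rewrite fx'].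
have l1 := s_step a; have l2 := s_step (s_sym a).
have [] := IH x' ltac:(nlia) ltac:(by rewrite fx') hl.
by move=> q1 [q2 _]; do ![split; first by nlia]; exists x'.
Qed.

Lemma lvl_dist x : gdist v0 (sf x) <= sl x.
Proof.
move E : (sl x) => l; elim: l x E => [|l IH] x E.
  by have [r [_ fr h]] := s_root Z; rewrite (h x E) fr gdistxx.
have [y [xy ly]] := @s_par _ _ _ _ Z x ltac:(by rewrite E).
have := gdist_step hc v0 (s_adj (s_sym xy)); have := IH y ltac:(nlia); nlia.
Qed.

End Lifts.

(** Each elementary step only needs room for the walks that it relates, so M depends on the homotopy
    alone and not on the stage. *)
Lemma rh_lifts (v0 : G) p q : rh (@near_tri G) p q -> exists M, forall n (Z : stage v0 n n) (x y y' : Z),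
  M <= n -> sl x = 0 -> near_walk (sf x) p -> lifts x p y -> lifts x q y' -> y = y'.
Proof.
elim=> [{}p|{}p {}q pq [M IH]|{}p {}q r pq [M1 IH1] qr [M2 IH2]|{}p a {}q|{}p a b c {}q [ab bc ac]].
- exists (2 * size p) => n Z x y y' h lx _; apply: lifts_uniq; rewrite lx; exact: h.
- exists M => n Z x y y' h lx nw h1 h2; apply/esym; apply: (IH n Z x) => //.
  by apply/(rh_near_walk pq).
- exists (maxn (maxn M1 M2) (2 * size q)) => n Z x y y'; rewrite !geq_max => /andP[/andP[h1 h2] h3] lx nw ly ly'.
  have nw' : near_walk (sf x) q by apply/(rh_near_walk pq).
  have [m hm] := @lifts_ex v0 n Z x q ltac:(by rewrite lx) nw'.
  by rewrite (IH1 n Z x y m) // (IH2 n Z x m y').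
- exists (2 * size (p ++ [:: a, a & q]) + 2) => n Z x y y'; rewrite size_cat /= => hn lx nw.
  move=> /lifts_cat[m [hm [A [mA fA [B [AB fB hB]]]]]].
  move=> /lifts_cat[m' [hm' [A' [mA' fA' hA']]]].
  have em : m = m' by apply: lifts_uniq hm hm'; nlia.
  subst m'; have lm := lifts_lvl hm; have lA := sB2_lvl mA.
  have eA : A = A' by apply: (proj1 (chart2 hc inc3 (_ : sl m + 2 <= n) mA mA')); [nlia|rewrite fA].
  subst A'.
  have AA : sB2 A A by exists A; split; left.
  have eB : A = B by apply: (proj1 (chart2 hc inc3 (_ : sl A + 2 <= n) AA AB)); [nlia|rewrite fA].
  by subst B; apply: lifts_uniq hB hA'; nlia.
- exists (2 * size (p ++ [:: a, b, c & q]) + 3) => n Z x y y'; rewrite size_cat /= => hn lx nw.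
  move=> /lifts_cat[m [hm [A [mA fA [B [AB fB [C [BC fC hC]]]]]]]].
  move=> /lifts_cat[m' [hm' [A' [mA' fA' [C' [AC' fC' hC']]]]]].
  have em : m = m' by apply: lifts_uniq hm hm'; nlia.
  subst m'; have lm := lifts_lvl hm; have lA := sB2_lvl mA; have lB := sB2_lvl AB.
  have eA : A = A' by apply: (proj1 (chart2 hc inc3 (_ : sl m + 2 <= n) mA mA')); [nlia|rewrite fA].
  subst A'.
  have AC : sB2 A C by apply: (near_tri_lift _ AB BC); [nlia|rewrite fA fC].
  have eC : C = C' by apply: (proj1 (chart2 hc inc3 (_ : sl A + 2 <= n) AC AC')); [nlia|rewrite fC].
  subst C'; apply: lifts_uniq hC hC'; have := sB2_lvl AC; nlia.
Qed.

Hypothesis nsc : near_sc G.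

Lemma geodesic_walk (u v : G) : exists p : seq G, [/\ path adj u p, last u p = v & size p = gdist u v].
Proof. exact: gdist_walk. Qed.

(** The closed path along a geodesic from v0 to a, through c to b, and back along a geodesic lifts
    to a closed path at the root. The way out bounds the level of A and the way back that of B, so
    both levels are the true distances. *)
Lemma lift_two_edges (v0 a c b : G) : adj a c -> adj c b ->
  exists n (Z : stage v0 n n) (A C B : Z), [/\ sa A C, sa C B, sf A = a, sf C = c &
    [/\ sf B = b, sl A = gdist v0 a & sl B = gdist v0 b]].
Proof.
move=> ac cb.
have [p [pp1 lp sp]] := geodesic_walk v0 a; have [q [pq lq sq]] := geodesic_walk b v0.
have [M hM] : exists M, forall n (Z : stage v0 n n) (x y y' : Z),
    M <= n -> sl x = 0 -> near_walk (sf x) (v0 :: p ++ [:: c, b & q]) ->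
    lifts x (v0 :: p ++ [:: c, b & q]) y -> lifts x [:: v0] y' -> y = y'.
  apply: rh_lifts; apply: nsc; last by rewrite last_cat /= lq.
  by rewrite cat_path pp1 lp /= ac cb.
pose n := maxn (maxn M 3) (2 * size (v0 :: p ++ [:: c, b & q])).
have hn1 : M <= n by rewrite /n; nlia.
have hn2 : 3 <= n by rewrite /n; nlia.
have hn3 : 2 * size (v0 :: p ++ [:: c, b & q]) <= n by rewrite /n; nlia.
have [Z] := stage_exists hc inc3 tpc3 pp v0 hn2.
have [r [lr fr _]] := s_root Z.
have pw : path adj v0 (p ++ [:: c, b & q]) by rewrite cat_path pp1 lp /= ac cb.
have nw : near_walk (sf r) (v0 :: p ++ [:: c, b & q]).
  by rewrite fr /=; split; [rewrite gdistxx|apply: path_near_walk].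
have hr : sl r + 2 * size (v0 :: p ++ [:: c, b & q]) <= n by rewrite lr add0n.
have [y hy] := lifts_ex hr nw.
have rr : sB2 r r by exists r; split; left.
have ey : y = r by apply: (hM n Z r y r hn1 lr nw hy) => /=; exists r.
subst y; move: hy => [r' [rr' fr' hy]].
rewrite /= size_cat /= in hn3.
have er : r = r' by apply: (proj1 (chart2 hc inc3 (_ : sl r + 2 <= n) rr rr')); [nlia|rewrite fr fr'].
subst r'; move: hy => /lifts_cat[A [hA hAr]].
have hs1 : sl r + 2 * size p <= n by nlia.
have pr : path adj (sf r) p by rewrite fr.
have [_ [lA _]] := lifts_path hs1 pr hA.
have fA : sf A = a.
  have end_img (l : seq G) (z : Z) : lifts z l A -> sf A = last (sf z) l.
    elim: l z => [|g l IH] z /=; first by move=> ->.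
    by move=> [z' [_ <- /IH]].
  by rewrite (end_img _ _ hA) fr.
have pA : path adj (sf A) [:: c, b & q] by rewrite fA /= ac cb.
have hs2 : sl A + 2 * size [:: c, b & q] <= n by rewrite /=; nlia.
have [_ [_ [C [AC fC hC]]]] := lifts_path hs2 pA hAr.
have lC := s_step (s_sym AC).
have pC : path adj (sf C) (b :: q) by rewrite fC /= cb.
have hs3 : sl C + 2 * size (b :: q) <= n by rewrite /=; nlia.
have [_ [_ [B [CB fB hB]]]] := lifts_path hs3 pC hC.
have lB := s_step (s_sym CB).
have pB : path adj (sf B) q by rewrite fB.
have hs4 : sl B + 2 * size q <= n by nlia.
have [lB' _] := lifts_path hs4 pB hB.
have gA := lvl_dist A; have gB := lvl_dist B.
rewrite fA in gA; rewrite fB in gB.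
exists n, Z, A, C, B; split=> //; split=> //; first by nlia.
by move: sq; rewrite (gdistC hc b); nlia.
Qed.

Lemma stage_par (v0 : G) n (Z : stage v0 n n) (x y : Z) : spar x y -> sl x = gdist v0 (sf x) ->
  par v0 (sf x) (sf y) /\ sl y = gdist v0 (sf y).
Proof.
move=> [xy lxy] lx; have := lvl_dist y; have := gdist_adj2 hc v0 (s_adj xy).
have h := s_adj xy; move=> h1 h2; split; [split=> //|]; nlia.
Qed.

(** In a suitable stage w and w' have their true levels, which forces that of u between them; INC is
    then read off upstairs. *)
Lemma local_global_incp (v u : G) : incp v u.
Proof.
move=> w w' [uw dw] [uw' dw'].
have wu : adj w u by rewrite adj_sym.
have [n [Z [W [U [W' [WU UW' fW fU [fW' lW lW']]]]]]] := @lift_two_edges v w u w' wu uw'.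
have gU := lvl_dist U; have lU := s_step (s_sym WU).
rewrite fU in gU.
have p1 : spar U W by split; [apply: s_sym|nlia].
have p2 : spar U W' by split; [|nlia].
case: (s_inc p1 p2) => [e|[a [t [pt pt']]]]; first by left; rewrite -fW -fW' e.
right; split; first by rewrite -fW -fW' s_adj.
have [q1 _] := stage_par pt (etrans lW (congr1 _ (esym fW))).
have [q2 _] := stage_par pt' (etrans lW' (congr1 _ (esym fW'))).
by exists (sf t); rewrite -fW -fW'.
Qed.

Lemma local_global_tpcp (v x y : G) : adj x y -> gdist v x = gdist v y -> tpcp v x y.
Proof.
move=> xy dxy; have yx : adj y x by rewrite adj_sym.
have [k dx] : exists k, gdist v x = k by eexists.
have dy : gdist v y = k by rewrite -dxy.
case: k dx dy => [|[|k]] dx dy.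
- by case: (adj_neq xy); rewrite -(gdist_eq0 hc dx) (gdist_eq0 hc dy).
- left; exists v; split; split; rewrite ?gdistxx ?dx ?dy // adj_sym; exact: gdist1.
(* The path x, y, y' ends at a parent of y so that y, too, gets its true level. *)
have [y' [yy' dy']] := par_exists hc dy.
have [n [Z [X [Y [Y' [XY YY' fX fY [fY' lX lY']]]]]]] := @lift_two_edges v x y y' xy yy'.
have gY := lvl_dist Y; have lY := s_step YY'; rewrite fY in gY.
have {}lY : sl Y = gdist v y by nlia.
have [b Xb] := @s_par _ _ _ _ Z X ltac:(nlia).
have [b' [t [Yb' bt bt']]] := @s_tpc _ _ _ _ Z X Y b ltac:(nlia) ltac:(nlia) XY Xb.
have [q1 lb] := stage_par Xb (etrans lX (congr1 _ (esym fX))).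
have [q2 lb'] := stage_par Yb' (etrans lY (congr1 _ (esym fY))).
have [q3 _] := stage_par bt lb; have [q4 _] := stage_par bt' lb'.
rewrite fX in q1; rewrite fY in q2.
move: (sf b) (sf b') (sf t) q1 q2 q3 q4 => c c' w q1 q2 q3 q4.
have [xb db] := q1; have [yb' db'] := q2; have [cw dt] := q3; have [cw' dt'] := q4.
case hxb : (adj x c'); first by left; exists c'; split=> //; split=> //; nlia.
case hyb : (adj y c); first by left; exists c; split=> //; split=> //; nlia.
have [e|/eqP ne] := eqVneq c c'; first by rewrite e hxb in xb.
case hbb : (adj c c').
  have b'y : adj c' y by rewrite adj_sym.
  case: (sqf xb hbb b'y yx) => e.
  - by move: db'; rewrite -e; nlia.
  - by move: db; rewrite e; nlia.
  - by rewrite hxb in e.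
  - by rewrite adj_sym hyb in e.
right; exists c, w, c'; split=> //; apply: pentE; rewrite ?hxb ?hbb //.
- by rewrite adj_sym.
- by rewrite adj_sym.
- by apply/negP => /(gdist_adj2 hc v); nlia.
- by rewrite adj_sym hyb.
- by apply/negP => /(gdist_adj2 hc v); nlia.
Qed.

End Monodromy.

(** * Faces and coverings of complexes *)

Section CycleAdjacency.

Lemma cyc_adj_sym n (i j : 'I_n) : cyc_adj i j = cyc_adj j i.
Proof. by rewrite /cyc_adj orbC. Qed.

Lemma cyc_succ_inj n (i j : 'I_n) : i.+1 = j.+1 %[mod n] -> i = j.
Proof.
move=> /eqP; rewrite -[i.+1]addn1 -[j.+1]addn1 eqn_modDr !modn_small // => /eqP e.
exact: val_inj.
Qed.

Lemma cyc_adj_three n (i a b c : 'I_n) : cyc_adj i a -> cyc_adj i b -> cyc_adj i c ->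
  [\/ a = b, b = c | a = c].
Proof.
have same (x y : 'I_n) : i.+1 %% n == x -> i.+1 %% n == y -> x = y.
  by move=> /eqP e1 /eqP e2; apply: val_inj; rewrite /= -e1 -e2.
have same' (x y : 'I_n) : x.+1 %% n == i -> y.+1 %% n == i -> x = y.
  by move=> /eqP e1 /eqP e2; apply: cyc_succ_inj; rewrite e1 e2.
move=> /orP[h1|h1] /orP[h2|h2] /orP[h3|h3];
  by [constructor 1; apply: same h1 h2|constructor 1; apply: same' h1 h2
     |constructor 2; apply: same h2 h3|constructor 2; apply: same' h2 h3
     |constructor 3; apply: same h1 h3|constructor 3; apply: same' h1 h3].
Qed.

Lemma cyc_adj_two n (i : 'I_n) : 3 <= n -> exists a b, [/\ cyc_adj i a, cyc_adj i b & a <> b].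
Proof.
move=> n3; have n0 : 0 < n by lia.
pose a := Ordinal (ltn_pmod i.+1 n0); pose b := Ordinal (ltn_pmod (i + n.-1) n0).
have eb : b.+1 %% n = i.
  rewrite /= -addn1 modnDml -addnA addn1 prednK // modnDr modn_small //.
exists a, b; rewrite /cyc_adj eb !eqxx orbT; split=> // e.
move: eb; rewrite -e /= -addn1 modnDml addn1 -addn2 => e2.
have : (i + 2 == i + 0 %[mod n]) by rewrite e2 addn0 modn_small.
by rewrite eqn_modDl mod0n modn_small //; lia.
Qed.

End CycleAdjacency.

Section Faces.
Variable X : cell_complex.
Implicit Types (f : face X) (u v a b c : skeleton X).

Lemma side_sym f u v : side f u v -> side f v u.
Proof.
have [n [t [_ _ E]]] := side_cycle f.
by move=> /E[i [j [h -> ->]]]; apply/E; exists j, i; rewrite cyc_adj_sym.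
Qed.

Lemma side_three f u a b c : side f u a -> side f u b -> side f u c ->
  [\/ a = b, b = c | a = c].
Proof.
have [n [t [_ inj E]]] := side_cycle f.
move=> /E[i [j [h1 -> ->]]] /E[i2 [j2 [h2 /inj e2 ->]]] /E[i3 [j3 [h3 /inj e3 ->]]].
subst i2 i3; case: (cyc_adj_three h1 h2 h3) => ->.
- by constructor 1.
- by constructor 2.
- by constructor 3.
Qed.

Lemma side_two f u : incident f u -> exists a b, [/\ side f u a, side f u b & a <> b].
Proof.
have [n [t [n3 inj E]]] := side_cycle f.
move=> [v /E[i [j [h -> _]]]]; have [a [b [ha hb ab]]] := cyc_adj_two i n3.
exists (tnth t a), (tnth t b); split; last by move/inj.
  by apply/E; exists i, a.
by apply/E; exists i, b.
Qed.

End Faces.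

Section TPFaces.
Variable G : sgraph.
Hypothesis hc : forall u v : G, exists n, has_walk u v n.
Implicit Types (a b c d e : G).

Lemma triangle_intro a b c : adj a b -> adj b c -> adj a c -> triangle [tuple a; b; c].
Proof.
move=> ab bc ac; have ba : adj b a by rewrite adj_sym.
have cb : adj c b by rewrite adj_sym.
have ca : adj c a by rewrite adj_sym.
have nab := adj_neq ab; have nbc := adj_neq bc; have nac := adj_neq ac.
split=> [i j|i j]; rewrite !(tnth_nth a) /=.
  case: i j => -[|[|[|//]]] hi [] [|[|[|//]]] hj //= e; try exact: val_inj;
  by [case: (nab e)|case: (nab (esym e))|case: (nbc e)|case: (nbc (esym e))
     |case: (nac e)|case: (nac (esym e))].
case: i j => -[|[|[|//]]] hi [] [|[|[|//]]] hj //=; rewrite ?adj_irr ?ab ?bc ?ac ?ba ?cb ?ca //.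
Qed.

Definition triangle_face a b c (ab : adj a b) (bc : adj b c) (ac : adj a c) : tp_face G :=
  exist _ [set` [tuple a; b; c]] (mem_set (or_introl (ex_intro2 _ _ _ (triangle_intro ab bc ac) erefl))).

Definition pent_face a b c d e (h : pent a b c d e) : tp_face G :=
  exist _ [set` [tuple a; b; c; d; e]]
    (mem_set (or_intror (ex_intro2 _ _ _ (proj2 (pentagonP a b c d e) h) erefl))).

Lemma triangle_side a b c ab bc ac x y : x \in [:: a; b; c] -> y \in [:: a; b; c] ->
  adj x y -> @side (tp_complex G) (@triangle_face a b c ab bc ac) x y.
Proof. by move=> hx hy xy; apply/and3P; split=> //; apply/mem_set. Qed.

Lemma pent_side a b c d e h x y : x \in [:: a; b; c; d; e] -> y \in [:: a; b; c; d; e] ->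
  adj x y -> @side (tp_complex G) (@pent_face a b c d e h) x y.
Proof. by move=> hx hy xy; apply/and3P; split=> //; apply/mem_set. Qed.

Lemma tp_side_dist2 (A : face (tp_complex G)) x y : incident A x -> incident A y ->
  [\/ x = y, side A x y | exists z, side A x z /\ side A z y].
Proof.
move=> [x' /and3P[hx _ _]] [y' /and3P[hy _ _]].
have cyc3 (i j : 'I_3) : i = j \/ cyc_adj i j.
  by case: i j => -[|[|[|//]]] hi [] [|[|[|//]]] hj; (try by right); left; apply: val_inj.
have cyc5 (i j : 'I_5) : [\/ i = j, cyc_adj i j | exists k, cyc_adj i k /\ cyc_adj k j].
  have E k l : k < 5 -> l < 5 -> [|| k == l, (k.+1 %% 5 == l) || (l.+1 %% 5 == k) |
      has (fun m => ((k.+1 %% 5 == m) || (m.+1 %% 5 == k)) &&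
                    ((m.+1 %% 5 == l) || (l.+1 %% 5 == m))) (iota 0 5)].
    by case: k => [|[|[|[|[|//]]]]]; case: l => [|[|[|[|[|//]]]]].
  case/or3P: (E i j (ltn_ord i) (ltn_ord j)) => [/eqP/val_inj ->|h|/hasP[m]].
  - by constructor 1.
  - by constructor 2.
  - rewrite mem_iota => /andP[_ m5] /andP[h1 h2]; constructor 3.
    by exists (Ordinal m5).
case: (set_mem (valP A)) => -[t [inj E] AE]; move: hx hy; rewrite AE =>
    /set_mem/= /tnthP[i ei] /set_mem/= /tnthP[j ej].
  case: (cyc3 i j) => [e|h]; first by constructor 1; rewrite ei ej e.
  constructor 2; rewrite /= /tp_side AE ei ej; apply/and3P; split; last by rewrite E.
  - by apply/mem_set; rewrite /= mem_tnth.
  - by apply/mem_set; rewrite /= mem_tnth.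
have S k l : cyc_adj k l -> side A (tnth t k) (tnth t l).
  move=> h; rewrite /= /tp_side AE; apply/and3P; split; last by rewrite E.
  - by apply/mem_set; rewrite /= mem_tnth.
  - by apply/mem_set; rewrite /= mem_tnth.
case: (cyc5 i j) => [e|h|[k [h1 h2]]]; first by constructor 1; rewrite ei ej e.
  by constructor 2; rewrite ei ej; apply: S.
by constructor 3; exists (tnth t k); rewrite ei ej; split; apply: S.
Qed.

End TPFaces.

Section CoveringLifts.
Variables (G : sgraph) (Y : cell_complex).
Variables (p : skeleton Y -> skeleton (tp_complex G)) (q : face Y -> face (tp_complex G)).
Hypothesis cov : covering p q.
Implicit Types (u v w x y : skeleton Y).

Lemma cov_inj u v w : adj u v -> adj u w -> p v = p w -> v = w.
Proof.
move=> uv uw e; have [v' [_ h]] := cov_edge cov (cov_adj cov uv).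
by rewrite -(h v) // -(h w).
Qed.

(** The two sides of f at u have distinct images, because p is injective on f, and [q f] has only
    two sides at [p u]. *)
Lemma cov_side_lift f u z : incident f u -> side (q f) (p u) z ->
  exists v, [/\ side f u v, p v = z & incident f v].
Proof.
move=> fu h; have [a [b [ha hb ab]]] := side_two fu.
have ia : incident f a by exists u; apply: side_sym.
have ib : incident f b by exists u; apply: side_sym.
case: (side_three h (cov_side cov ha) (cov_side cov hb)) => e.
- by exists a.
- by case: ab; apply: (cov_cell cov) ia ib e.
- by exists b.
Qed.

(** The triangle downstairs lifts to a 2-cell at u, and uniqueness of lifts of edges identifies its
    other vertices with v and w. *)
Lemma cov_triangle u v w : adj u v -> adj u w -> adj (p v) (p w) -> adj v w.
Proof.
move=> uv uw vw; pose T : face (tp_complex G) := triangle_face (cov_adj cov uv) vw (cov_adj cov uw).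
have pvu : side T (p u) (p v) by apply: triangle_side; rewrite ?inE ?eqxx ?orbT //; apply: (cov_adj cov).
have puw : side T (p u) (p w) by apply: triangle_side; rewrite ?inE ?eqxx ?orbT //; apply: (cov_adj cov).
have pvw : side T (p v) (p w) by apply: triangle_side; rewrite ?inE ?eqxx ?orbT.
have iT : incident T (p u) by exists (p v).
have [f [[fu ef] _]] := cov_face cov iT.
rewrite -ef in pvu puw pvw.
have [v' [h1 ev iv]] := cov_side_lift fu pvu; have e1 := cov_inj (side_adj h1) uv ev; subst v'.
have [w' [h2 ew iw]] := cov_side_lift fu puw; have e2 := cov_inj (side_adj h2) uw ew; subst w'.
have [x [h3 ex ix]] := cov_side_lift iv pvw.
by rewrite -(cov_cell cov ix iw ex); apply: side_adj h3.
Qed.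

(** The lift of the pentagon at c is followed all the way round; injectivity of p on the cell makes
    it close up at x1. *)
Lemma cov_pent x0 x1 c x3 x4 : adj c x1 -> adj x1 x0 -> adj c x3 -> adj x3 x4 ->
  @pent G (p x0) (p x1) (p c) (p x3) (p x4) -> adj x0 x4.
Proof.
move=> c1 a1 c3 a3 pe; pose T : face (tp_complex G) := pent_face pe.
move: (pe) => /andP[/and5P[g01 g12 g23 g34 g40] _].
have s23 : side T (p c) (p x3) by apply: pent_side; rewrite ?inE ?eqxx ?orbT.
have s34 : side T (p x3) (p x4) by apply: pent_side; rewrite ?inE ?eqxx ?orbT.
have s40 : side T (p x4) (p x0) by apply: pent_side; rewrite ?inE ?eqxx ?orbT.
have s01 : side T (p x0) (p x1) by apply: pent_side; rewrite ?inE ?eqxx ?orbT.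
have s21 : side T (p c) (p x1).
  by apply: pent_side; rewrite ?inE ?eqxx ?orbT //; apply: (cov_adj cov).
have iT : incident T (p c) by exists (p x3).
have [f [[fc ef] _]] := cov_face cov iT.
rewrite -ef in s23 s34 s40 s01 s21.
have [y3 [h3 e3 i3]] := cov_side_lift fc s23; have e := cov_inj (side_adj h3) c3 e3; subst y3.
have [y4 [h4 e4 i4]] := cov_side_lift i3 s34; have e := cov_inj (side_adj h4) a3 e4; subst y4.
have [y0 [h0 e0 i0]] := cov_side_lift i4 s40; rewrite -e0 in s01.
have [y1 [h1 e1 i1]] := cov_side_lift i0 s01.
have [z1 [h1' e1' i1']] := cov_side_lift fc s21; have e := cov_inj (side_adj h1') c1 e1'; subst z1.
have e := cov_cell cov i1 i1' e1; subst y1.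
have h10 : adj x1 y0 by apply: side_adj (side_sym h1).
by rewrite -(cov_inj h10 a1 e0) adj_sym; apply: side_adj h0.
Qed.

Lemma cov_face_dist2 f u v : incident f u -> incident f v ->
  [\/ u = v, adj u v | exists w, adj u w /\ adj w v].
Proof.
move=> fu fv.
have im w : incident f w -> incident (q f) (p w) by case=> z /(cov_side cov); exists (p z).
case: (tp_side_dist2 (im _ fu) (im _ fv)) => [e|h|[z [h1 h2]]].
- by constructor 1; apply: (cov_cell cov) fu fv e.
- have [w [h3 e fw]] := cov_side_lift fu h; constructor 2.
  by rewrite -(cov_cell cov fw fv e); apply: side_adj h3.
- have [w [h3 e fw]] := cov_side_lift fu h1; rewrite -e in h2.
  have [x [h4 e' fx]] := cov_side_lift fw h2; constructor 3; exists w.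
  by rewrite -(cov_cell cov fx fv e') (side_adj h3) (side_adj h4).
Qed.

End CoveringLifts.

(** * Passage of the local conditions to coverings *)

Definition local_conditions (G : sgraph) : Prop :=
  [/\ forall v u : G, gdist v u <= 3 -> incp v u,
      forall v x y : G, adj x y -> gdist v x = gdist v y -> gdist v x <= 3 -> tpcp v x y
    & pp_close G].

Section LiftConditions.
Variables (G S : sgraph) (p : S -> G).
Hypothesis hc : forall u v : G, exists n, has_walk u v n.
Hypothesis hcS : forall u v : S, exists n, has_walk u v n.
Hypothesis lc : local_conditions G.
Hypothesis padj : forall u v, adj u v -> adj (p u) (p v).
Hypothesis pli : forall u v w, adj u v -> adj u w -> p v = p w -> v = w.
Hypothesis ptr : forall u v w, adj u v -> adj u w -> adj (p v) (p w) -> adj v w.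
Hypothesis psu : forall u g, adj (p u) g -> exists v, adj u v /\ p v = g.
Hypothesis ppe : forall c x1 x0 x3 x4, adj c x1 -> adj x1 x0 -> adj c x3 ->
  adj x3 x4 -> pent (p x0) (p x1) (p c) (p x3) (p x4) -> adj x0 x4.
Implicit Types (u v w x y : S).

Let inc3 : forall v u : G, gdist v u <= 3 -> incp v u. Proof. by case: lc. Qed.
Let tpc3 : forall v x y : G, adj x y -> gdist v x = gdist v y -> gdist v x <= 3 ->
  tpcp v x y. Proof. by case: lc. Qed.

(** With all levels equal to 0 the bounds on levels hold everywhere, so charts of radius 3 exist
    about every vertex. *)
Let C : pcover G 3 3.
Proof.
apply: (@PCover G 3 3 S p (fun=> 0) (fun u v => adj u v)).
- by move=> x y; rewrite adj_sym.
- by [].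
- exact: padj.
- exact: pli.
- exact: ptr.
- by move=> x g _; apply: psu.
- by move=> c x1 x0 x3 x4 _; apply: ppe.
Defined.

Let B1 u v : sB1 (u : C) v <-> gdist u v <= 1.
Proof.
split=> [[->|/(adj_gdist hcS) ->//]|/(gdist_le1 hcS)[->|h]]; [|by left|by right].
by rewrite gdistxx.
Qed.

Let B2 u v : sB2 (u : C) v <-> gdist u v <= 2.
Proof.
split=> [[m [/B1 h1 /B1 h2]]|]; first by have := gdist_tri hcS u m v; nlia.
case E : (gdist u v) => [|[|[|//]]] _.
- by exists v; split; apply/B1; rewrite ?E ?gdistxx.
- by exists v; split; apply/B1; rewrite ?E ?gdistxx.
- have [m [um mv]] := gdist2_mid hcS E.
  by exists m; split; apply/B1; rewrite adj_gdist.
Qed.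

Let B3 u v : sB3 (u : C) v <-> gdist u v <= 3.
Proof.
split=> [[m [/B2 h1 /B1 h2]]|]; first by have := gdist_tri hcS u m v; nlia.
case E : (gdist u v) => [|[|[|[|//]]]] _; try by
  exists v; split; [apply/B2; rewrite E|apply/B1; rewrite gdistxx].
have [m [um mv]] := @gdist_split _ hcS u v 2 1 E.
by exists m; split; [apply/B2; rewrite um|apply/B1; rewrite mv].
Qed.

Let chart v x y : gdist v x <= 3 -> gdist v y <= 3 ->
  (p x = p y -> x = y) /\ (adj (p x) (p y) -> adj x y).
Proof.
move=> /B3 hx /B3 hy.
exact: (@chart3 G hc inc3 tpc3 3 3 C (leqnn 3) v x y isT hx hy).
Qed.

Let lift v g : gdist (p v) g <= 3 -> exists y, gdist v y <= 3 /\ p y = g.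
Proof.
move=> h; have [y [/B3 hy fy]] := @lift3 G hc 3 3 C v g isT h.
by exists y.
Qed.

Lemma cover_gdist_le u v : gdist (p u) (p v) <= gdist u v.
Proof.
have [l [pl ll sl]] := gdist_walk hcS u v.
apply: gdist_le; exists (map p l); split; last by rewrite size_map.
- elim: l u pl {ll sl} => //= a l IH u /andP[ua /IH ->].
  by rewrite padj.
- by rewrite last_map ll.
Qed.

Lemma cover_gdist u v : gdist u v <= 3 -> gdist (p u) (p v) = gdist u v.
Proof.
move=> h; apply/eqP; rewrite eqn_leq cover_gdist_le /=.
have uu : gdist u u <= 3 by rewrite gdistxx.
have [e1 e2] := chart uu h.
case E : (gdist (p u) (p v)) => [|[|[|j]]].
- by rewrite -(e1 (gdist_eq0 hc E)) gdistxx.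
- by rewrite (adj_gdist hcS (e2 (gdist1 hc E))).
- have [y [/B2 hy fy]] := @lift2 G hc 3 3 C u (p v) isT (eq_leq E).
  have hy3 : gdist u y <= 3 by nlia.
  by rewrite (proj1 (chart h hy3)).
- by apply: leq_trans h _; nlia.
Qed.

Let par_down v x y : gdist v x <= 3 -> par v x y -> par (p v) (p x) (p y).
Proof. by move=> h [xy d]; split; [apply: padj|rewrite !cover_gdist //; nlia]. Qed.

Let par_up v x y : gdist v x <= 3 -> gdist v y <= 3 -> par (p v) (p x) (p y) -> par v x y.
Proof.
move=> hx hy [xy]; rewrite !cover_gdist // => d; split=> //.
exact: (proj2 (chart hx hy)).
Qed.

Let par_lift v x g : gdist v x <= 3 -> par (p v) (p x) g -> exists y, p y = g /\ par v x y.
Proof.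
move=> h pg; have := pg => -[_]; rewrite cover_gdist // => d.
have [y [hy fy]] := @lift v g ltac:(nlia); exists y; split=> //.
by apply: par_up => //; rewrite fy.
Qed.

Let par_le3 v x y : gdist v x <= 3 -> par v x y -> gdist v y <= 3.
Proof. by move=> h [_ d]; nlia. Qed.

Let pent_down a b c d e : pent a b c d e -> pent (p a) (p b) (p c) (p d) (p e).
Proof.
have nadj x y z : adj x y -> adj y z -> ~~ adj x z -> ~~ adj (p x) (p z).
  move=> xy yz; apply: contra => h.
  have h1 : gdist x x <= 3 by rewrite gdistxx.
  have h2 : gdist x z <= 3 by have := gdist_step2 hcS x xy yz; rewrite gdistxx; nlia.
  exact: (proj2 (chart h1 h2)).
move=> /andP[/and5P[ab bc cd de ea] /and5P[ac ad bd be ce]].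
apply: pentE; try exact: padj.
- exact: nadj ab bc ac.
- by rewrite adj_sym; apply: (nadj d e a) => //; rewrite adj_sym.
- exact: nadj bc cd bd.
- by rewrite adj_sym; apply: (nadj e a b) => //; rewrite adj_sym.
- exact: nadj cd de ce.
Qed.

(** INC and TPC at levels up to 3 only involve a ball of radius 3, which p maps isomorphically onto
    a ball downstairs. For two pentagons, the lift of the image of d' near d is identified with d'
    through their common neighbour c'. *)
Lemma lift_local_conditions : local_conditions S.
Proof.
split.
- move=> v u h w w' pw pw'.
  have hw := par_le3 h pw; have hw' := par_le3 h pw'.
  have h' : gdist (p v) (p u) <= 3 by rewrite cover_gdist.
  case: (inc3 h' (par_down h pw) (par_down h pw')) => [/(proj1 (chart hw hw'))|]; first by left.
  move=> [/(proj2 (chart hw hw')) ww' [z [pz pz']]]; right; split=> //.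
  have [y [fy py]] := par_lift hw pz; exists y; split=> //.
  by apply: par_up => //; [apply: par_le3 hw py|rewrite fy].
- move=> v x y xy d hx; have hy : gdist v y <= 3 by rewrite -d.
  have := tpc3 (padj xy) (_ : gdist (p v) (p x) = gdist (p v) (p y)).
  rewrite !cover_gdist // => /(_ d hx) [[z [pz pz']]|[a [t [b [pa pt pb pt' pe]]]]].
    have [w [fw pw]] := par_lift hx pz; left; exists w; split=> //.
    by apply: par_up => //; [apply: par_le3 hx pw|rewrite fw].
  have [a' [fa pa']] := par_lift hx pa; have ha := par_le3 hx pa'; rewrite -fa in pt pe.
  have [b' [fb pb']] := par_lift hy pb; have hb := par_le3 hy pb'; rewrite -fb in pt' pe.
  have [t' [ft pt2]] := par_lift ha pt; have ht := par_le3 ha pt2; rewrite -ft in pt' pe.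
  right; exists a', t', b'; split=> //; first exact: par_up.
  have nadj u w : ~~ adj (p u) (p w) -> ~~ adj u w by apply: contra; apply: padj.
  move: pe => /andP[/and5P[ab bc cd de ea] /and5P[ac ad bd be ce]].
  by apply: pentE; try (by apply: nadj); [apply: (proj2 (chart hx ha))
    |apply: (proj2 (chart ha ht))|apply: (proj2 (chart ht hb))
    |apply: (proj2 (chart hb hy))|rewrite adj_sym].
- move=> a b c d e c' d' e' pe pe'.
  have pp : pp_close G by case: lc.
  have h := pp _ _ _ _ _ _ _ _ (pent_down pe) (pent_down pe').
  have [y [hy fy]] := lift h.
  move: pe => /andP[/and5P[_ bc cd _ _] _]; move: pe' => /andP[/and5P[_ bc' cd' _ _] _].
  have dc : adj d c by rewrite adj_sym.
  have cb : adj c b by rewrite adj_sym.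
  have hd : gdist d c' <= 3.
    by have := gdist_step2 hcS d dc cb; have := gdist_step hcS d bc'; rewrite gdistxx; nlia.
  have h1 : adj c' y by apply: (proj2 (chart hd hy)); rewrite fy; apply: padj.
  by rewrite (pli cd' h1 (esym fy)).
Qed.

End LiftConditions.

(** * Relation to the conditions of the statement *)

Section GlobalConsequences.
Variable G : sgraph.
Hypothesis hc : forall u v : G, exists n, has_walk u v n.

Lemma local_conditions_convex : local_conditions G -> near_sc G -> convex_balls G.
Proof.
move=> [inc3 tpc3 pp] nsc; apply: (conditions_convex_balls hc).
- by move=> v u; apply: (local_global_incp hc inc3 tpc3 pp nsc).
- by move=> v x y; apply: (local_global_tpcp hc inc3 tpc3 pp nsc).
Qed.

Lemma incp_upto : INC_upto G 3 <-> forall v u : G, gdist v u <= 3 -> incp v u.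
Proof.
split=> h u v d; [apply/(incpE hc)|apply/(incpE hc)]; apply: h; rewrite gdistC //.
Qed.

Lemma tpcp_upto : TPC0_upto G 3 <->
  forall v x y : G, adj x y -> gdist v x = gdist v y -> gdist v x <= 3 -> tpcp v x y.
Proof.
split=> h.
  by move=> v x y xy d dx; apply/(tpcpE hc xy erefl (esym d)); apply: h.
by move=> v x y k xy dx dy k3; apply/(tpcpE hc xy dx dy); apply: h; rewrite ?dx ?dy.
Qed.

(** If d and d' were at distance at least 4, no vertex within 1 of d would be equal or adjacent to
    one within 1 of d', so the two pentagons would form an induced PP_1. *)
Lemma pp_close_PP1 : PP1_diameter_le G 3 -> pp_close G.
Proof.
move=> pp a b c d e c' d' e' pe pe'; rewrite leqNgt; apply/negP => far.
have [dd1 dd2] : (forall x, gdist d x <= 1 -> forall y, gdist d' y <= 1 -> 2 <= gdist x y) /\ True.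
  split=> // x hx y hy; have := gdist_tri hc d x d'; have := gdist_tri hc x y d'.
  by rewrite (gdistC hc y); nlia.
move: (pe) (pe') => /andP[/and5P[ab bc cd de ea] /and5P[ac ad bd be ce]].
move=> /andP[/and5P[_ bc' cd' de' ea'] /and5P[ac' ad' bd' be' ce']].
have [hc1 hd1 he1] : [/\ gdist d c <= 1, gdist d d <= 1 & gdist d e <= 1].
  by rewrite gdistxx (adj_gdist hc de) (gdistC hc) (adj_gdist hc cd).
have [hc2 hd2 he2] : [/\ gdist d' c' <= 1, gdist d' d' <= 1 & gdist d' e' <= 1].
  by rewrite gdistxx (adj_gdist hc de') (gdistC hc) (adj_gdist hc cd').
have nadj (x y : G) : 2 <= gdist x y -> adj x y = false.
  by move=> h; apply/negP => xy; rewrite (adj_gdist hc xy) in h.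
have neq (x y : G) : 2 <= gdist x y -> (x == y) = false.
  by move=> h; apply/eqP => e1; rewrite e1 gdistxx in h.
pose s := [:: a; b; c; d; e; c'; d'; e'].
have us : uniq s.
  have [/tuple_uniqP u1 _] := proj2 (pentagonP a b c d e) pe.
  have [/tuple_uniqP u2 _] := proj2 (pentagonP a b c' d' e') pe'.
  move: u1 u2; rewrite /s /= !inE !negb_or (neq _ _ (dd1 _ hc1 _ hc2)) (neq _ _ (dd1 _ hc1 _ hd2)) (neq _ _ (dd1 _ hc1 _ he2)) (neq _ _ (dd1 _ hd1 _ hc2)) (neq _ _ (dd1 _ hd1 _ hd2)) (neq _ _ (dd1 _ hd1 _ he2)) (neq _ _ (dd1 _ he1 _ hc2)) (neq _ _ (dd1 _ he1 _ hd2)) (neq _ _ (dd1 _ he1 _ he2)).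
  by repeat (match goal with |- context [@eq_op ?T ?x ?y] => case: (@eq_op T x y) => //= end).
have E i j : i < j -> j < 8 ->
    adj (nth a s i) (nth a s j) = ((i, j) \in PP1_edges) || ((j, i) \in PP1_edges).
  move: (negbTE ac) (negbTE ad) (negbTE bd) (negbTE be) (negbTE ce) => fac fad fbd fbe fce.
  move: (negbTE ac') (negbTE ad') (negbTE bd') (negbTE be') (negbTE ce') => fac' fad' fbd' fbe' fce'.
  rewrite adj_sym in ea; rewrite adj_sym in ea'.
  case: i => [|[|[|[|[|[|[|[|//]]]]]]]]; case: j => [|[|[|[|[|[|[|[|//]]]]]]]] //= _ _;
  rewrite ?ab ?bc ?cd ?de ?ea ?bc' ?cd' ?de' ?ea' ?fac ?fad ?fbd ?fbe ?fce
    ?fac' ?fad' ?fbd' ?fbe' ?fce' //; by rewrite nadj // dd1.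
have S i j : adj (nth a s i) (nth a s j) = adj (nth a s j) (nth a s i) by rewrite adj_sym.
have ind : induced_PP1 (fun i : 'I_8 => nth a s i).
  split=> [i j /eqP|i j].
    by rewrite nth_uniq // => /eqP/val_inj.
  rewrite /PP1_adj; case: (ltngtP i j) => [ij|ij|/val_inj ->].
  - exact: E.
  - by rewrite S E // orbC.
  - by rewrite adj_irr; case: j {i} => -[|[|[|[|[|[|[|[|//]]]]]]]].
have := pp _ ind (inord 3) (inord 6); rewrite !inordK //= => h.
by move: far; rewrite ltnNge h.
Qed.

(** Only the vertices 3 and 6, opposite to the common edge, are four apart in PP_1. The neighbours 5
    and 7 of 6 are within 3 of vertex 3, and 6 lies between them. *)
Lemma conv_PP1 : convex_balls_upto G 3 -> PP1_diameter_le G 3.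
Proof.
move=> conv h [hinj hadj].
have A i j : i < 8 -> j < 8 -> ((i, j) \in PP1_edges) || ((j, i) \in PP1_edges) ->
    gdist (h (inord i)) (h (inord j)) <= 1.
  by move=> i8 j8 ij; rewrite (adj_gdist hc) // hadj /PP1_adj !inordK.
have far : gdist (h (inord 3)) (h (inord 6)) <= 3.
  have d5 : gdist (h (inord 3)) (h (inord 5)) <= 3.
    have := gdist_tri hc (h (inord 3)) (h (inord 2)) (h (inord 5)).
    have := gdist_tri hc (h (inord 2)) (h (inord 1)) (h (inord 5)).
    by have := A 3 2 isT isT isT; have := A 2 1 isT isT isT; have := A 1 5 isT isT isT; nlia.
  have d7 : gdist (h (inord 3)) (h (inord 7)) <= 3.
    have := gdist_tri hc (h (inord 3)) (h (inord 4)) (h (inord 7)).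
    have := gdist_tri hc (h (inord 4)) (h (inord 0)) (h (inord 7)).
    by have := A 3 4 isT isT isT; have := A 4 0 isT isT isT; have := A 0 7 isT isT isT; nlia.
  have a56 : adj (h (inord 5)) (h (inord 6)) by rewrite hadj /PP1_adj !inordK.
  have a67 : adj (h (inord 6)) (h (inord 7)) by rewrite hadj /PP1_adj !inordK.
  apply: (conv_mid2 hc conv (leqnn 3) d5 d7 a56 a67).
  apply: (gdist2 hc a56 a67); last by rewrite hadj /PP1_adj !inordK.
  by move=> /hinj e; have := congr1 (@nat_of_ord 8) e; rewrite !inordK.
pose st i j := (i == j) || ((i, j) \in PP1_edges) || ((j, i) \in PP1_edges).
have D i j : i < 8 -> j < 8 -> st i j -> gdist (h (inord i)) (h (inord j)) <= 1.
  move=> i8 j8; rewrite /st -orbA => /orP[/eqP ->|]; first by rewrite gdistxx.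
  exact: A.
move=> i j; rewrite -(inord_val i) -(inord_val j).
have : all (fun i => all (fun j => [|| (i == 3) && (j == 6), (i == 6) && (j == 3) |
   has (fun k => has (fun l => [&& st i k, st k l & st l j]) (iota 0 8)) (iota 0 8)])
   (iota 0 8)) (iota 0 8) by vm_compute.
move=> /allP/(_ (val i)); rewrite mem_iota ltn_ord => /(_ isT)/allP/(_ (val j)).
rewrite mem_iota ltn_ord => /(_ isT)/or3P[/andP[/eqP -> /eqP ->]|/andP[/eqP -> /eqP ->]|] //.
  by rewrite gdistC.
move=> /hasP[k]; rewrite mem_iota => /andP[_ k8] /hasP[l]; rewrite mem_iota => /andP[_ l8].
move=> /and3P[/D-/(_ (ltn_ord i) k8) h1 /D-/(_ k8 l8) h2 /D-/(_ l8 (ltn_ord j)) h3].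
apply: leq_trans (gdist_tri hc _ (h (inord k)) _) _.
by apply: (leq_add h1); apply: leq_trans (gdist_tri hc _ (h (inord l)) _) (leq_add h2 h3).
Qed.

End GlobalConsequences.

(** * Loops and null homotopies *)

Import Order.TTheory GRing.Theory Num.Theory.
Import numFieldNormedType.Exports.

Local Open Scope ring_scope.

Lemma within_contP {S T : topologicalType} (D : set S) (f : S -> T) :
  {within D, continuous f} <->
  forall x, D x -> forall V, nbhs (f x) V -> \forall z \near x, D z -> V (f z).
Proof.
rewrite subspace_continuousP; split=> h x Dx V; first by move=> /(h x Dx).
by move=> /(h x Dx V).
Qed.

Section WithinContinuity.
Context {S T U : topologicalType}.

Lemma within_cont_comp (D : set S) (E : set T) (phi : S -> T) (f : T -> U) :
  {within D, continuous phi} -> (forall x, D x -> E (phi x)) ->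
  {within E, continuous f} -> {within D, continuous (f \o phi)}.
Proof.
move=> /(iffLR (within_contP D phi)) cphi DE /(iffLR (within_contP E f)) cf.
apply: (iffRL (within_contP D _)) => x Dx V /(cf _ (DE _ Dx)) h.
have := cphi x Dx _ h; apply: filterS => z hz Dz; exact: hz Dz (DE _ Dz).
Qed.

Lemma within_cont_eq (D : set S) (f g : S -> T) : (forall x, D x -> f x = g x) ->
  {within D, continuous f} -> {within D, continuous g}.
Proof.
move=> e /(iffLR (within_contP D f)) h; apply: (iffRL (within_contP D g)) => x Dx V; rewrite -e // => /(h x Dx).
by apply: filterS => z hz Dz; rewrite -e //; apply: hz.
Qed.

Lemma continuous_within (D : set S) (f : S -> T) : continuous f -> {within D, continuous f}.
Proof. exact: continuous_subspaceT. Qed.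

End WithinContinuity.

Section Circle.
Variable R : realType.
Implicit Types (s : R) (z : R * R).

Definition unit_square : set (R * R) := [set z | (0 <= z.1 <= 1) /\ (0 <= z.2 <= 1)].
Definition unit_itv : set R := [set s | 0 <= s <= 1].

Lemma unit_itvE : `[0, 1]%classic = unit_itv.
Proof. by apply/seteqP; split=> s /=; rewrite in_itv. Qed.

(* The circle is parametrized through the diamond |x| + |y| = 1, and the angle is
   piecewise rational; the constants 1/2 and 1/4 only keep the denominators away
   from 0. *)
Definition diam_x s := `|4 * s - 2| - 1.
Definition diam_y s := Num.max 0 (1 - `|4 * s - 1|) - Num.max 0 (1 - `|4 * s - 3|).
Definition norm2 (x y : R) := Num.sqrt (x ^+ 2 + y ^+ 2).
Definition circ s : R * R :=
  let n := Num.max (norm2 (diam_x s) (diam_y s)) 2^-1 in (diam_x s / n, diam_y s / n).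
Definition norm1 z := Num.max (`|z.1| + `|z.2|) 4^-1.
Definition ang_up z := (1 - z.1 / norm1 z) / 4.
Definition ang_down z := (3 + z.1 / norm1 z) / 4.
Definition ang z := if 0 <= z.2 then ang_up z else ang_down z.

Lemma cont_pair (T : topologicalType) (f g : T -> R) : continuous f -> continuous g ->
  continuous (fun t => (f t, g t)).
Proof. by move=> cf cg t; exact: (cvg_pair (cf t) (cg t)). Qed.

Lemma cont_max (T : topologicalType) (f g : T -> R) : continuous f -> continuous g ->
  continuous (fun t => Num.max (f t) (g t)).
Proof. by move=> cf cg t; exact: (continuous_max (cf t) (cg t)). Qed.

Lemma cont_add (T : topologicalType) (f g : T -> R) : continuous f -> continuous g ->
  continuous (fun t => f t + g t).
Proof. by move=> cf cg t; exact: (continuousD (cf t) (cg t)). Qed.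

Lemma cont_opp (T : topologicalType) (f : T -> R) : continuous f ->
  continuous (fun t => - f t).
Proof. by move=> cf t; exact: (continuousN (cf t)). Qed.

Lemma cont_mul (T : topologicalType) (f g : T -> R) : continuous f -> continuous g ->
  continuous (fun t => f t * g t).
Proof. by move=> cf cg t; exact: (continuousM (cf t) (cg t)). Qed.

Lemma cont_inv (T : topologicalType) (f : T -> R) : (forall t, f t != 0) -> continuous f ->
  continuous (fun t => (f t)^-1).
Proof. by move=> nz cf t; exact: (continuousV (nz t) (cf t)). Qed.

Lemma cont_norm (T : topologicalType) (f : T -> R) : continuous f ->
  continuous (fun t => `|f t|).
Proof. by move=> cf t; exact: (continuous_comp (cf t) (@norm_continuous _ R (f t))). Qed.

Lemma cont_sqrt (T : topologicalType) (f : T -> R) : continuous f ->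
  continuous (fun t => Num.sqrt (f t)).
Proof. by move=> cf t; apply: (continuous_comp (cf t) (@sqrt_continuous R (f t))). Qed.

Lemma cont_const (T : topologicalType) (c : R) : continuous (fun _ : T => c).
Proof. by move=> t; apply: cvg_cst. Qed.

Lemma cont_sqr (T : topologicalType) (f : T -> R) : continuous f -> continuous (fun t => f t ^+ 2).
Proof. by move=> cf; apply: (cont_mul cf cf). Qed.

Lemma cont_fst : continuous (fun z : R * R => z.1).
Proof. by move=> z; apply: cvg_fst. Qed.

Lemma cont_snd : continuous (fun z : R * R => z.2).
Proof. by move=> z; apply: cvg_snd. Qed.

Lemma cont_id : continuous (fun s : R => s).
Proof. by move=> s; apply: cvg_id. Qed.

Let affine_cont (a b : R) : continuous (fun s : R => a * s - b).
Proof. exact: (cont_add (cont_mul (@cont_const _ a) cont_id) (@cont_const _ (- b))). Qed.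

Lemma diam_x_cont : continuous diam_x.
Proof. exact: (cont_add (cont_norm (@affine_cont 4 2)) (@cont_const _ (-1))). Qed.

Lemma diam_y_cont : continuous diam_y.
Proof.
have h (b : R) : continuous (fun s : R => Num.max 0 (1 - `|4 * s - b|)).
  apply: (cont_max (@cont_const _ 0)).
  exact: (cont_add (@cont_const _ 1) (cont_opp (cont_norm (@affine_cont 4 b)))).
exact: (cont_add (h 1) (cont_opp (h 3))).
Qed.

Lemma norm2_cont (T : topologicalType) (f g : T -> R) : continuous f -> continuous g ->
  continuous (fun t => norm2 (f t) (g t)).
Proof. by move=> cf cg; exact: (cont_sqrt (cont_add (cont_sqr cf) (cont_sqr cg))). Qed.

Lemma circ_cont : continuous circ.
Proof.
pose n s := Num.max (norm2 (diam_x s) (diam_y s)) 2^-1.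
have nz s : n s != 0 by apply: lt0r_neq0; rewrite lt_max invr_gt0 ltr0n orbT.
have cn : continuous n.
  exact: (cont_max (norm2_cont diam_x_cont diam_y_cont) (@cont_const _ 2^-1)).
exact: (cont_pair (cont_mul diam_x_cont (cont_inv nz cn)) (cont_mul diam_y_cont (cont_inv nz cn))).
Qed.

Lemma norm1_neq0 z : norm1 z != 0.
Proof. by apply: lt0r_neq0; rewrite lt_max invr_gt0 ltr0n orbT. Qed.

Lemma norm1_cont : continuous norm1.
Proof.
exact: (cont_max (cont_add (cont_norm cont_fst) (cont_norm cont_snd)) (@cont_const _ 4^-1)).
Qed.

Let ratio_cont : continuous (fun z => z.1 / norm1 z).
Proof. exact: (cont_mul cont_fst (cont_inv norm1_neq0 norm1_cont)). Qed.

Lemma ang_up_cont : continuous ang_up.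
Proof.
exact: (cont_mul (cont_add (@cont_const _ 1) (cont_opp ratio_cont)) (@cont_const _ 4^-1)).
Qed.

Lemma ang_down_cont : continuous ang_down.
Proof. exact: (cont_mul (cont_add (@cont_const _ 3) ratio_cont) (@cont_const _ 4^-1)). Qed.


Lemma norm_cases (x : R) : (0 <= x /\ `|x| = x) \/ (x <= 0 /\ `|x| = - x).
Proof. case: (lerP 0 x) => [h|/ltW h].
  by left; split=> //; exact: ger0_norm.
by right; split=> //; exact: ler0_norm. Qed.

Lemma max_cases (x y : R) : (x <= y /\ Num.max x y = y) \/ (y <= x /\ Num.max x y = x).
Proof. by case: (leP x y) => [h|/ltW h]; [left|right]. Qed.

Ltac absmax := repeat match goal with
  | |- context [ Num.norm ?x ] => lazymatch x with
      | context [ Num.norm _ ] => fail | context [ Order.max _ _ ] => fail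
      | _ => case: (norm_cases x) => -[? ->] end
  | |- context [ Order.max ?x ?y ] => lazymatch y with
      | context [ Num.norm _ ] => fail | context [ Order.max _ _ ] => fail
      | _ => case: (max_cases x y) => -[? ->] end
  end.

Lemma diam_up s : 0 <= s -> s <= 2^-1 ->
  [/\ diam_x s = 1 - 4 * s, 0 <= diam_y s & `|diam_x s| + `|diam_y s| = 1].
Proof.
move=> h1 h2; rewrite /diam_x /diam_y.
rewrite (@ler0_norm _ (4 * s - 2)) ?(@ler0_norm _ (4 * s - 3)); [|lra|lra].
rewrite (@max_l _ _ 0 (1 - - _)); last lra.
case: (norm_cases (4 * s - 1)) => -[h ->]; rewrite max_r; try lra;
  (rewrite (@ger0_norm _ (_ - 0)); last lra); split; try lra; absmax; lra.
Qed.

Lemma diam_down s : 2^-1 <= s -> s <= 1 ->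
  [/\ diam_x s = 4 * s - 3, diam_y s <= 0 & `|diam_x s| + `|diam_y s| = 1].
Proof.
move=> h1 h2; rewrite /diam_x /diam_y.
rewrite (@ger0_norm _ (4 * s - 2)) ?(@ger0_norm _ (4 * s - 1)); [|lra|lra].
rewrite (@max_l _ _ 0 (1 - (4 * s - 1))); last lra.
case: (norm_cases (4 * s - 3)) => -[h ->]; rewrite max_r; try lra;
  (rewrite (@ler0_norm _ (0 - _)); last lra); split; try lra; absmax; lra.
Qed.

Lemma diam_y_lt0 s : 2^-1 < s -> s < 1 -> diam_y s < 0.
Proof.
move=> h1 h2; rewrite /diam_y (@ger0_norm _ (4 * s - 1)); last lra.
rewrite (@max_l _ _ 0 (1 - (4 * s - 1))); last lra.
by absmax; lra.
Qed.

Lemma norm2_bounds (x y : R) : `|x| + `|y| = 1 -> 2^-1 <= norm2 x y /\ norm2 x y <= 1.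
Proof.
move=> h.
have h0 : 0 <= norm2 x y by exact: sqrtr_ge0.
have h1 : norm2 x y ^+ 2 = x ^+ 2 + y ^+ 2 by rewrite sqr_sqrtr // addr_ge0 ?sqr_ge0.
have [a b] : 4^-1 <= norm2 x y ^+ 2 /\ norm2 x y ^+ 2 <= 1.
  rewrite h1 -(real_normK (num_real x)) -(real_normK (num_real y)).
  have p0 := normr_ge0 x; have q0 := normr_ge0 y.
  have -> : `|y| = 1 - `|x| by lra.
  by have := sqr_ge0 (2 * `|x| - 1); split; nra.
by rewrite !leNgt; split; apply/negP => ?; nra.
Qed.

Lemma diam_norm s : 0 <= s -> s <= 1 -> `|diam_x s| + `|diam_y s| = 1.
Proof.
move=> h0 h1; case: (lerP s 2^-1) => h; first by case: (diam_up h0 h).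
by case: (diam_down (ltW h) h1).
Qed.

Lemma circE s : 0 <= s -> s <= 1 ->
  circ s = (diam_x s / norm2 (diam_x s) (diam_y s), diam_y s / norm2 (diam_x s) (diam_y s)).
Proof.
move=> h0 h1; have [a b] := norm2_bounds (diam_norm h0 h1).
by rewrite /circ max_l.
Qed.

Lemma circ_circle s : 0 <= s -> s <= 1 -> unit_circle (circ s).
Proof.
move=> h0 h1; rewrite circE //; have [a _] := norm2_bounds (diam_norm h0 h1).
rewrite /unit_circle /= !exprMn -mulrDl exprVn.
rewrite /norm2 sqr_sqrtr ?addr_ge0 ?sqr_ge0 // mulfV //.
by apply/eqP => e; move: a; rewrite /norm2 e sqrtr0; lra.
Qed.

Lemma ang_circ s : 0 <= s -> s < 1 -> ang (circ s) = s.
Proof.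
move=> h0 h1; rewrite circE // ?ltW //.
have dn := diam_norm h0 (ltW h1); have [a b] := norm2_bounds dn.
set n := norm2 _ _ in a b *.
have n0 : n != 0 by apply: lt0r_neq0; lra.
have ni : 1 <= n^-1 by rewrite invf_ge1; lra.
have E : norm1 (diam_x s / n, diam_y s / n) = n^-1.
  rewrite /norm1 /= !normrM normrV ?unitfE // (@ger0_norm _ n); last by lra.
  by rewrite -mulrDl dn mul1r max_l //; lra.
rewrite /ang /ang_up /ang_down E /= mulfK ?invr_eq0 //.
case: (lerP s 2^-1) => h.
  have [-> y0 _] := diam_up h0 h.
  by rewrite divr_ge0 //; [field | lra].
have [-> _ _] := diam_down (ltW h) (ltW h1).
have y0 := diam_y_lt0 h h1.
rewrite pmulr_lge0; last by rewrite invr_gt0; lra.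
by rewrite leNgt y0 /=; field.
Qed.

Lemma circ0 : circ 0 = (1, 0).
Proof.
rewrite circE // ?ler01 //; have [-> _ dn] := @diam_up 0 (lexx _) (ltac:(lra)).
have -> : diam_y 0 = 0.
  move: dn; have [-> _ _] := @diam_up 0 (lexx _) (ltac:(lra)).
  by rewrite mulr0 subr0 normr1 => h; apply/normr0_eq0; lra.
by rewrite /norm2 mulr0 subr0 expr1n expr0n /= addr0 sqrtr1 !divr1.
Qed.

Lemma circ1 : circ 1 = (1, 0).
Proof.
rewrite circE // ?ler01 //; have [e _ dn] := @diam_down 1 (ltac:(lra)) (lexx _).
have e1 : diam_x 1 = 1 by rewrite e; lra.
have -> : diam_y 1 = 0.
  by move: dn; rewrite e1 normr1 => h; apply/normr0_eq0; lra.
by rewrite /norm2 e1 expr1n expr0n /= addr0 sqrtr1 !divr1.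
Qed.

Lemma circle_norm1 z : unit_circle z -> [/\ norm1 z = `|z.1| + `|z.2|, 1 <= norm1 z & norm1 z <= 2].
Proof.
rewrite /unit_circle /= => h.
have [a b] : 1 <= `|z.1| + `|z.2| /\ `|z.1| + `|z.2| <= 2.
  have p0 := normr_ge0 z.1; have q0 := normr_ge0 z.2.
  move: h; rewrite -(real_normK (num_real z.1)) -(real_normK (num_real z.2)) => h.
  have := mulr_ge0 p0 q0; have := sqr_ge0 (`|z.1| - `|z.2|).
  by rewrite !leNgt; split; apply/negP => ?; nra.
by rewrite /norm1 max_l //; lra.
Qed.

Lemma ang_up_itv z : 0 <= ang_up z <= 2^-1.
Proof.
rewrite /ang_up; have: `|z.1 / norm1 z| <= 1.
  have p : 0 < norm1 z by rewrite lt_max invr_gt0 ltr0n orbT.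
  rewrite normrM normfV (gtr0_norm p) ler_pdivrMr // mul1r le_max.
  by rewrite lerDl normr_ge0.
by move: (_ / _) => r; case: (norm_cases r) => -[a ->] b; apply/andP; split; lra.
Qed.

Lemma ang_down_up z : ang_down z = 1 - ang_up z.
Proof. by rewrite /ang_down /ang_up; lra. Qed.

Lemma circ_ang_aux z : unit_circle z ->
  (0 <= z.2 -> circ (ang_up z) = z) /\ (z.2 <= 0 -> circ (ang_down z) = z).
Proof.
move=> zc; have [E A1 A2] := circle_norm1 zc; set A := norm1 z in E A1 A2.
have A0 : A != 0 by exact: norm1_neq0.
have xy : `|z.1 / A| + `|z.2 / A| = 1.
  by rewrite !normrM -mulrDl -E normfV ger0_norm ?mulfV //; lra.
have N : norm2 (z.1 / A) (z.2 / A) = A^-1.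
  rewrite /norm2 !exprMn -mulrDl zc mul1r sqrtr_sqr ger0_norm // invr_ge0; lra.
have fin : (z.1 / A / A^-1, z.2 / A / A^-1) = z.
  by rewrite invrK !mulfVK //; case: (z).
have [u0 u1] := andP (ang_up_itv z).
split=> y0.
  rewrite circE; [|lra|lra].
  have [e1 e2 e3] := diam_up u0 u1.
  have ex : diam_x (ang_up z) = z.1 / A by rewrite e1 /ang_up -/A; lra.
  have ey : diam_y (ang_up z) = z.2 / A.
    have p : 0 <= z.2 / A by apply: divr_ge0 => //; lra.
    by move: e3 xy; rewrite ex (ger0_norm e2) (ger0_norm p); lra.
  by rewrite ex ey N.
rewrite circE ?ang_down_up; [|lra|lra].
have [e1 e2 e3] := @diam_down (1 - ang_up z) (ltac:(lra)) (ltac:(lra)).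
have ex : diam_x (1 - ang_up z) = z.1 / A by rewrite e1 /ang_up -/A; lra.
have ey : diam_y (1 - ang_up z) = z.2 / A.
  have p : z.2 / A <= 0 by rewrite pmulr_lle0 // invr_gt0; lra.
  by move: e3 xy; rewrite ex (ler0_norm e2) (ler0_norm p); lra.
by rewrite ex ey N.
Qed.

Lemma ang_agree z : z.2 = 0 -> z.1 != 0 -> 4^-1 <= `|z.1| ->
  ang_up z = ang_down z \/ (ang_up z = 0 /\ ang_down z = 1).
Proof.
move=> y0 x0 xl; rewrite /ang_up /ang_down /norm1 y0 normr0 addr0 max_l //.
case: (norm_cases z.1) => -[h ->]; first by right; rewrite divff //; lra.
by left; rewrite invrN mulrN divff //; lra.
Qed.

End Circle.

Arguments circ : simpl never.

Section Glue.
Variables (R : realType) (T U : topologicalType).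

Lemma within_glue (D : set T) (f : T -> U) (h : T -> R) : continuous h ->
  {within D `&` [set z | 0 <= h z], continuous f} ->
  {within D `&` [set z | h z <= 0], continuous f} -> {within D, continuous f}.
Proof.
move=> ch /(iffLR (within_contP _ f)) c1 /(iffLR (within_contP _ f)) c2.
apply: (iffRL (within_contP D f)) => x Dx V nV.
have h1 : \forall z \near x, D z -> 0 <= h z -> V (f z).
  case: (lerP 0 (h x)) => hx.
    by have := c1 x (conj Dx hx) V nV; apply: filterS => z hz Dz z0; exact: hz (conj Dz z0).
  have : \forall z \near x, h z < 0 by exact: (@cvgr_lt _ _ _ _ h (h x) (ch x) _ hx).
  apply: filterS => z hz _ z0.
  by move: (le_lt_trans z0 hz); rewrite ltxx.
have h2 : \forall z \near x, D z -> h z <= 0 -> V (f z).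
  case: (lerP (h x) 0) => hx.
    by have := c2 x (conj Dx hx) V nV; apply: filterS => z hz Dz z0; exact: hz (conj Dz z0).
  have : \forall z \near x, 0 < h z by exact: (@cvgr_gt _ _ _ _ h (h x) (ch x) _ hx).
  apply: filterS => z hz _ z0.
  by move: (lt_le_trans hz z0); rewrite ltxx.
apply: filterS2 h1 h2 => z a b Dz.
by case: (lerP 0 (h z)) => hz; [exact: a|apply: b => //; exact: ltW].
Qed.

End Glue.

Section Loops.
Variables (R : realType) (T : topologicalType).

(** A contraction through closed loops whose base point may move: this is a map of the disk in polar
    coordinates. *)
Definition null_loop (l : R -> T) : Prop := exists F : R * R -> T,
  [/\ {within @unit_square R, continuous F}, forall s, 0 <= s <= 1 -> F (s, 1) = l s,
      forall s, 0 <= s <= 1 -> F (s, 0) = F (0, 0)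
    & forall t, 0 <= t <= 1 -> F (0, t) = F (1, t)].

Lemma circle_fst (z : R * R) : unit_circle z -> z.2 = 0 -> 1 <= `|z.1|.
Proof.
rewrite /unit_circle /= => zc y0; move: zc; rewrite y0 expr0n addr0 => h.
have := normr_ge0 z.1; have : `|z.1| ^+ 2 = 1 by rewrite real_normK ?num_real.
by move=> e p; rewrite leNgt; apply/negP => ?; nra.
Qed.

Lemma circle_ang_down (z : R * R) (l : R -> T) : unit_circle z -> l 0 = l 1 ->
  z.2 <= 0 -> l (ang z) = l (ang_down z).
Proof.
move=> zc l01 y0; rewrite /ang; case: ifP => // y1.
have yz : z.2 = 0 by apply/eqP; rewrite eq_le y0 y1.
have x1 := circle_fst zc yz.
have [||->|[-> ->]//] := @ang_agree _ z yz => //; last by lra.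
by apply/eqP => e; move: x1; rewrite e normr0; lra.
Qed.

Lemma ang_down_itv (z : R * R) : 0 <= ang_down z <= 1.
Proof. by have := ang_up_itv z; rewrite ang_down_up => /andP[? ?]; apply/andP; split; lra. Qed.

Lemma ang_up_itv1 (z : R * R) : 0 <= ang_up z <= 1.
Proof. by have := ang_up_itv z; move=> /andP[? ?]; apply/andP; split; lra. Qed.

Lemma loop_circle (l : R -> T) : {within @unit_itv R, continuous l} -> l 0 = l 1 ->
  {within @unit_circle R, continuous (l \o @ang R)}.
Proof.
move=> cl l01; apply: (within_glue (@cont_snd R)).
  apply: (@within_cont_eq _ _ _ (l \o @ang_up R)).
    by move=> z [zc /= y0]; rewrite /ang y0.
  apply: within_cont_comp cl; last by move=> z _; exact: ang_up_itv1.
  by apply: continuous_within; exact: ang_up_cont.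
apply: (@within_cont_eq _ _ _ (l \o @ang_down R)).
  by move=> z [zc /= y0]; rewrite (circle_ang_down zc).
apply: within_cont_comp cl; last by move=> z _; exact: ang_down_itv.
by apply: continuous_within; exact: ang_down_cont.
Qed.

Lemma simply_connected_loops : simply_connected_space R T ->
  forall l : R -> T, {within @unit_itv R, continuous l} -> l 0 = l 1 -> null_loop l.
Proof.
move=> [_ sc] l cl l01; have [g cg gE] := sc _ (loop_circle cl l01).
exists (fun st => g (st.2 * (circ st.1).1, st.2 * (circ st.1).2)); split.
- apply: (@within_cont_comp _ _ _ _ (@unit_disk R)) cg.
    apply: continuous_within.
    have cc : continuous (fun st : R * R => circ st.1).
      by move=> st; exact: (continuous_comp (@cont_fst R st) (@circ_cont R _)).
    have c1 : continuous (fun st : R * R => (circ st.1).1).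
      by move=> st; exact: (continuous_comp (cc st) (@cont_fst R _)).
    have c2 : continuous (fun st : R * R => (circ st.1).2).
      by move=> st; exact: (continuous_comp (cc st) (@cont_snd R _)).
    exact: (cont_pair (cont_mul (@cont_snd R) c1) (cont_mul (@cont_snd R) c2)).
  move=> [s t] [/= /andP[s0 s1] /andP[t0 t1]]; have := circ_circle s0 s1.
  rewrite /unit_circle /unit_disk /= !exprMn -mulrDr => ->; rewrite mulr1.
  by rewrite expr_le1.
- move=> s /andP[s0 s1]; rewrite (_ : (s, 1).1 = s) // (_ : (s, 1).2 = 1) // !mul1r.
  have -> : ((circ s).1, (circ s).2) = circ s by case: (circ s).
  rewrite gE; last exact: circ_circle.
  move: s1; rewrite le_eqVlt => /orP[/eqP->|s1]; last by rewrite /= ang_circ.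
  by rewrite circ1 -circ0 /= ang_circ ?ltr01 // l01.
- by move=> s _; rewrite /= !mul0r.
- by move=> t _; rewrite (_ : circ (0, t).1 = circ (1, t).1) //; transitivity (circ 0 : R * R) => //; rewrite circ0 -circ1.
Qed.

Lemma loops_simply_connected : path_connected_space R T ->
  (forall l : R -> T, {within @unit_itv R, continuous l} -> l 0 = l 1 -> null_loop l) ->
  simply_connected_space R T.
Proof.
move=> pc nl; split=> // f cf.
have [||F [cF F1 F0 Fp]] := nl (f \o @circ R).
- apply: within_cont_comp cf; first by apply: continuous_within; exact: circ_cont.
  by move=> s /andP[]; exact: circ_circle.
- by rewrite /= circ0 circ1.
(* The radius vanishes for norm at most 1/2, and there F is constant; this hides the behaviour of
   the angle near the origin. Farther out the two formulas for the angle agree on the axis up to the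
   identification of 0 with 1. *)
pose rad (z : R * R) := Num.max 0 (2 * norm2 z.1 z.2 - 1).
have crad : continuous rad.
  apply: (cont_max (@cont_const _ _ 0)).
  exact: (cont_add (cont_mul (@cont_const _ _ 2) (norm2_cont (@cont_fst R) (@cont_snd R))) (@cont_const _ _ (-1))).
have nle z : unit_disk z -> norm2 z.1 z.2 <= 1.
  by rewrite /unit_disk /= => h; rewrite -sqrtr1 ler_wsqrtr.
have radI z : unit_disk z -> 0 <= rad z <= 1.
  move=> /nle h; rewrite /rad le_max lexx /= ge_max ler01 /=; lra.
have radF (s : R) z : 0 <= s <= 1 -> rad z = 0 -> F (s, rad z) = F (0, 0).
  by move=> sI ->; exact: F0.
have agree z : z.2 = 0 -> F (ang_up z, rad z) = F (ang_down z, rad z) \/ ~ unit_disk z.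
  move=> y0; case: (pselect (unit_disk z)) => [zd|]; [left|by right].
  case: (lerP (rad z) 0) => r0.
    have e : rad z = 0 by apply/eqP; rewrite eq_le r0; case/andP: (radI z zd).
    by rewrite !radF ?ang_up_itv1 ?ang_down_itv.
  have nz : 2^-1 < `|z.1|.
    move: r0; rewrite /rad lt_max ltxx /= /norm2 y0 expr0n addr0 sqrtr_sqr; lra.
  have [||->//|[-> ->]] := @ang_agree _ z y0; last by rewrite Fp //; exact: radI.
    by apply/eqP => e; move: nz; rewrite e normr0; lra.
  lra.
exists (fun z => F (ang z, rad z)).
  apply: (within_glue (@cont_snd R)).
    apply: (@within_cont_eq _ _ _ (F \o (fun z => (ang_up z, rad z)))).
      by move=> z [zc /= y0]; rewrite /ang y0.
    apply: within_cont_comp cF.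
      by apply: continuous_within; exact: (cont_pair (@ang_up_cont R) crad).
    by move=> z [zd _]; split; [exact: ang_up_itv1|exact: radI].
  apply: (@within_cont_eq _ _ _ (F \o (fun z => (ang_down z, rad z)))).
    move=> z [zd /= y0]; rewrite /ang; case: ifP => // y1.
    by have [->|//] := agree z (ltac:(by apply/eqP; rewrite eq_le y0 y1)).
  apply: within_cont_comp cF.
    by apply: continuous_within; exact: (cont_pair (@ang_down_cont R) crad).
  by move=> z [zd _]; split; [exact: ang_down_itv|exact: radI].
move=> z zc.
have -> : rad z = 1.
  by rewrite /rad /norm2 (zc : _ = _) sqrtr1 max_r; lra.
have [cu cd] := circ_ang_aux zc.
rewrite /ang; case: (lerP 0 z.2) => y0; rewrite F1 ?ang_up_itv1 ?ang_down_itv //= ?cu ?cd //.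
exact: ltW.
Qed.

End Loops.

Local Close Scope ring_scope.

Local Open Scope ring_scope.

(** * Homotopies of paths *)

Section Homotopy.
Variables (R : realType) (T : topologicalType).
Local Notation I := (@unit_itv R).
Local Notation Sq := (@unit_square R).
Implicit Types (f g h : R -> T).

Definition pcat (U : Type) (f g : R -> U) (s : R) : U :=
  if s <= 2^-1 then f (2 * s) else g (2 * s - 1).

Definition homot f g : Prop := exists F : R * R -> T,
  [/\ {within Sq, continuous F},
      forall s, I s -> F (s, 0) = f s /\ F (s, 1) = g s
    & forall t, I t -> F (0, t) = f 0 /\ F (1, t) = f 1].

Definition cpath f := {within I, continuous f}.

Lemma I0 : I 0. Proof. by rewrite /unit_itv /= lexx ler01. Qed.
Lemma I1 : I 1. Proof. by rewrite /unit_itv /= lexx ler01. Qed.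

Lemma hom_ends f g : homot f g -> f 0 = g 0 /\ f 1 = g 1.
Proof.
case=> F [_ F1 F2]; have [a b] := F2 1 I1; have [_ c] := F1 0 I0; have [_ d] := F1 1 I1.
by rewrite -a -b c d.
Qed.

(** The square is convex, so two paths in it with common ends are joined by segments. The
    reparametrizations below are instances. *)
Lemma hom_sub (S : R * R -> T) (phi psi : R -> R * R) : {within Sq, continuous S} ->
  continuous phi -> continuous psi -> (forall s, I s -> Sq (phi s)) ->
  (forall s, I s -> Sq (psi s)) -> phi 0 = psi 0 -> phi 1 = psi 1 ->
  homot (S \o phi) (S \o psi).
Proof.
move=> cS cphi cpsi Iphi Ipsi e0 e1.
pose k (z : R * R) : R * R := ((1 - z.2) * (phi z.1).1 + z.2 * (psi z.1).1,
                       (1 - z.2) * (phi z.1).2 + z.2 * (psi z.1).2).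
have ck : continuous k.
  have c2 : continuous (fun z : R * R => 1 - z.2).
    exact: (cont_add (@cont_const _ _ 1) (cont_opp (@cont_snd R))).
  have comp (a : R -> R * R) (b : R * R -> R) : continuous a -> continuous b ->
      continuous (fun z : R * R => b (a z.1)).
    move=> ca cb z; apply: (@continuous_comp _ _ _ (fun z : R * R => a z.1) b z).
      by apply: (@continuous_comp _ _ _ (fun z : R * R => z.1) a z);
        [exact: cont_fst|exact: ca].
    exact: cb.
  have mk (b : R * R -> R) : continuous b ->
      continuous (fun z : R * R => (1 - z.2) * b (phi z.1) + z.2 * b (psi z.1)).
    move=> cb; exact: (cont_add (cont_mul c2 (comp _ _ cphi cb)) (cont_mul (@cont_snd R) (comp _ _ cpsi cb))).
  exact: (cont_pair (mk _ (@cont_fst R)) (mk _ (@cont_snd R))).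
have conv (t a b : R) : 0 <= t <= 1 -> 0 <= a <= 1 -> 0 <= b <= 1 -> 0 <= (1 - t) * a + t * b <= 1.
  by move=> /andP[? ?] /andP[? ?] /andP[? ?]; apply/andP; split; nra.
exists (S \o k); split.
- apply: within_cont_comp cS; first exact: continuous_within.
  move=> [s t] [/= Is It]; have [a b] := Iphi _ Is; have [c d] := Ipsi _ Is.
  by split; exact: conv.
- move=> s Is; rewrite /k /= !(subr0, mul1r, mul0r, addr0, subrr, add0r).
  by rewrite -!surjective_pairing.
- move=> t It; rewrite /k /= -e0 -e1 -!mulrDl subrK !mul1r.
  by rewrite -!surjective_pairing.
Qed.

Lemma hom_eq f f' g g' : homot f g -> (forall s, I s -> f s = f' s) ->
  (forall s, I s -> g s = g' s) -> homot f' g'.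
Proof.
move=> [F [cF F1 F2]] ef eg; exists F; split=> // s Is.
  by have [-> ->] := F1 s Is; rewrite ef ?eg.
by have [-> ->] := F2 s Is; rewrite !ef //; [exact: I1|exact: I0].
Qed.

Lemma hom_sym f g : homot f g -> homot g f.
Proof.
move=> fg; have [e0 e1] := hom_ends fg; case: fg => F [cF F1 F2].
exists (F \o (fun z => (z.1, 1 - z.2))); split.
- apply: within_cont_comp cF.
    apply: continuous_within; apply: (cont_pair (@cont_fst R)).
    exact: (cont_add (@cont_const _ _ 1) (cont_opp (@cont_snd R))).
  by move=> [s t] [/= Is /andP[? ?]]; split=> //=; apply/andP; split; lra.
- by move=> s Is /=; rewrite subr0 subrr; case: (F1 s Is).
- move=> t /andP[? ?] /=; rewrite -e0 -e1; apply: F2; apply/andP; split; lra.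
Qed.

Lemma hom_path_sub (f : R -> T) (phi psi : R -> R) : cpath f ->
  continuous phi -> continuous psi -> (forall s, I s -> I (phi s)) ->
  (forall s, I s -> I (psi s)) -> phi 0 = psi 0 -> phi 1 = psi 1 ->
  homot (f \o phi) (f \o psi).
Proof.
move=> cf cphi cpsi Iphi Ipsi e0 e1.
apply: (@hom_sub (f \o fst) (fun s => (phi s, 0)) (fun s => (psi s, 0))) => //.
- apply: within_cont_comp cf; last by move=> z [].
  by apply: continuous_within; exact: cont_fst.
- exact: (cont_pair cphi (@cont_const _ _ 0)).
- exact: (cont_pair cpsi (@cont_const _ _ 0)).
- by move=> s Is; split; [exact: Iphi|exact: I0].
- by move=> s Is; split; [exact: Ipsi|exact: I0].
- by rewrite e0.
- by rewrite e1.
Qed.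

Lemma hom_refl f : cpath f -> homot f f.
Proof.
by move=> cf; apply: (@hom_path_sub f id id) => //; exact: cont_id.
Qed.

Lemma half_affine (U : topologicalType) (c : U -> R) : continuous c ->
  continuous (fun z => 2 * c z) /\ continuous (fun z => 2 * c z - 1).
Proof.
move=> cc; have h : continuous (fun z => 2 * c z) by exact: (cont_mul (@cont_const _ _ 2) cc).
by split=> //; exact: (cont_add h (@cont_const _ _ (-1))).
Qed.

Lemma half_le (t : R) : (t <= 2^-1) = (2 * t - 1 <= 0).
Proof. by apply/idP/idP => h; lra. Qed.

Lemma hom_trans f g h : homot f g -> homot g h -> homot f h.
Proof.
move=> fg [K [cK K1 K2]]; have [e0 e1] := hom_ends fg; case: fg => F [cF F1 F2].
have [c1 c2] := half_affine (@cont_snd R).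
exists (fun z => if z.2 <= 2^-1 then F (z.1, 2 * z.2) else K (z.1, 2 * z.2 - 1)); split.
- apply: (@within_glue _ _ _ _ _ (fun z : R * R => 2 * z.2 - 1)) => //.
    apply: (@within_cont_eq _ _ _ (K \o (fun z => (z.1, 2 * z.2 - 1)))).
      move=> [s t] [[/= Is _] t1]; case: ifP => // t2.
      have -> : t = 2^-1 by lra.
      by rewrite mulfV // subrr; have [_ ->] := F1 s Is; have [-> _] := K1 s Is.
    apply: within_cont_comp cK; first by apply: continuous_within; exact: (cont_pair (@cont_fst R) c2).
    by move=> [s t] [[/= Is /andP[? ?]] t1]; split=> //=; apply/andP; split; lra.
  apply: (@within_cont_eq _ _ _ (F \o (fun z => (z.1, 2 * z.2)))).
    by move=> [s t] [_ t1]; rewrite /= half_le t1.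
  apply: within_cont_comp cF; first by apply: continuous_within; exact: (cont_pair (@cont_fst R) c1).
  by move=> [s t] [[/= Is /andP[? ?]] t1]; split=> //=; apply/andP; split; lra.
- move=> s Is /=; rewrite invr_ge0 ler0n mulr0 invf_ge1 // lern1 /= mulr1.
  have -> : 2 - 1 = 1 :> R by lra.
  by have [-> _] := F1 s Is; have [_ ->] := K1 s Is.
- move=> t /andP[? ?] /=; case: ifP => ht; first by apply: F2; apply/andP; split; lra.
  have [] := K2 (2 * t - 1); first by apply/andP; split; lra.
  by move=> -> ->.
Qed.

Lemma hom_cat f f' g g' : homot f f' -> homot g g' -> f 1 = g 0 ->
  homot (pcat f g) (pcat f' g').
Proof.
move=> [F [cF F1 F2]] [K [cK K1 K2]] fg.
have [c1 c2] := half_affine (@cont_fst R).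
exists (fun z => if z.1 <= 2^-1 then F (2 * z.1, z.2) else K (2 * z.1 - 1, z.2)); split.
- apply: (@within_glue _ _ _ _ _ (fun z : R * R => 2 * z.1 - 1)) => //.
    apply: (@within_cont_eq _ _ _ (K \o (fun z => (2 * z.1 - 1, z.2)))).
      move=> [s t] [[/= _ It] t1]; case: ifP => // t2.
      have -> : s = 2^-1 by lra.
      by rewrite mulfV // subrr; have [_ ->] := F2 t It; have [-> _] := K2 t It.
    apply: within_cont_comp cK; first by apply: continuous_within; exact: (cont_pair c2 (@cont_snd R)).
    by move=> [s t] [[/= /andP[? ?] It] t1]; split=> //=; apply/andP; split; lra.
  apply: (@within_cont_eq _ _ _ (F \o (fun z => (2 * z.1, z.2)))).
    by move=> [s t] [_ t1]; rewrite /= half_le t1.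
  apply: within_cont_comp cF; first by apply: continuous_within; exact: (cont_pair c1 (@cont_snd R)).
  by move=> [s t] [[/= /andP[? ?] It] t1]; split=> //=; apply/andP; split; lra.
- move=> s /andP[? ?] /=; rewrite /pcat; case: ifP => hs.
    by apply: F1; apply/andP; split; lra.
  by apply: K1; apply/andP; split; lra.
- move=> t It /=; rewrite /pcat invr_ge0 ler0n mulr0 invf_ge1 // lern1 /= mulr1.
  have -> : 2 - 1 = 1 :> R by lra.
  by have [-> _] := F2 t It; have [_ ->] := K2 t It.
Qed.

Lemma hom_cpath f g : homot f g -> cpath f.
Proof.
move=> [F [cF F1 _]]; apply: (@within_cont_eq _ _ _ (F \o (fun s => (s, 0)))).
  by move=> s Is /=; case: (F1 s Is).
apply: within_cont_comp cF; last by move=> s Is; split=> //; exact: I0.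
by apply: continuous_within; exact: (cont_pair (@cont_id R) (@cont_const _ _ 0)).
Qed.

Lemma cat_cpath f g : cpath f -> cpath g -> f 1 = g 0 -> cpath (pcat f g).
Proof. by move=> cf cg e; apply: hom_cpath (hom_cat (hom_refl cf) (hom_refl cg) e). Qed.

Lemma pcat0 f g : pcat f g 0 = f 0.
Proof. by rewrite /pcat invr_ge0 ler0n mulr0. Qed.

Lemma pcat1 f g : pcat f g 1 = g 1.
Proof.
by rewrite /pcat invf_ge1 // lern1 /= mulr1; congr g; lra.
Qed.

Lemma cpath_const (x : T) : cpath (fun=> x).
Proof. by apply: continuous_within => z; exact: cvg_cst. Qed.

(** The pairs [(m1, m0)] and [(m0, m1)] each run along two sides of the square, from the same corner
    to the opposite one. *)
Let m0 (s : R) := Num.max 0 (2 * s - 1).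
Let m1 (s : R) := Num.min 1 (2 * s).

Lemma cont_min (U : topologicalType) (f g : U -> R) : continuous f -> continuous g ->
  continuous (fun t => Num.min (f t) (g t)).
Proof. by move=> cf cg t; exact: (continuous_min (cf t) (cg t)). Qed.

Let m0c : continuous m0.
Proof. exact: (cont_max (@cont_const _ _ 0) (half_affine (@cont_id R)).2). Qed.

Let m1c : continuous m1.
Proof. exact: (cont_min (@cont_const _ _ 1) (half_affine (@cont_id R)).1). Qed.

Let m0I s : I s -> I (m0 s).
Proof.
move=> /andP[? ?]; rewrite /m0; apply/andP.
by case: (max_cases 0 (2 * s - 1)) => -[? ->]; split; lra.
Qed.

Let m1I s : I s -> I (m1 s).
Proof.
move=> /andP[? ?]; rewrite /m1; apply/andP.
by case: (leP 1 (2 * s)) => ?; split; lra.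
Qed.

Let m0l s : s <= 2^-1 -> m0 s = 0.
Proof. by move=> ?; rewrite /m0 max_l //; lra. Qed.
Let m0r s : 2^-1 <= s -> m0 s = 2 * s - 1.
Proof. by move=> ?; rewrite /m0 max_r //; lra. Qed.
Let m1l s : s <= 2^-1 -> m1 s = 2 * s.
Proof. by move=> ?; rewrite /m1 min_r //; lra. Qed.
Let m1r s : 2^-1 <= s -> m1 s = 1.
Proof. by move=> ?; rewrite /m1 min_l //; lra. Qed.

Let m00 : m0 0 = 0. Proof. by apply: m0l; lra. Qed.
Let m01 : m0 1 = 1. Proof. by rewrite m0r; lra. Qed.
Let m10 : m1 0 = 0. Proof. by rewrite m1l; lra. Qed.
Let m11 : m1 1 = 1. Proof. by rewrite m1r; lra. Qed.

Lemma hom_const_cat f : cpath f -> homot (pcat (fun=> f 0) f) f.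
Proof.
move=> cf; apply: hom_eq (@hom_path_sub f m0 id cf m0c (@cont_id R) m0I _ m00 m01) _ _ => //.
move=> s _; rewrite /pcat /=; case: ifP => hs; first by rewrite m0l.
by rewrite m0r //; lra.
Qed.

Lemma hom_cat_const f : cpath f -> homot (pcat f (fun=> f 1)) f.
Proof.
move=> cf; apply: hom_eq (@hom_path_sub f m1 id cf m1c (@cont_id R) m1I _ m10 m11) _ _ => //.
move=> s _; rewrite /pcat /=; case: ifP => hs; first by rewrite m1l.
by rewrite m1r //; lra.
Qed.

Lemma hom_cat_rev f : cpath f -> homot (pcat f (fun s => f (1 - s))) (fun=> f 0).
Proof.
move=> cf; pose phi (s : R) : R := 1 - `|1 - 2 * s|.
have c2 := (half_affine (@cont_id R)).1.
have cphi : continuous phi.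
  apply: (cont_add (@cont_const _ _ 1)); apply: cont_opp; apply: cont_norm.
  exact: (cont_add (@cont_const _ _ 1) (cont_opp c2)).
apply: hom_eq (@hom_path_sub f phi (fun=> 0) cf cphi (@cont_const _ _ 0) _ _ _ _) _ _ => //.
- move=> s /andP[? ?]; rewrite /phi; apply/andP.
  by case: (norm_cases (1 - 2 * s)) => -[? ->]; split; lra.
- by move=> s _; exact: I0.
- by rewrite /phi mulr0 subr0 normr1 subrr.
- by rewrite /phi mulr1 (_ : 1 - 2 = -1) ?normrN1 ?subrr //; lra.
- move=> s _; rewrite /pcat /phi /=; case: ifP => hs.
    by rewrite ger0_norm; [congr f|]; lra.
  by rewrite ler0_norm; [congr f|]; lra.
Qed.

Lemma hom_catA f g h : cpath f -> cpath g -> cpath h -> f 1 = g 0 -> g 1 = h 0 ->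
  homot (pcat (pcat f g) h) (pcat f (pcat g h)).
Proof.
(* On the unit interval psi is piecewise affine with slopes 1/2, 1 and 2 and breaks at 1/2 and 3/4,
   which turns the left bracketing into the right one. *)
move=> cf cg ch fg gh; pose psi (s : R) : R := Num.max (s / 2) (Num.max (s - 4^-1) (2 * s - 1)).
have ck : cpath (pcat (pcat f g) h).
  by apply: cat_cpath => //; [exact: cat_cpath|rewrite pcat1].
have cpsi : continuous psi.
  apply: cont_max; first exact: (cont_mul (@cont_id R) (@cont_const _ _ 2^-1)).
  apply: cont_max; last exact: (half_affine (@cont_id R)).2.
  exact: (cont_add (@cont_id R) (@cont_const _ _ (- 4^-1))).
have psi1 s : s <= 2^-1 -> psi s = s / 2.
  by move=> ?; rewrite /psi max_l // ge_max; apply/andP; split; lra.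
have psi2 s : 2^-1 <= s -> s <= 3 / 4 -> psi s = s - 4^-1.
  by move=> ? ?; rewrite /psi max_r ?max_l ?le_max; lra.
have psi3 s : 3 / 4 <= s -> psi s = 2 * s - 1.
  by move=> ?; rewrite /psi max_r ?max_r ?le_max; lra.
apply: hom_eq (@hom_path_sub _ id psi ck (@cont_id R) cpsi _ _ _ _) _ _ => //.
- move=> s /andP[? ?]; rewrite /psi; apply/andP.
  case: (max_cases (s - 4^-1) (2 * s - 1)) => -[? ->].
    by case: (max_cases (s / 2) (2 * s - 1)) => -[? ->]; split; lra.
  by case: (max_cases (s / 2) (s - 4^-1)) => -[? ->]; split; lra.
- by rewrite psi1 ?mul0r //; lra.
- by rewrite psi3; lra.
- move=> s _ /=; rewrite /pcat; case: (ifP (s <= _)) => h1.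
    by rewrite psi1 // !ifT; [congr f| |]; lra.
  have {}h1 : 2^-1 < s by rewrite ltNge h1.
  case: (ifP (2 * s - 1 <= _)) => h2.
    rewrite psi2; [|lra|lra].
    rewrite (_ : s - 4^-1 <= 2^-1) /=; last lra.
    case: ifP => h3; last by congr g; lra.
    by exfalso; clear fg gh; lra.
  rewrite psi3; last by lra.
  by rewrite ifF; [congr h|apply/negP]; lra.
Qed.

Lemma hom_square (S : R * R -> T) : {within Sq, continuous S} ->
  homot (pcat (fun s => S (s, 0)) (fun t => S (1, t)))
      (pcat (fun t => S (0, t)) (fun s => S (s, 1))).
Proof.
move=> cS.
apply: hom_eq (@hom_sub S (fun s => (m1 s, m0 s)) (fun s => (m0 s, m1 s)) cS
  (cont_pair m1c m0c) (cont_pair m0c m1c) _ _ _ _) _ _.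
- by move=> s Is; split; [exact: m1I|exact: m0I].
- by move=> s Is; split; [exact: m0I|exact: m1I].
- by rewrite m00 m10.
- by rewrite m01 m11.
- move=> s _; rewrite /pcat /=; case: ifP => hs; first by rewrite m1l ?m0l.
  by rewrite m1r ?m0r //; lra.
- move=> s _; rewrite /pcat /=; case: ifP => hs; first by rewrite m1l ?m0l.
  by rewrite m1r ?m0r //; lra.
Qed.

End Homotopy.

(** * Geometric realization *)

Section CompactUniform.
Variable R : realType.

(** It serves twice: on the square for Lebesgue numbers, and on a segment for neighbourhoods in the
    weak topology. *)
Lemma compact_uniform (S : topologicalType) (K : set S) (P : R -> S -> Prop) : compact K ->
  (forall x, K x -> exists2 e : R, 0 < e &
     \forall x' \near x, forall d, 0 < d -> d < e -> P d x') ->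
  exists2 e : R, 0 < e & forall x, K x -> P e x.
Proof.
move=> /compact_near_coveringP nc h.
have := nc nat \oo (fun n x => P n.+1%:R^-1 x) _ _.
case=> [x Kx|n _ /(_ n (leqnn n)) hn].
  have [e e0 he] := h x Kx.
  exists ([set x' | forall d, 0 < d -> d < e -> P d x'], [set n | n.+1%:R^-1 < e]).
    by split=> //=; exact: (near_infty_natSinv_lt (PosNum e0)).
  by move=> [x' n] [/= h1 h2]; apply: h1 => //; rewrite invr_gt0 ltr0n.
by exists n.+1%:R^-1; rewrite ?invr_gt0 ?ltr0n.
Qed.

Lemma unit_square_compact : compact (@unit_square R).
Proof.
have := compact_setX (@segment_compact R 0 1) (@segment_compact R 0 1).
congr compact; apply/seteqP; split=> -[s t] /=; rewrite !in_itv /=; by case.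
Qed.

Lemma lebesgue_number (A : Type) (Q : A -> set (R * R)) :
  (forall z, unit_square z -> exists a, \forall z' \near z, unit_square z' -> Q a z') ->
  exists2 e : R, 0 < e & forall z, unit_square z -> exists a, forall z', unit_square z' ->
    `|z.1 - z'.1| < e -> `|z.2 - z'.2| < e -> Q a z'.
Proof.
move=> h; apply: (compact_uniform (P := fun e z => exists a, forall z', unit_square z' ->
  `|z.1 - z'.1| < e -> `|z.2 - z'.2| < e -> Q a z') unit_square_compact) => z zs.
have [a /nbhs_ballP[r /= r0 hr]] := h z zs.
have rr : 0 < r / 2 by rewrite divr_gt0.
exists (r / 2) => //; apply: filterS (nbhsx_ballx z _ rr).
move=> z1 [b1 b2] d d0 dr; exists a => z' zs' h1 h2; apply: hr => //.
split; rewrite /ball /=.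
  rewrite (_ : z.1 - z'.1 = (z.1 - z1.1) + (z1.1 - z'.1)); last by rewrite addrA subrK.
  by apply: le_lt_trans (ler_normD _ _) _; move: b1; rewrite /ball /=; lra.
rewrite (_ : z.2 - z'.2 = (z.2 - z1.2) + (z1.2 - z'.2)); last by rewrite addrA subrK.
by apply: le_lt_trans (ler_normD _ _) _; move: b2; rewrite /ball /=; lra.
Qed.

End CompactUniform.

Section Points.
Variables (R : realType) (X : cell_complex).
Local Notation T := (realization R X).
Implicit Types (x y : T) (a b : node X) (s : seq (node X)) (t : R).

Lemma point_ext x y : (forall a, bary x a = bary y a) -> x = y.
Proof.
case: x y => [w wP] [w' wP'] /= e; have ew : w = w' by apply/funext.
by case: _ / ew wP' => wP'; congr Point; exact: Prop_irrelevance.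
Qed.

Lemma side_corner (f : face X) : exists u v, side f u v.
Proof.
have [n [c [n3 _ sE]]] := side_cycle f.
case: n c n3 sE => [|[|n]] // c n3 sE.
have h1 : (1 < n.+2)%N by [].
exists (tnth c ord0), (tnth c (Ordinal h1)); apply/sE; exists ord0, (Ordinal h1).
by split=> //; rewrite /cyc_adj /= modn_small // eqxx.
Qed.

Lemma side_neq (f : face X) u v : side f u v -> u != v.
Proof. by move=> /side_adj; apply: contraTneq => ->; rewrite adj_irr. Qed.

Lemma simplex_uniq s : simplex s -> uniq s.
Proof.
case=> [u|u v uv|f u v uv] //=.
  by rewrite inE andbT; apply: contraTneq uv => -[->]; rewrite adj_irr.
rewrite !inE !andbT /=; apply/eqP => -[e].
by have := side_neq uv; rewrite e eqxx.
Qed.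

Lemma has_simplex a : exists2 s, simplex s & a \in s.
Proof.
case: a => [u|f]; first by exists [:: inl u]; [exact: SVertex|rewrite inE eqxx].
have [u [v uv]] := side_corner f.
by exists [:: inr f; inl u; inl v]; [exact: (SCorner uv)|rewrite inE eqxx].
Qed.

Lemma in_simplex_delta s a : simplex s -> a \in s ->
  in_simplex s (fun b => (b == a)%:R : R).
Proof.
move=> ss sa; split=> [b|b bs|]; first by rewrite ler0n.
  by case: eqP bs => // ->; rewrite sa.
rewrite (bigD1_seq a) ?simplex_uniq //= eqxx big1 ?addr0 // => b /negbTE -> //.
Qed.

Lemma pt_subproof a : exists2 s, simplex s & in_simplex s (fun b => (b == a)%:R : R).
Proof. by have [s ss sa] := has_simplex a; exists s => //; exact: in_simplex_delta. Qed.

Definition pt a : T := Point (pt_subproof a).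

Lemma pt_in s a : simplex s -> a \in s -> in_simplex s (bary (pt a)).
Proof. exact: in_simplex_delta. Qed.

Definition coface x y := exists2 s, simplex s & in_simplex s (bary x) /\ in_simplex s (bary y).

Lemma in_simplex_mix s (w w' : node X -> R) t : 0 <= t <= 1 ->
  in_simplex s w -> in_simplex s w' -> in_simplex s (fun a => (1 - t) * w a + t * w' a).
Proof.
move=> /andP[t0 t1] [p0 o0 s0] [p1 o1 s1]; split=> [a|a as_|].
- by rewrite addr_ge0 // mulr_ge0 // subr_ge0.
- by rewrite o0 // o1 // !mulr0 addr0.
- by rewrite big_split /= -!mulr_sumr s0 s1 !mulr1 subrK.
Qed.

Lemma mix_subproof x y t : coface x y -> 0 <= t <= 1 ->
  exists2 s, simplex s & in_simplex s (fun a => (1 - t) * bary x a + t * bary y a).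
Proof. by move=> [s ss [h1 h2]] tI; exists s => //; exact: in_simplex_mix. Qed.

(* Junk value [x] if x and y do not lie in a common simplex. *)
Definition mix x y t : T :=
  if pselect (coface x y /\ 0 <= t <= 1) is left h
  then Point (mix_subproof (proj1 h) (proj2 h)) else x.

Lemma mixE x y t a : coface x y -> 0 <= t <= 1 ->
  bary (mix x y t) a = (1 - t) * bary x a + t * bary y a.
Proof. by move=> h1 h2; rewrite /mix; case: pselect => // -[]. Qed.

Lemma mix_in s x y t : simplex s -> in_simplex s (bary x) -> in_simplex s (bary y) ->
  0 <= t <= 1 -> in_simplex s (bary (mix x y t)).
Proof.
move=> ss xs ys tI; have h : coface x y by exists s.
rewrite (_ : bary _ = (fun a => (1 - t) * bary x a + t * bary y a)).
  exact: in_simplex_mix.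
by apply/funext => a; exact: mixE.
Qed.

Lemma mix0 x y : mix x y 0 = x.
Proof.
apply: point_ext => a; rewrite /mix; case: pselect => // -[h1 h2] /=.
by rewrite subr0 mul1r mul0r addr0.
Qed.

Lemma mix1 x y : coface x y -> mix x y 1 = y.
Proof.
move=> h; apply: point_ext => a; rewrite mixE ?lexx ?ler01 //.
by rewrite subrr mul0r mul1r add0r.
Qed.

Lemma mixxx x t : mix x x t = x.
Proof.
apply: point_ext => a; rewrite /mix; case: pselect => // -[h1 h2] /=.
by rewrite -mulrDl subrK mul1r.
Qed.

Lemma supp_in s x a : in_simplex s (bary x) -> 0 < bary x a -> a \in s.
Proof. by move=> [_ o _] p; apply: contraLR p => /o ->; rewrite ltxx. Qed.

Lemma bary_ge0 x a : 0 <= bary x a.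
Proof. by have [s _ [p _ _]] := baryP x. Qed.

Lemma bary_le1 x a : bary x a <= 1.
Proof.
have [s ss [p o e]] := baryP x; case: (boolP (a \in s)) => as_; last by rewrite o ?ler01.
rewrite -e (bigD1_seq a) ?simplex_uniq //= lerDl.
by apply: sumr_ge0.
Qed.

Lemma supp_ex x : exists a, 0 < bary x a.
Proof.
have [s ss [p o e]] := baryP x; apply/not_existsP => h.
have z a : bary x a = 0 by apply/eqP; rewrite eq_le p andbT leNgt; apply/negP => /h.
by have := oner_neq0 R; rewrite -e big1 ?eqxx.
Qed.

Lemma coface_pt x a : 0 < bary x a -> coface x (pt a).
Proof.
move=> p; have [s ss xs] := baryP x; exists s => //; split=> //.
by apply: pt_in => //; exact: supp_in xs p.
Qed.

Lemma bary_pt a b : bary (pt a) b = (b == a)%:R.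
Proof. by []. Qed.

Lemma nbhs_open x (V : set T) : nbhs x V -> exists2 U : set T, realization_open U & U x /\ U `<=` V.
Proof. by rewrite nbhsE => -[U [oU Ux] UV]; exists U => //; split. Qed.

Lemma open_nbhsT x (U : set T) : realization_open U -> U x -> nbhs x U.
Proof. by move=> oU Ux; rewrite nbhsE; exists U => //; split. Qed.

Lemma star_open a : realization_open [set x : T | 0 < bary x a].
Proof.
move=> s x ss xs /= xa; exists (bary x a) => // y ys /(_ a).
by rewrite ltr_distl => /andP[_]; rewrite -ltrBlDr subrr.
Qed.

Section OneSimplex.
Variables (S : topologicalType) (D : set S) (W : S -> T) (s : seq (node X)).
Hypotheses (ss : simplex s) (Ws : forall z, D z -> in_simplex s (bary (W z))).
Hypothesis (cW : forall a, {within D, continuous (fun z => bary (W z) a)}).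

Lemma one_simplex_cont : {within D, continuous W}.
Proof.
apply: (iffRL (within_contP D W)) => z Dz V /nbhs_open[U oU [Uz UV]].
have [e e0 eU] := oU s _ ss (Ws Dz) Uz.
have near_all (l : seq (node X)) : \forall z' \near z, D z' ->
    forall a, a \in l -> `|bary (W z) a - bary (W z') a| < e.
  elim: l => [|a l IH]; first by apply: filterE => z' _ a; rewrite in_nil.
  have ha := iffLR (within_contP D (fun z => bary (W z) a)) (@cW a) z Dz _ (nbhsx_ballx (bary (W z) a) _ e0).
  apply: filterS2 ha IH => z' h1 h2 Dz' b; rewrite inE => /orP[/eqP->|bl].
    exact: h1.
  exact: h2.
apply: filterS (near_all s) => z' h Dz'; apply: UV; apply: eU; first exact: Ws.
move=> a; case: (boolP (a \in s)) => as_; first exact: h.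
have [_ o1 _] := Ws Dz; have [_ o2 _] := Ws Dz'.
by rewrite o1 // o2 // subrr normr0.
Qed.

End OneSimplex.

Lemma mix_cpath x y : coface x y -> cpath (mix x y).
Proof.
move=> h; have [s ss [xs ys]] := h.
apply: (one_simplex_cont ss) => [t tI|a]; first exact: mix_in.
apply: (@within_cont_eq _ _ _ (fun t => (1 - t) * bary x a + t * bary y a)).
  by move=> t tI; rewrite mixE.
apply: continuous_within; apply: cont_add.
  apply: cont_mul; last exact: cont_const.
  by apply: cont_add; [exact: cont_const|apply: cont_opp; exact: cont_id].
by apply: cont_mul; [exact: cont_id|exact: cont_const].
Qed.

Lemma hom_mix_triangle s x y (z : T) : simplex s -> in_simplex s (bary x) ->
  in_simplex s (bary y) -> in_simplex s (bary z) ->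
  homot (pcat (mix x y) (mix y z)) (mix x z).
Proof.
move=> ss xs ys zs.
have yz : coface y z by exists s.
have xw w : in_simplex s (bary w) -> coface x w by exists s.
have ws t : 0 <= t <= 1 -> in_simplex s (bary (mix y z t)) by exact: mix_in.
pose S (q : R * R) := mix x (mix y z q.2) q.1.
have cS : {within @unit_square R, continuous S}.
  apply: (one_simplex_cont ss) => [q [q1 q2]|a]; first by apply: mix_in => //; exact: ws.
  apply: (@within_cont_eq _ _ _ (fun q : R * R => (1 - q.1) * bary x a +
       q.1 * ((1 - q.2) * bary y a + q.2 * bary z a))).
    by move=> q [q1 q2]; rewrite /S mixE ?mixE //; apply: xw; exact: ws.
  have om (f : R * R -> R) : continuous f -> continuous (fun q => 1 - f q).
    by move=> cf; apply: cont_add; [exact: cont_const|exact: cont_opp].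
  have c1 := @cont_fst R; have c2 := @cont_snd R.
  apply: continuous_within; apply: cont_add.
    by apply: cont_mul; [exact: (om _ c1)|exact: cont_const].
  apply: cont_mul => //; apply: cont_add; apply: cont_mul => //; try exact: cont_const.
  exact: (om _ c2).
have := hom_square cS; rewrite /S /=.
move=> h; apply: hom_trans (_ : homot (pcat (fun=> mix x z 0) (mix x z)) (mix x z)).
  apply: hom_eq h _ _ => t tI; rewrite /pcat.
    by rewrite !mix0 /=; case: ifP => // th; rewrite mix1 //; apply: xw; apply: ws;
       move: tI => /andP[? ?]; apply/andP; split; lra.
  by rewrite !mix0; case: ifP => // _; rewrite mix1.
by apply: hom_const_cat; apply: mix_cpath; exact: xw.
Qed.

(** The bound is uniform in the coordinate b and does not ask x and y to lie in one simplex. *)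
Lemma mix_dist x y a t t' b : coface x (pt a) -> coface y (pt a) ->
  0 <= t <= 1 -> 0 <= t' <= 1 ->
  `|bary (mix x (pt a) t) b - bary (mix y (pt a) t') b| <= `|bary x b - bary y b| + `|t - t'|.
Proof.
move=> hx hy tI tI'; rewrite !mixE // bary_pt.
set p := bary x b; set q := bary y b; set d := (b == a)%:R.
have q0 : 0 <= q by exact: bary_ge0.
have q1 : q <= 1 by exact: bary_le1.
have [d0 d1] : 0 <= d /\ d <= 1 by rewrite /d; case: (b == a); rewrite ?lexx ?ler01.
have -> : (1 - t) * p + t * d - ((1 - t') * q + t' * d) = (1 - t) * (p - q) + (t - t') * (d - q).
  by lra.
apply: le_trans (ler_normD _ _) _; apply: lerD; rewrite normrM.
  rewrite ler_piMl //; move: tI => /andP[? ?].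
  by rewrite ger0_norm; lra.
by rewrite ler_piMr // ler_norml; apply/andP; split; lra.
Qed.

(* Only nearness in the weak topology is available on the first argument, so the
   neighbourhood is taken uniform in t over a compact segment. *)
Lemma mix_star_nbhs x a t (U : set T) : 0 < bary x a -> 0 <= t <= 1 ->
  realization_open U -> U (mix x (pt a) t) ->
  exists2 e : R, 0 < e &
    nbhs x [set y | forall t', 0 <= t' <= 1 -> `|t - t'| < e -> U (mix y (pt a) t')].
Proof.
move=> xa tI oU Ux; have [s ss xs] := baryP x.
have as_ := supp_in xs xa.
have pin y t' : in_simplex s (bary y) -> 0 <= t' <= 1 -> in_simplex s (bary (mix y (pt a) t')).
  by move=> ys tI'; apply: mix_in => //; exact: pt_in.
have [e e0 eU] := oU s _ ss (pin x t xs tI) Ux.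
pose lo := Num.max 0 (t - e / 2); pose hi := Num.min 1 (t + e / 2).
have BI t' : `[lo, hi]%classic t' <-> 0 <= t' <= 1 /\ `|t - t'| <= e / 2.
  rewrite /= in_itv /= /lo /hi ge_max le_min ler_distlC.
  split=> [/andP[/andP[-> ->] /andP[-> ->]]//|].
  by move=> [/andP[-> ->] /andP[-> ->]].
exists (e / 2); first by rewrite divr_gt0.
pose V := [set y : T | 0 < bary y a /\ forall t', `[lo, hi]%classic t' -> U (mix y (pt a) t')].
apply: (@filterS _ (nbhs x) _ V); first by move=> y [_ h] t' tI' tt'; apply: h; apply/BI; split=> //; exact: ltW.
apply: open_nbhsT; last first.
  split=> // t' /BI[tI' tt']; apply: eU; first exact: pin.
  move=> b; have cx := coface_pt xa.
  apply: le_lt_trans (mix_dist _ cx cx tI tI') _.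
  by rewrite subrr normr0 add0r; apply: le_lt_trans tt' _; rewrite ltr_pdivrMr // ltr_pMr // ltr1n.
move=> s' y ss' ys' [ya Uy].
have as' := supp_in ys' ya.
have pin' y' t' : in_simplex s' (bary y') -> 0 <= t' <= 1 -> in_simplex s' (bary (mix y' (pt a) t')).
  by move=> h tI'; apply: mix_in => //; exact: pt_in.
have cof' y' : in_simplex s' (bary y') -> coface y' (pt a).
  by move=> h; exists s' => //; split=> //; exact: pt_in.
have [d d0 hd] : exists2 d : R, 0 < d & forall t', `[lo, hi]%classic t' ->
    forall y', in_simplex s' (bary y') -> (forall b, `|bary y b - bary y' b| < d) ->
    U (mix y' (pt a) t').
  have := @compact_uniform R _ `[lo, hi]%classic (fun d t' => `[lo, hi]%classic t' ->
    forall y', in_simplex s' (bary y') -> (forall b, `|bary y b - bary y' b| < d) ->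
    U (mix y' (pt a) t')) (@segment_compact R lo hi).
  case=> [t1 B1|d d0 hd]; last by exists d => // t' Bt'; exact: hd.
  have [tI1 _] := (BI t1).1 B1.
  have [r r0 hr] := oU s' _ ss' (pin' y t1 ys' tI1) (Uy _ B1).
  exists (r / 2); first by rewrite divr_gt0.
  have rr : 0 < r / 2 by rewrite divr_gt0.
  apply: filterS (nbhsx_ballx t1 _ rr).
  move=> t2 t12 d d0 dr /BI[tI2 _] y' ys2 hy'; apply: hr; first exact: pin'.
  move=> b; apply: le_lt_trans (mix_dist _ (cof' _ ys') (cof' _ ys2) tI1 tI2) _.
  by have := hy' b; move: t12; rewrite /ball /=; lra.
exists (Num.min d (bary y a)); first by rewrite lt_min d0.
move=> y' ys2 hy'; split.
  by have := hy' a; rewrite lt_min => /andP[_]; rewrite ltr_distl => /andP[_]; rewrite -ltrBlDr subrr.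
by move=> t' Bt'; apply: hd => // b; have := hy' b; rewrite lt_min => /andP[].
Qed.

Lemma mix_star_cont (S : topologicalType) (D : set S) (f : S -> T) (tau : S -> R) a :
  {within D, continuous f} -> {within D, continuous tau} ->
  (forall z, D z -> 0 < bary (f z) a /\ 0 <= tau z <= 1) ->
  {within D, continuous (fun z => mix (f z) (pt a) (tau z))}.
Proof.
move=> /(iffLR (within_contP D f)) cf /(iffLR (within_contP D tau)) ct h.
apply: (iffRL (within_contP D _)) => z Dz V /nbhs_open[U oU [Uz UV]].
have [fa tI] := h z Dz.
have [e e0 nU] := mix_star_nbhs fa tI oU Uz.
have h1 := cf z Dz _ nU.
have h2 := ct z Dz _ (nbhsx_ballx (tau z) _ e0).
apply: filterS2 h1 h2 => z' a1 a2 Dz'; apply: UV; apply: (a1 Dz'); first by case: (h z' Dz').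
exact: a2.
Qed.

(** Coning the path towards the vertex a fills a square whose fourth side is constant. *)
Lemma hom_star (f : R -> T) a : cpath f -> (forall r : R, unit_itv r -> 0 < bary (f r) a) ->
  homot (pcat f (mix (f 1) (pt a))) (mix (f 0) (pt a)).
Proof.
move=> cf fa; pose S (q : R * R) := mix (f q.1) (pt a) q.2.
have cS : {within @unit_square R, continuous S}.
  apply: (@mix_star_cont _ _ (f \o fst) snd).
  - apply: within_cont_comp cf; first by apply: continuous_within; exact: cont_fst.
    by move=> q [].
  - by apply: continuous_within; exact: cont_snd.
  - by move=> q [q1 q2]; split=> //; exact: fa.
have f0 := fa _ (@I0 R); have c0 := coface_pt f0.
apply: hom_trans (hom_cat_const (mix_cpath c0)).
apply: hom_eq (hom_square cS) _ _ => s sI; rewrite /S /pcat /=; case: ifP => h //.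
- by rewrite mix0.
- rewrite !mix1 //; apply: coface_pt; apply: fa.
  by move: sI => /andP[? ?]; apply/andP; split; lra.
Qed.

End Points.

Local Close Scope ring_scope.

(** * Edge paths and simple connectivity *)

Section RhLemmas.
Variables (N : Type) (tri : N -> N -> N -> Prop).

Lemma rh_ctx u v p q : rh tri p q -> rh tri (u ++ p ++ v) (u ++ q ++ v).
Proof.
elim=> [{}p|{}p {}q _ IH|{}p {}q r _ IH1 _ IH2|{}p a {}q|{}p a b c {}q t].
- exact: rh_refl.
- exact: rh_sym.
- exact: rh_trans IH1 IH2.
- by rewrite -!catA !cat_cons !catA; apply: rh_dup.
- by rewrite -!catA !cat_cons !catA; apply: rh_elem.
Qed.

Lemma rh_catl u p q : rh tri p q -> rh tri (u ++ p) (u ++ q).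
Proof. by move=> /(rh_ctx u [::]); rewrite !cats0. Qed.

Lemma rh_catr v p q : rh tri p q -> rh tri (p ++ v) (q ++ v).
Proof. exact: (rh_ctx [::] v). Qed.

Lemma rh_cons x p q : rh tri p q -> rh tri (x :: p) (x :: q).
Proof. exact: (rh_catl [:: x]). Qed.

Lemma ladder n (a b : nat -> N) :
  (forall i, i < n -> tri (a i) (a i.+1) (b i.+1) /\ tri (a i) (b i) (b i.+1)) ->
  tri (a n) (b n) (a n) ->
  rh tri (mkseq a n.+1) (a 0 :: mkseq b n.+1 ++ [:: a n]).
Proof.
have mk (f : nat -> N) m : mkseq f m.+1 = f 0 :: mkseq (f \o succn) m.
  by rewrite /mkseq /= -[1]addn0 iotaDl -map_comp.
elim: n a b => [|n IH] a b h ht.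
  apply: rh_sym; apply: rh_trans (rh_elem [::] [::] ht) _; exact: (rh_dup tri [::]).
rewrite mk; apply: rh_trans (rh_cons (a 0) (IH (a \o succn) (b \o succn) _ ht)) _.
  by move=> i lin; apply: h.
have [h1 h2] := h 0 isT.
rewrite (mk b) mk /=; apply: rh_trans (rh_elem [::] _ h1) _.
exact: (rh_sym (rh_elem [::] _ h2)).
Qed.

Lemma rh_map (N' : Type) (tri' : N' -> N' -> N' -> Prop) (f : N -> N') p q :
  (forall a b c, tri a b c -> tri' (f a) (f b) (f c)) ->
  rh tri p q -> rh tri' (map f p) (map f q).
Proof.
move=> h; elim=> [{}p|{}p {}q _ IH|{}p {}q r _ IH1 _ IH2|{}p a {}q|{}p a b c {}q t].
- exact: rh_refl.
- exact: rh_sym.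
- exact: rh_trans IH1 IH2.
- by rewrite !map_cat /=; apply: rh_dup.
- by rewrite !map_cat /=; apply: rh_elem; apply: h.
Qed.

Lemma rh_last_dup p a : rh tri (rcons p a ++ [:: a]) (rcons p a).
Proof. by rewrite -cats1 -catA /=; apply: (rh_dup tri p a [::]). Qed.

End RhLemmas.

Lemma rh_collapse (N : eqType) (tri : N -> N -> N -> Prop) (P : N -> Prop) a l b :
  (forall x y z, P x -> P y -> P z -> tri x y z) ->
  P a -> (forall x, x \in l -> P x) -> P b -> rh tri (a :: rcons l b) [:: a; b].
Proof.
move=> h Pa + Pb; elim: l => [_|c l IH Pl]; first exact: rh_refl.
have Pc : P c by apply: Pl; rewrite mem_head.
have Pl' x : x \in l -> P x by move=> xl; apply: Pl; rewrite inE xl orbT.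
apply: rh_trans (IH Pl'); rewrite /= ; case: l Pl' {IH Pl} => [|d l] Pl /=.
  by apply: (rh_elem [::] [::]); apply: h.
by apply: (rh_elem [::]); apply: h => //; apply: Pl; rewrite mem_head.
Qed.


Local Open Scope ring_scope.

Section NodeWalks.
Variables (R : realType) (X : cell_complex).
Local Notation T := (realization R X).
Implicit Types (a b c : node X) (p q : seq (node X)).

Definition cof a b := exists2 s, simplex s & a \in s /\ b \in s.
Definition ntri a b c := exists2 s, simplex s & [/\ a \in s, b \in s & c \in s].

Fixpoint nwalk a p : Prop := if p is b :: q then cof a b /\ nwalk b q else True.

Fixpoint npath a p : R -> T :=
  if p is b :: q then pcat (mix (pt R a) (pt R b)) (npath b q) else fun=> pt R a.

Lemma cof_coface a b : cof a b -> coface (pt R a) (pt R b).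
Proof. by case=> s ss [sa sb]; exists s => //; split; apply: pt_in. Qed.

Lemma pos_pt a b : 0 < bary (pt R a) b -> b = a.
Proof. by rewrite bary_pt; case: eqP => //; rewrite ltxx. Qed.

Lemma pos_ntri (w : T) a b c : 0 < bary w a -> 0 < bary w b -> 0 < bary w c -> ntri a b c.
Proof.
move=> pa pb pc; have [s ss ws] := baryP w; exists s => //.
by split; exact: supp_in ws _.
Qed.

Lemma npath0 a p : npath a p 0 = pt R a.
Proof. by case: p => //= b q; rewrite pcat0 mix0. Qed.

Lemma npath1 a p : nwalk a p -> npath a p 1 = pt R (last a p).
Proof. by elim: p a => //= b q IH a [_ /IH]; rewrite pcat1. Qed.

Lemma npath_cpath a p : nwalk a p -> cpath (npath a p).
Proof.
elim: p a => [|b q IH] a /=; first by move=> _; exact: cpath_const.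
move=> [ab bq]; have cab := cof_coface ab; apply: cat_cpath; last by rewrite mix1 // npath0.
  exact: mix_cpath.
exact: IH.
Qed.

(** Each edge takes half of the remaining time in [npath], so a grid with [2 ^ size p * m.+1] steps
    contains the times at which the nodes are reached. Between two consecutive nodes every label is
    one of these two. *)
Lemma npath_subdivision m a p (x : nat -> node X) (M := (2 ^ size p * m.+1)%N) : nwalk a p ->
  (forall i, (i <= M)%N -> 0 < bary (npath a p (i%:R / M%:R)) (x i)) ->
  rh ntri (mkseq x M.+1) (a :: p).
Proof.
elim: p a x @M => [|b q IH] a x.
  move=> M _ h; have xa i : (i <= M)%N -> x i = a by move=> /h /pos_pt.
  have -> : mkseq x M.+1 = a :: rcons (nseq m a) a.
    have M1 : M = m.+1 by rewrite /M expn0 mul1n.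
    apply: (@eq_from_nth _ a); first by rewrite size_mkseq /= size_rcons size_nseq M1.
    move=> i; rewrite size_mkseq => lti; rewrite nth_mkseq // xa //.
    by rewrite -cats1 -[RHS]/(nth a (nseq m.+1 a ++ nseq 1 a) i) -nseqD nth_nseq; case: ifP.
  apply: rh_trans (@rh_collapse _ ntri (eq a) a _ a _ _ _ _) _ => //.
  - move=> _ _ _ <- <- <-; have [s ss sa] := has_simplex a; by exists s.
  - by move=> y; rewrite mem_nseq => /andP[_ /eqP].
  - exact: (rh_dup ntri [::] a [::]).
move=> M [ab bq] h.
pose k := (2 ^ size q * m.+1)%N.
have Mk : M = (k + k)%N by rewrite /M /k /= expnS -mulnA mul2n -addnn.
have k0 : (0 < k)%N by rewrite muln_gt0 expn_gt0.
have kR : 0 < k%:R :> R by rewrite ltr0n.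
have MR : M%:R = 2 * k%:R :> R by rewrite Mk natrD; lra.
have cab := cof_coface ab.
have low i : (i <= k)%N -> npath a (b :: q) (i%:R / M%:R) = mix (pt R a) (pt R b) (i%:R / k%:R).
  move=> ik; rewrite /= /pcat MR.
  have e : 2 * (i%:R / (2 * k%:R)) = i%:R / k%:R :> R by field; apply: lt0r_neq0.
  rewrite e ifT // -(ler_pM2l (_ : 0 < 2)) // e mulfV // ler_pdivrMr // mul1r ler_nat //.
have xab i : (i <= k)%N -> x i = a \/ x i = b.
  move=> ik; have := h i (leq_trans ik _); rewrite low // Mk leq_addr => /(_ isT).
  have tI : 0 <= (i%:R / k%:R : R) <= 1.
    by rewrite divr_ge0 //= ler_pdivrMr // mul1r ler_nat.
  rewrite mixE // !bary_pt; case: (eqVneq (x i) a) => [|_]; first by left.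
  case: (eqVneq (x i) b) => [|_]; first by right.
  by rewrite !mulr0 addr0 ltxx.
have x0 : x 0%N = a by apply: pos_pt; have := h 0%N isT; rewrite mul0r npath0.
have xk : x k = b.
  apply: pos_pt; have := h k; rewrite low // Mk leq_addr => /(_ isT).
  by rewrite divff ?mix1 //; apply: lt0r_neq0.
have hi : rh ntri (mkseq (fun i => x (k + i)%N) k.+1) (b :: q).
  apply: IH => // i; rewrite -/k => ik.
  case: i ik => [|i] ik; first by rewrite addn0 mul0r npath0 xk bary_pt eqxx ltr01.
  have := h (k + i.+1)%N; rewrite Mk leq_add2l => /(_ ik); rewrite -Mk /= /pcat MR natrD.
  have e : 2 * ((k%:R + i.+1%:R) / (2 * k%:R)) - 1 = i.+1%:R / k%:R :> R.
    by field; apply: lt0r_neq0.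
  rewrite e ifF //; apply/negbTE; rewrite half_le e -ltNge.
  by rewrite divr_gt0 // ltr0n.
have -> : mkseq x M.+1 = mkseq x k ++ mkseq (fun i => x (k + i)%N) k.+1.
  by rewrite Mk -addnS /mkseq iotaD map_cat add0n -{2}[k]addn0 iotaDl -map_comp.
apply: rh_trans (rh_catl _ hi) _.
case: k k0 {hi low kR MR Mk} xab xk => // k _ xab xk.
have -> : mkseq x k.+1 = a :: mkseq (x \o succn) k.
  by rewrite /mkseq /= -{1}[1%N]addn0 iotaDl -map_comp x0.
rewrite -cat_rcons rcons_cons.
apply: (@rh_catr _ ntri q _ [:: a; b]).
apply: (@rh_collapse _ ntri (fun y => y = a \/ y = b)); [|by left| |by right].
  have [s ss [sa sb]] := ab.
  by move=> y z w [] -> [] -> [] ->; exists s.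
by move=> y /mapP[i]; rewrite mem_iota add0n => /andP[_ ik] ->; apply: xab; exact: ltnW.
Qed.

Lemma grid_step (M i i' : nat) (e : R) : M%:R^-1 < e -> (i <= i'.+1)%N -> (i' <= i.+1)%N ->
  `|i%:R / M%:R - i'%:R / M%:R| < e.
Proof.
move=> Me h1 h2; apply: le_lt_trans Me; rewrite -mulrBl normrM [`|M%:R^-1|]ger0_norm ?invr_ge0 //.
rewrite -[leRHS]mul1r ler_wpM2r ?invr_ge0 //.
move: h1 h2; rewrite -(ler_nat R) -[(i' <= _)%N](ler_nat R) -!natr1 => h1 h2.
by rewrite ler_norml; apply/andP; split; lra.
Qed.

(* The closed rows of a fine grid are successively homotopic by ladders; the bottom
   row lies in one simplex, and the top row is a subdivision of a :: p. *)
Lemma null_loop_rh a p : nwalk a p -> last a p = a -> null_loop (npath a p) ->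
  rh ntri (a :: p) [:: a].
Proof.
move=> ap la [F [cF F1 F0 Fp]].
have [|e e0 he] := @lebesgue_number R (node X) (fun b z => 0 < bary (F z) b).
  move=> z zs; have [b hb] := supp_ex (F z); exists b.
  have := iffLR (within_contP _ F) cF z zs _ (open_nbhsT (@star_open R X b) hb).
  exact.
have [|A hA] := @choice (R * R) (node X) (fun z b => unit_square z -> forall z', unit_square z' ->
    `|z.1 - z'.1| < e -> `|z.2 - z'.2| < e -> 0 < bary (F z') b).
  move=> z; case: (pselect (unit_square z)) => zs; last by exists a.
  by have [b hb] := he z zs; exists b => _.
have [m hm] : exists m : nat, m.+1%:R^-1 < e.
  by have [n _ /(_ n (leqnn n))] := near_infty_natSinv_lt (PosNum e0); exists n.
have [M ME] : exists M : nat, M = (2 ^ size p * m.+1)%N by exists (2 ^ size p * m.+1)%N.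
have mM : (m.+1 <= M)%N by rewrite ME -{1}[m.+1]mul1n leq_mul2r expn_gt0 orbT.
have M0 : 0 < M%:R :> R by rewrite ltr0n; apply: leq_trans mM.
have Me : M%:R^-1 < e.
  by apply: le_lt_trans hm; rewrite lef_pV2 ?posrE ?ltr0Sn // ler_nat.
pose z i j : R * R := (i%:R / M%:R, j%:R / M%:R).
have fI i : (i <= M)%N -> 0 <= (i%:R / M%:R : R) <= 1.
  move=> iM; rewrite divr_ge0 //=; rewrite ler_pdivrMr // mul1r.
  by rewrite ler_nat.
have zI i j : (i <= M)%N -> (j <= M)%N -> unit_square (z i j) by split; exact: fI.
have MM : M%:R / M%:R = 1 :> R by rewrite divff // lt0r_neq0.
have pos i j i' j' : (i <= M)%N -> (j <= M)%N -> (i' <= M)%N -> (j' <= M)%N ->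
    (i <= i'.+1)%N -> (i' <= i.+1)%N -> (j <= j'.+1)%N -> (j' <= j.+1)%N ->
    0 < bary (F (z i' j')) (A (z i j)).
  by move=> *; apply: hA; [exact: zI|exact: zI|exact: grid_step|exact: grid_step].
(* Column M + 1 repeats column 0. As F agrees on the two vertical sides, the rows become closed
   walks of labels. *)
pose c j i := A (z (if (i <= M)%N then i else 0%N) j).
have c0 j : c j 0%N = A (z 0%N j) by [].
have cM j : c j M.+1 = c j 0%N by rewrite /c ltnn.
have per j : (j <= M)%N -> F (z M j) = F (z 0%N j).
  by move=> jM; rewrite /z MM mul0r Fp //; exact: fI.
have cpos i j i' j' : (i <= M)%N -> (j <= M)%N -> (j' <= M)%N -> (j <= j'.+1)%N -> (j' <= j.+1)%N ->
    i' = i \/ i' = i.+1 -> 0 < bary (F (z i j)) (c j' i').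
  move=> iM jM jM' h1 h2 hi; rewrite /c; case: (leqP i' M) => h3.
    by case: hi h3 => -> h3; apply: pos; clear -iM jM jM' h1 h2 h3; lia.
  have -> : i = M by clear -iM hi h3; lia.
  by rewrite per //; apply: pos; clear -iM jM jM' h1 h2 h3; lia.
have row j : (j <= M)%N -> rh ntri (mkseq (c j) M.+2) [:: c j 0%N].
  elim: j => [|j IH] jM.
    have -> : mkseq (c 0%N) M.+2 = c 0%N 0%N :: rcons (mkseq (c 0%N \o succn) M) (c 0%N 0%N).
      by rewrite mkseqS cM /mkseq /= -[1%N]addn0 iotaDl -map_comp.
    pose P b := 0 < bary (F (0, 0)) b.
    have Pc i : (i <= M)%N -> P (c 0%N i).
      move=> iM; rewrite /P -(F0 (i%:R / M%:R)) ?fI //.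
      by have := cpos i 0%N i 0%N iM isT isT isT isT (or_introl erefl); rewrite /z mul0r.
    apply: rh_trans (@rh_collapse _ ntri P _ _ _ _ _ _ _) (rh_dup ntri [::] _ [::]) => //.
    - by move=> x y w; exact: pos_ntri.
    - exact: Pc.
    - by move=> x /mapP[i]; rewrite mem_iota add0n => /andP[_ iM] ->; exact: Pc.
    - exact: Pc.
  have jM' := ltnW jM.
  have cp i j' i' : (i <= M)%N -> j' = j \/ j' = j.+1 -> i' = i \/ i' = i.+1 ->
      0 < bary (F (z i j)) (c j' i').
    move=> iM hj hi; apply: cpos => //; case: hj => -> //; exact: ltnW.
  have lad := @ladder _ ntri M.+1 (c j.+1) (c j).
  apply: rh_trans (lad _ _) _.
  - move=> i; rewrite ltnS => iM; split; apply: (@pos_ntri (F (z i j))); apply: cp => //; tauto.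
  - by rewrite !cM; apply: (@pos_ntri (F (z 0%N j))); apply: cp => //; tauto.
  rewrite cM; apply: rh_trans (rh_ctx [:: c j.+1 0%N] [:: c j.+1 0%N] (IH jM')) _ => /=.
  apply: rh_trans (rh_elem [::] [::] _) (rh_dup ntri [::] _ [::]).
  by apply: (@pos_ntri (F (z 0%N j))); apply: cp => //; tauto.
have top i : (i <= M)%N -> F (z i M) = npath a p (i%:R / M%:R).
  by move=> iM; rewrite /z MM F1 //; exact: fI.
have cMa : c M 0%N = a.
  apply: pos_pt; have := top 0%N isT; rewrite mul0r npath0 => <-.
  by apply: cpos => //; left.
have sub := @npath_subdivision m a p (c M) ap; rewrite -ME in sub.
have {}sub : rh ntri (mkseq (c M) M.+1) (a :: p).
  by apply: sub => i iM; rewrite -top //; apply: cpos => //; left.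
have := row M (leqnn M); rewrite mkseqS cM cMa -cats1 => h.
apply: rh_trans h; apply: rh_trans (rh_catr [:: a] (rh_sym sub)).
rewrite [a :: p]lastI la; exact: rh_sym (rh_last_dup _ _ _).
Qed.

End NodeWalks.

Local Close Scope ring_scope.

Section SkeletonFromTopology.
Variables (R : realType) (X : cell_complex).
Hypothesis face2 : forall (f : face X) u v, incident f u -> incident f v ->
  [\/ u = v, adj u v | exists w, adj u w /\ adj w v].
Local Notation T := (realization R X).

(** A barycentre has to be sent to a vertex; by [face2] any vertex of its cell is close enough to
    the others. *)
Let corner (f : face X) : {u | incident f u}.
Proof.
apply: cid; have [u [v uv]] := side_corner f; exists u; by exists v.
Qed.

Definition node_vertex (a : node X) : skeleton X :=
  match a with inl u => u | inr f => sval (corner f) end.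

Lemma cof_vertex a b : cof a b -> [\/ node_vertex a = node_vertex b,
  adj (node_vertex a) (node_vertex b)
  | exists w, adj (node_vertex a) w /\ adj w (node_vertex b)].
Proof.
have fc (f : face X) : incident f (node_vertex (inr f)) by exact: svalP (corner f).
case=> s [u|u v uv|f u v uv] [].
- by rewrite !inE => /eqP-> /eqP->; constructor 1.
- rewrite !inE => /orP[] /eqP-> /orP[] /eqP-> /=; (try by constructor 1); constructor 2 => //.
  by rewrite adj_sym.
- have fu : incident f u by exists v.
  have fv : incident f v by exists u; exact: side_sym.
  have key c : c \in [:: inr f; inl u; inl v] -> incident f (node_vertex c).
    by rewrite !inE => /or3P[] /eqP-> //; exact: fc.
  by move=> /key ha /key hb; exact: face2 ha hb.
Qed.

Lemma cof_dist a b : cof a b -> gdist (node_vertex a) (node_vertex b) <= 2.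
Proof.
case/cof_vertex => [->|h|[w [h1 h2]]]; first by rewrite gdistxx.
  have w1 : has_walk (node_vertex a) (node_vertex b) 1 by exists [:: node_vertex b]; rewrite /= ?h.
  exact: leq_trans (gdist_le w1) _.
by apply: gdist_le; exists [:: w; node_vertex b]; rewrite /= ?h1 ?h2.
Qed.

Lemma simply_connected_near_sc : simply_connected R X -> near_sc (skeleton X).
Proof.
move=> sc u p up pu.
have nw : forall v q, path adj v q -> @nwalk X (inl v) (map inl q).
  move=> v q; elim: q v => //= w q IH v /andP[vw /IH]; split=> //.
  by exists [:: inl v; inl w]; [exact: SEdge|rewrite !inE !eqxx orbT].
have la : last (inl u : node X) (map inl p) = inl u by rewrite last_map pu.
have nw1 := nw _ _ up.
have := @simply_connected_loops R _ sc (@npath R X (inl u) (map inl p)).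
rewrite npath0 npath1 // la => /(_ (@npath_cpath R _ _ _ nw1) erefl) /(null_loop_rh nw1 la).
move=> /(@rh_map _ _ _ (@near_tri (skeleton X)) node_vertex) h.
have {h} := h _; rewrite /= -map_comp map_id; apply => a b c [s ss [sa sb sc']].
by split; apply: cof_dist; exists s.
Qed.

(** Labels of consecutive points of a finely subdivided path lie in a common simplex, so their
    vertices are joined by at most two edges. The path is spread over the square to reuse
    [lebesgue_number]. *)
Lemma path_connected_skeleton : path_connected_space R T -> connected_graph (skeleton X).
Proof.
move=> [[x0 _] pc]; split.
  have [s ss _] := baryP x0; case: s / ss => [u|u v _|f u v _]; by exists u.
move=> u v; have [f [cf f0 f1]] := pc (pt R (inl u)) (pt R (inl v)).
move: cf; rewrite unit_itvE => cf.
have cF : {within @unit_square R, continuous (f \o fst)}.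
  by apply: within_cont_comp cf; [apply: continuous_within; exact: cont_fst|move=> ? []].
have [|e e0 he] := @lebesgue_number R (node X) (fun b z => (0 < bary (f z.1) b)%R).
  move=> z zs; have [b hb] := supp_ex (f z.1); exists b.
  exact: (iffLR (within_contP _ (f \o fst)) cF z zs _ (open_nbhsT (@star_open R X b) hb)).
have [m hm] : exists m : nat, (m.+1%:R^-1 < e)%R.
  by have [n _ /(_ n (leqnn n))] := near_infty_natSinv_lt (PosNum e0); exists n.
pose M := m.+1; pose z i : R * R := (i%:R / M%:R, 0)%R.
have zI i : i <= M -> unit_square (z i).
  move=> iM; split=> /=; last by rewrite lexx ler01.
  by rewrite divr_ge0 //= ler_pdivrMr ?ltr0n // mul1r ler_nat.
have walk i : i <= M -> forall b, (0 < bary (f (z i).1) b)%R -> exists n, has_walk u (node_vertex b) n.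
  elim: i => [|i IH] iM b; first by rewrite /= mul0r f0 => /pos_pt ->; exists 0, [::].
  have [a ha] := he _ (zI _ (ltnW iM)).
  have ai : (0 < bary (f (z i).1) a)%R by apply: ha; rewrite ?subrr ?normr0 //; exact/zI/ltnW.
  have ai1 : (0 < bary (f (z i.+1).1) a)%R.
    apply: ha; first exact: zI.
      by apply: grid_step => //; rewrite leqW.
    by rewrite subrr normr0.
  move=> bi1; have [n [p [p1 p2 p3]]] := IH (ltnW iM) a ai.
  have : cof a b by have [s ss [? ? _]] := pos_ntri ai1 bi1 bi1; exists s.
  case/cof_vertex => [<-|h|[w [h1 h2]]]; first by exists n, p.
    by exists n.+1, (rcons p (node_vertex b)); rewrite rcons_path p1 p2 h last_rcons size_rcons p3.
  exists n.+2, (rcons (rcons p w) (node_vertex b)).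
  by rewrite !rcons_path p1 p2 h1 !last_rcons h2 !size_rcons p3.
apply: (walk M (leqnn M) (inl v)).
by rewrite /= divff ?f1 ?bary_pt ?eqxx ?ltr01 // pnatr_eq0.
Qed.

End SkeletonFromTopology.

Local Open Scope ring_scope.

(** * From contractible node walks to simple connectivity *)

Section Realize.
Variables (R : realType) (X : cell_complex).
Local Notation T := (realization R X).
Implicit Types (a b c : node X) (p q : seq (node X)).
Local Notation npath := (@npath R X).
Local Notation pt := (@pt R X).

(** A derivation in [rh] ranges over arbitrary lists, so the property of being a walk and the end
    point are carried along with the homotopy. *)
Definition same_path p q : Prop := match p, q with
  | [::], [::] => True
  | a :: p', b :: q' => [/\ a = b, last a p' = last b q', nwalk a p' <-> nwalk b q'
      & nwalk a p' -> homot (npath a p') (npath b q')]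
  | _, _ => False end.

Lemma same_path_refl p : same_path p p.
Proof. by case: p => //= a p; split=> // /(@npath_cpath R _ _ _); exact: hom_refl. Qed.

Lemma same_path_cons x a b p q : same_path (a :: p) (b :: q) -> same_path [:: x, a & p] [:: x, b & q].
Proof.
move=> [<- e1 e2 e3]; split=> //=; first by rewrite e2.
move=> [xa ap]; apply: hom_cat (e3 ap) _; last by rewrite mix1 ?npath0 //; exact: cof_coface.
by apply: hom_refl; apply: mix_cpath; exact: cof_coface.
Qed.

Lemma same_path_catl u a b p q : same_path (a :: p) (b :: q) ->
  same_path (u ++ a :: p) (u ++ b :: q).
Proof.
move=> h; elim: u => [//|x u IH] /=.
by case: u IH => [|y u] IH; exact: same_path_cons.
Qed.

Lemma rh_same_path p q : rh (@ntri X) p q -> same_path p q.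
Proof.
elim=> [{}p|{}p {}q _|{}p {}q r _ IH1 _|{}p a {}q|{}p a b c {}q [s ss [sa sb sc]]].
- exact: same_path_refl.
- case: p q => [|a p] [|b q] //= [-> e1 e2 e3]; split=> //; first by tauto.
  by move=> h; apply: hom_sym; apply: e3; tauto.
- case: p q r IH1 => [|a p] [|b q] [|c r] //= [ab e1 e2 e3] [bc f1 f2 f3]; subst b c; split.
  + by [].
  + by rewrite e1.
  + by tauto.
  + by move=> h; apply: hom_trans (e3 h) (f3 _); tauto.
- apply: same_path_catl; split=> //=.
    split=> [[]//|h]; split=> //; have [s ss sa] := has_simplex a; by exists s.
  move=> [_ aq]; have := hom_const_cat (@npath_cpath R _ _ _ aq); rewrite npath0.
  move=> h; apply: hom_eq h _ _ => // s _; rewrite /pcat; case: ifP => // _.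
  by rewrite mixxx.
- apply: same_path_catl.
  have ab : cof a b by exists s.
  have bc : cof b c by exists s.
  have ac : cof a c by exists s.
  split=> //=; first by tauto.
  move=> [_ [_ cq]]; have cw := @npath_cpath R _ _ _ cq.
  have cc x y : cof x y -> cpath (mix (pt x) (pt y)) by move=> h; apply: mix_cpath; exact: cof_coface.
  have e1 x y : cof x y -> mix (pt x) (pt y) 1 = pt y by move=> h; rewrite mix1 //; exact: cof_coface.
  apply: hom_trans (hom_sym (hom_catA (cc _ _ ab) (cc _ _ bc) cw _ _)) _.
  + by rewrite e1 // mix0.
  + by rewrite e1 // npath0.
  apply: hom_cat (hom_refl cw) _; last by rewrite pcat1 e1 // npath0.
  by apply: (hom_mix_triangle ss); exact: pt_in.
Qed.

(* One step of the homotopy from h g ... to the edge path through a and b: h stays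
   in the star of a and ends in the star of b. *)
Lemma hom_star_step (h g w cc : R -> T) a b : cpath h -> cpath g -> cpath w -> cpath cc ->
  (forall r : R, unit_itv r -> 0 < bary (h r) a) -> 0 < bary (h 1) b ->
  h 1 = g 0 -> g 1 = cc 0 -> w 0 = pt b ->
  homot (pcat g cc) (pcat (mix (g 0) (pt b)) w) ->
  homot (pcat (pcat h g) cc) (pcat (mix (h 0) (pt a)) (pcat (mix (pt a) (pt b)) w)).
Proof.
move=> ch cg cw ccc ha hb hg gc wb H; rewrite -hg in H.
have h1a := ha _ (I1 R).
have [s ss ys] := baryP (h 1); have sa := supp_in ys h1a; have sb := supp_in ys hb.
have coa := coface_pt h1a; have cob := coface_pt hb.
have coab : coface (pt a) (pt b) by exists s => //; split; exact: pt_in.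
have cd := mix_cpath coa; have ce := mix_cpath coab; have cf := mix_cpath cob.
have d1 := mix1 coa; have e1 := mix1 coab; have f1 := mix1 cob.
have tri : homot (pcat (mix (h 1) (pt a)) (mix (pt a) (pt b))) (mix (h 1) (pt b)).
  by apply: (hom_mix_triangle ss) => //; exact: pt_in.
have cew : cpath (pcat (mix (pt a) (pt b)) w) by apply: cat_cpath; rewrite ?e1.
apply: hom_trans (hom_catA ch cg ccc hg gc) _.
apply: hom_trans (hom_cat (hom_refl ch) H _) _; first by rewrite pcat0.
apply: hom_trans (hom_cat (hom_refl ch) (hom_cat (hom_sym tri) (hom_refl cw) _) _) _.
- by rewrite f1.
- by rewrite pcat0 mix0.
apply: hom_trans (hom_cat (hom_refl ch) (hom_catA cd ce cw _ _) _) _.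
- by rewrite d1 mix0.
- by rewrite e1.
- by rewrite !pcat0 mix0.
apply: hom_trans (hom_sym (hom_catA ch cd cew _ _)) _.
- by rewrite mix0.
- by rewrite d1 pcat0 mix0.
apply: hom_cat (hom_star ch ha) (hom_refl cew) _.
by rewrite pcat1 d1 pcat0 mix0.
Qed.

(** Downward induction over the tails g of the loop: a piece h inside one star is cut off and traded
    for an edge of the node walk by [hom_star_step]. *)
Lemma hom_loop_node_walk (l : R -> T) : cpath l -> l 0 = l 1 ->
  exists a p, [/\ nwalk a p, last a p = a, 0 < bary (l 1) a
    & homot (pcat l (mix (l 1) (pt a))) (pcat (mix (l 1) (pt a)) (npath a p))].
Proof.
move=> cl l01.
have [|e e0 he] := @lebesgue_number R (node X) (fun b z => 0 < bary (l z.1) b).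
  move=> z zs; have [b hb] := supp_ex (l z.1); exists b.
  have cF : {within @unit_square R, continuous (l \o fst)}.
    by apply: within_cont_comp cl; [apply: continuous_within; exact: cont_fst|move=> ? []].
  have := iffLR (within_contP _ (l \o fst)) cF z zs _ (open_nbhsT (@star_open R X b) hb).
  exact.
have [m hm] : exists m : nat, m.+1%:R^-1 < e.
  by have [n _ /(_ n (leqnn n))] := near_infty_natSinv_lt (PosNum e0); exists n.
have [M ME] : exists M : nat, M = m.+1 by exists m.+1.
rewrite -ME in hm; have M0 : 0 < M%:R :> R by rewrite ME ltr0Sn.
have MM : M%:R / M%:R = 1 :> R by rewrite divff // lt0r_neq0.
have fI (x : R) : 0 <= x -> x <= M%:R -> unit_itv (x / M%:R).
  by move=> x0 xM; apply/andP; rewrite divr_ge0 ?(ltW M0) //= ler_pdivrMr // mul1r.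
have [|A0 hA0] := @choice nat (node X) (fun i b => (i < M)%N -> forall x : R,
    i%:R <= x -> x <= i.+1%:R -> 0 < bary (l (x / M%:R)) b).
  move=> i; case: (pselect (i < M)%N) => iM; last by have [b _] := supp_ex (l 1); exists b.
  have iMR : i.+1%:R <= M%:R :> R by rewrite ler_nat.
  have i0 : 0 <= i%:R :> R by rewrite ler0n.
  have zs : unit_square (i%:R / M%:R, 0 : R).
    split; last by rewrite /= lexx ler01.
    by apply: fI => //; apply: le_trans iMR; rewrite ler_nat.
  have [b hb] := he _ zs; exists b => _ x x1 x2.
  apply: (hb (x / M%:R, 0)) => /=; last by rewrite subrr normr0.
    by split; [apply: fI; [lra|exact: le_trans x2 iMR]|exact: I0].
  rewrite -mulrBl normrM [`|M%:R^-1|]ger0_norm ?invr_ge0 ?(ltW M0) //.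
  apply: le_lt_trans hm; rewrite -[leRHS]mul1r ler_wpM2r ?invr_ge0 ?(ltW M0) //.
  by move: x2; rewrite -natr1 ler_norml => x2; apply/andP; split; lra.
(* The label at M is the one at 0, which closes the node walk. *)
pose A i := if (i < M)%N then A0 i else A0 0%N.
have M1 : (0 < M)%N by rewrite ME.
have A00 : A 0%N = A0 0%N by rewrite /A M1.
have AM : A M = A 0%N by rewrite A00 /A ltnn.
have posA i : (i <= M)%N -> 0 < bary (l (i%:R / M%:R)) (A i).
  rewrite leq_eqVlt => /orP[/eqP->|iM].
    by have := hA0 0%N M1 0 (lexx _) ler01; rewrite mul0r AM A00 MM -l01.
  by rewrite /A iM; apply: hA0 => //; rewrite ler_nat.
pose cc := mix (l 1) (pt (A 0%N)).
have pos1 : 0 < bary (l 1) (A 0%N) by have := posA M (leqnn M); rewrite MM AM.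
have ccc : cpath cc by apply: mix_cpath; exact: coface_pt.
pose g i s := l ((i%:R + s * (M%:R - i%:R)) / M%:R).
pose h i s := l ((i%:R + s) / M%:R).
have affine (x y : R) : continuous (fun s : R => (x + s * y) / M%:R).
  apply: cont_mul; last exact: cont_const.
  apply: cont_add; first exact: cont_const.
  by apply: cont_mul; [exact: cont_id|exact: cont_const].
have gI i (s : R) : (i <= M)%N -> unit_itv s -> unit_itv ((i%:R + s * (M%:R - i%:R)) / M%:R).
  rewrite -(ler_nat R) => iM /andP[s0 s1]; have i0 : 0 <= i%:R :> R by rewrite ler0n.
  by apply: fI; nra.
have cg i : (i <= M)%N -> cpath (g i).
  move=> iM; apply: within_cont_comp cl; first by apply: continuous_within; exact: affine.
  by move=> s; exact: gI.
have hI i (s : R) : (i < M)%N -> unit_itv s -> unit_itv ((i%:R + s) / M%:R).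
  rewrite -(ler_nat R) -natr1 => iM /andP[s0 s1]; have i0 : 0 <= i%:R :> R by rewrite ler0n.
  by apply: fI; lra.
have ch i : (i < M)%N -> cpath (h i).
  move=> iM; apply: within_cont_comp cl; last by move=> s; exact: hI.
  apply: continuous_within; have := affine i%:R 1.
  by under eq_fun do rewrite mulr1.
have g0 i : g i 0 = l (i%:R / M%:R) by rewrite /g mul0r addr0.
have g1 i : g i 1 = l 1 by rewrite /g mul1r addrC subrK MM.
have h0 i : h i 0 = l (i%:R / M%:R) by rewrite /h addr0.
have h1 i : h i 1 = g i.+1 0 by rewrite /h g0 natr1.
have split_g i : (i < M)%N -> homot (g i) (pcat (h i) (g i.+1)).
  move=> iM; pose psi (s : R) : R := (i%:R + (Num.min 1 (2 * s) + Num.max 0 (2 * s - 1) * (M%:R - i.+1%:R))) / M%:R.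
  have c2 := half_affine (@cont_id R).
  have cpsi : continuous psi.
    apply: cont_mul; last exact: cont_const.
    apply: cont_add; first exact: cont_const.
    apply: cont_add; first by apply: cont_min; [exact: cont_const|exact: c2.1].
    by apply: cont_mul; [apply: cont_max; [exact: cont_const|exact: c2.2]|exact: cont_const].
  have lowP (s : R) : s <= 2^-1 -> psi s = (i%:R + 2 * s) / M%:R.
    by move=> hs; rewrite /psi min_r ?max_l ?mul0r ?addr0 //; lra.
  have highP (s : R) : 2^-1 <= s -> psi s = (i.+1%:R + (2 * s - 1) * (M%:R - i.+1%:R)) / M%:R.
    by move=> hs; rewrite /psi min_l ?max_r ?addrA ?natr1 //; lra.
  apply: hom_eq (@hom_path_sub _ _ l _ psi cl (affine i%:R (M%:R - i%:R)) cpsi _ _ _ _) _ _.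
  - by move=> s; apply: gI; exact: ltnW.
  - move=> s /andP[s0 s1]; case: (lerP s 2^-1) => hs.
      by rewrite lowP //; apply: hI => //; apply/andP; split; lra.
    rewrite highP ?ltW //; apply: gI => //; apply/andP; split; lra.
  - by rewrite lowP ?mulr0 ?mul0r //; lra.
  - by rewrite highP; [congr (_ / _); lra|lra].
  - by [].
  - move=> s _; rewrite /pcat /=; case: ifP => hs; first by rewrite lowP.
    by rewrite highP //; lra.
pose W i := [seq A j | j <- iota i.+1 (M - i)].
have main k i : (i + k)%N = M -> nwalk (A i) (W i) /\
    homot (pcat (g i) cc) (pcat (mix (g i 0) (pt (A i))) (npath (A i) (W i))).
  elim: k i => [|k IH] i ik.
    have {ik}-> : i = M by rewrite -ik addn0.
    rewrite /W subnn /= AM; split=> //; have gM s : g M s = l 1 by rewrite /g subrr mulr0 addr0 MM.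
    have -> : pcat (g M) cc = pcat (fun=> cc 0) cc.
      by apply/funext => s; rewrite /pcat; case: ifP => // _; rewrite gM /cc mix0.
    apply: hom_trans (hom_const_cat ccc) _.
    have := hom_sym (hom_cat_const ccc).
    by rewrite /cc gM mix1 //; exact: coface_pt.
  have iM : (i < M)%N by rewrite -ik; lia.
  have [nw H] := IH i.+1 (ltac:(by rewrite -ik addSnnS)).
  have iWE : W i = A i.+1 :: W i.+1 by rewrite /W -[(M - i)%N]prednK ?subn_gt0 // -subnS.
  have ha (r : R) : unit_itv r -> 0 < bary (h i r) (A i).
    move=> /andP[r0 r1]; rewrite /h /A iM; apply: hA0 => //; rewrite -?natr1; lra.
  have hb : 0 < bary (h i 1) (A i.+1) by rewrite h1 g0; exact: posA.
  have co : cof (A i) (A i.+1).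
    by have [s ss [? ? _]] := pos_ntri (ha _ (I1 R)) hb hb; exists s.
  rewrite iWE; split=> //=.
  apply: hom_trans (hom_cat (split_g i iM) (hom_refl ccc) _) _; first by rewrite g1 /cc mix0.
  have -> : g i 0 = h i 0 by rewrite g0 h0.
  apply: hom_star_step => //.
  - exact: ch.
  - exact: cg.
  - exact: npath_cpath.
  - by rewrite g1 /cc mix0.
  - by rewrite npath0.
have [nw H] := main M 0%N (add0n _).
have gE : g 0%N = l.
  by apply/funext => s; rewrite /g subr0 add0r -mulrA MM mulr1.
rewrite gE l01 in H.
exists (A 0%N), (W 0%N); split=> //.
by rewrite /W subn0 last_map -nth_last size_iota nth_iota ?prednK // add1n prednK.
Qed.

Lemma null_walks_simply_connected : connected_graph (skeleton X) ->
  (forall a p, nwalk a p -> last a p = a -> rh (@ntri X) (a :: p) [:: a]) ->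
  simply_connected R X.
Proof.
move=> [[u0 _] hc] nw; apply: loops_simply_connected.
  have vx (x : T) : exists u, coface x (pt (inl u)).
    have [s ss xs] := baryP x.
    have [u us] : exists u, inl u \in s.
      by case: ss {xs} => [u|u v _|f u v _]; exists u; rewrite !inE ?eqxx ?orbT.
    by exists u, s => //; split=> //; exact: pt_in.
  split; first by exists (pt (inl u0)).
  move=> x y; have [u xu] := vx x; have [v yv] := vx y.
  have [n [p [up pv _]]] := hc u v.
  have walk : forall (v' : skeleton X) (w : seq (skeleton X)), path adj v' w ->
      @nwalk X (inl v') (map inl w).
    move=> v' q; elim: q v' => //= w q IH v' /andP[vw /IH]; split=> //.
    by exists [:: inl v'; inl w]; [exact: SEdge|rewrite !inE !eqxx orbT].
  have w1 := walk _ _ up.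
  pose f3 (s : R) := mix y (pt (inl v)) (1 - s).
  have c3 : cpath f3.
    apply: (@within_cont_comp _ _ _ _ (@unit_itv R)) (mix_cpath yv).
      apply: continuous_within; apply: cont_add; first exact: cont_const.
      by apply: cont_opp; exact: cont_id.
    by move=> s /andP[? ?]; apply/andP; split; lra.
  have e : npath (inl u) (map inl p) 1 = f3 0 by rewrite npath1 // last_map pv /f3 subr0 mix1.
  exists (pcat (mix x (pt (inl u))) (pcat (npath (inl u) (map inl p)) f3)).
  rewrite unit_itvE; split; last by rewrite !pcat1 /f3 subrr mix0.
    apply: cat_cpath; first exact: mix_cpath.
      by apply: cat_cpath => //; exact: npath_cpath.
    by rewrite mix1 // pcat0 npath0.
  by rewrite pcat0 mix0.
move=> l cl l01; have [a [p [ap la pa H]]] := hom_loop_node_walk cl l01.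
have [_ _ _ /(_ ap) N] := rh_same_path (nw a p ap la).
have co := coface_pt pa; have cc := mix_cpath co.
have ca := @cpath_const R T (pt a).
have cl1 := @cpath_const R T (l 1).
set c := mix (l 1) (pt a) in H cc.
have c0 : c 0 = l 1 by rewrite /c mix0.
have c1 : c 1 = pt a by rewrite /c mix1.
pose r (s : R) := c (1 - s).
have cr : cpath r.
  apply: (@within_cont_comp _ _ _ _ (@unit_itv R)) cc.
    apply: continuous_within; apply: cont_add; first exact: cont_const.
    by apply: cont_opp; exact: cont_id.
  by move=> s /andP[? ?]; apply/andP; split; lra.
(* Since the node walk is null, l followed by the segment c is homotopic to c; cancelling c against
   its reverse contracts l. *)
have H2 : homot (pcat l c) c.
  apply: hom_trans H _; apply: hom_trans (hom_cat (hom_refl cc) N _) _.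
    by rewrite c1 npath0.
  by have := hom_cat_const cc; rewrite c1.
have rev := hom_cat_rev cc; rewrite c0 -/r in rev.
have H3 : homot l (fun=> l 1).
  apply: hom_trans (hom_sym (hom_cat_const cl)) _.
  apply: hom_trans (hom_cat (hom_refl cl) (hom_sym rev) _) _ => //.
  apply: hom_trans (hom_sym (hom_catA cl cc cr _ _)) _.
  - by rewrite c0.
  - by rewrite /r subr0.
  apply: hom_trans rev; apply: hom_cat H2 (hom_refl cr) _.
  by rewrite pcat1 /r subr0.
have [F [cF F1 F2]] := hom_sym H3; exists F; split=> //.
- by move=> s /F1[].
- by move=> s sI; have [-> _] := F1 s sI; have [-> _] := F1 0 (I0 R).
- by move=> t /F2[-> ->].
Qed.

End Realize.

Local Close Scope ring_scope.

(** * Contraction of edge paths *)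

Section FaceMoves.
Variable X : cell_complex.
Implicit Types (u v w : skeleton X) (f : face X) (q : seq (node X)).
Local Notation rhX := (rh (@ntri X)).

Lemma cof_inl u v : cof (inl u : node X) (inl v) -> u = v \/ adj u v.
Proof.
case=> s [x|x y xy|f x y xy] []; rewrite !inE.
- by move=> /eqP[->] /eqP[->]; left.
- move=> /orP[] /eqP[->] /orP[] /eqP[->]; (try by left); right=> //.
  by rewrite adj_sym.
- move=> /orP[//|] /orP[] /eqP[->] /orP[//|] /orP[] /eqP[->]; (try by left); right.
    exact: side_adj xy.
  by rewrite adj_sym; exact: side_adj xy.
Qed.

Lemma cof_inr f g : cof (inr f : node X) (inr g) -> f = g.
Proof.
case=> s [x|x y xy|h x y xy] []; rewrite !inE ?orbF //.
by move=> /eqP[->] /eqP[->].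
Qed.

Lemma cof_sym (a b : node X) : cof a b -> cof b a.
Proof. by case=> s ss [sa sb]; exists s. Qed.

Lemma cof_incident f u : cof (inr f : node X) (inl u) -> incident f u.
Proof.
case=> s [x|x y xy|h x y xy] []; rewrite !inE ?orbF //.
move=> /eqP[->] /orP[//|] /orP[] /eqP[->]; first by exists y.
by exists x; exact: side_sym.
Qed.

Lemma incident_cof f u : incident f u -> cof (inr f : node X) (inl u).
Proof.
by move=> [v uv]; exists [:: inr f; inl u; inl v]; [exact: SCorner|rewrite !inE !eqxx ?orbT].
Qed.

Lemma rh_backtrack (a b : node X) q : cof a b -> rhX [:: a, b, a & q] (a :: q).
Proof.
move=> [s ss [sa sb]]; apply: rh_trans (rh_dup _ [::] a q).
by apply: (rh_elem [::]); exists s.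
Qed.

Lemma rh_face_in f u v q : side f u v -> rhX [:: inl u, inl v & q] [:: inl u, inr f, inl v & q].
Proof.
move=> uv; apply: rh_sym; apply: (rh_elem [::]).
by exists [:: inr f; inl u; inl v]; [exact: SCorner|rewrite !inE !eqxx ?orbT].
Qed.

Lemma rh_face_skip f u v q : side f u v -> rhX [:: inr f, inl u, inl v & q] [:: inr f, inl v & q].
Proof.
move=> uv; apply: (rh_elem [::]).
by exists [:: inr f; inl u; inl v]; [exact: SCorner|rewrite !inE !eqxx ?orbT].
Qed.

Lemma rh_face_path2 f u v w q : side f u v -> side f v w ->
  rhX [:: inl u, inl v, inl w & q] [:: inl u, inr f, inl w & q].
Proof.
move=> uv vw; apply: rh_trans (rh_face_in _ uv) _.
exact: (rh_cons _ (rh_face_skip q vw)).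
Qed.

Section ToVertices.
Hypothesis face2 : forall f u v, incident f u -> incident f v ->
  [\/ u = v, side f u v | exists w, side f u w /\ side f w v].

(** Each passage through a barycentre is replaced, across the cell, by a path of length at most 2 on
    its boundary. Consecutive barycentres coincide. *)
Lemma node_walk_vertices u v p : nwalk (inl u : node X) p -> last (inl u) p = inl v ->
  exists w : seq (skeleton X), [/\ path adj u w, last u w = v & rhX (inl u :: p) (map inl (u :: w))].
Proof.
have [n] := ubnP (size p); elim: n u p => // n IH u [|[x|f] p] /=.
- by move=> _ _ [<-]; exists [::]; split=> //; exact: rh_refl.
- rewrite ltnS => sp [ux xp] lp; have [w [w1 w2 w3]] := IH x p sp xp lp.
  case: (cof_inl ux) => [e|e]; last first.
    by exists (x :: w); rewrite /= e; split=> //; exact: rh_cons.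
  subst x; exists w; split=> //; apply: rh_trans w3; exact: (rh_dup _ [::]).
- case: p => [|[y|g] p] //= sp [uf [fy yp]] lp; last first.
    have e := cof_inr fy; subst g.
    have [w [w1 w2 w3]] := IH u (inr f :: p) (sp : size (inr f :: p) < n) (conj uf yp) lp.
    exists w; split=> //; apply: rh_trans w3; exact: (rh_dup _ [:: inl u]).
  have [w [w1 w2 w3]] := IH y p (ltnW (sp : (size p).+1 < n)) yp lp.
  case: (face2 (cof_incident (cof_sym uf)) (cof_incident fy)) => [e|e|[z [e1 e2]]].
  + subst y; exists w; split=> //; apply: rh_trans w3; exact: rh_backtrack.
  + exists (y :: w); rewrite /= (side_adj e); split=> //.
    by apply: rh_trans (rh_sym (rh_face_in _ e)) _; exact: rh_cons.
  + exists [:: z, y & w]; rewrite /= (side_adj e1) (side_adj e2); split=> //.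
    by apply: rh_trans (rh_sym (rh_face_path2 _ e1 e2)) _; do 2 apply: rh_cons.
Qed.

Lemma node_walks_null :
  (forall u (w : seq (skeleton X)), path adj u w -> last u w = u -> rhX (map inl (u :: w)) [:: inl u]) ->
  forall (a : node X) p, nwalk a p -> last a p = a -> rhX (a :: p) [:: a].
Proof.
move=> h.
have H u p : nwalk (inl u : node X) p -> last (inl u) p = inl u -> rhX (inl u :: p) [:: inl u].
  move=> up lp; have [w [w1 w2 w3]] := node_walk_vertices up lp.
  by apply: rh_trans w3 _; apply: h.
move=> [u|f] p; first exact: H.
(* A closed walk based at a barycentre is conjugated into one based at a corner of the cell. *)
move=> fp lf; have [u [v uv]] := side_corner f.
have fu : incident f u by exists v.
have cfu := incident_cof fu.
have nw (b : node X) l c : nwalk b l -> cof (last b l) c -> nwalk b (rcons l c).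
  by elim: l b => [|d l IH] b //= [bd dl] lc; split=> //; apply: IH.
have N : rhX (inl u :: rcons (inr f :: p) (inl u)) [:: inl u].
  apply: H; last by rewrite last_rcons.
  split; first exact: cof_sym.
  by apply: nw => //; rewrite lf.
have L1 : rhX (inr f :: p) (inr f :: inl u :: inr f :: p) by apply/rh_sym/rh_backtrack.
have L2 : rhX (inr f :: p) ((inr f :: p) ++ [:: inl u; inr f]).
  rewrite lastI lf -cats1 -catA; apply: rh_catl; exact/rh_sym/rh_backtrack.
apply: rh_trans L1 _; apply: rh_trans (rh_catl [:: inr f; inl u] L2) _.
have := rh_ctx [:: inr f] [:: inr f] N; rewrite -cats1 /= -catA => N'.
apply: rh_trans N' _; exact: rh_backtrack.
Qed.

End ToVertices.

End FaceMoves.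

Section Geodesics.
Variable G : sgraph.
Hypothesis hc : forall u v : G, exists n, has_walk u v n.
Hypothesis inc : forall v u : G, incp v u.
Hypothesis tpc : forall v x y : G, adj x y -> gdist v x = gdist v y -> tpcp v x y.
Local Notation X := (tp_complex G).
Local Notation rhX := (rh (@ntri X)).
Local Notation nodes := (map (@inl (skeleton X) (face X))).

Lemma rh_triangle (a b c : G) q : adj a b -> adj b c -> adj a c ->
  rhX (nodes [:: a, b, c & q]) (nodes [:: a, c & q]).
Proof.
move=> ab bc ac; pose f : face X := triangle_face ab bc ac.
have s x y : x \in [:: a; b; c] -> y \in [:: a; b; c] -> adj x y -> side f x y.
  exact: triangle_side.
have sab : side f a b by apply: s; rewrite ?inE ?eqxx ?orbT.
have sbc : side f b c by apply: s; rewrite ?inE ?eqxx ?orbT.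
have sac : side f a c by apply: s; rewrite ?inE ?eqxx ?orbT.
apply: rh_trans (rh_face_path2 _ sab sbc) _; exact/rh_sym/rh_face_in.
Qed.

Lemma rh_pentagon (x a t b y : G) q : pent x a t b y ->
  rhX (nodes [:: x, y, b, t & q]) (nodes [:: x, a, t & q]).
Proof.
move=> pe; pose f : face X := pent_face pe.
have s u v : u \in [:: x; a; t; b; y] -> v \in [:: x; a; t; b; y] -> adj u v -> side f u v.
  exact: pent_side.
move: (pe) => /andP[/and5P[xa at_ tb bY yx] _].
have s1 : side f x y by apply: s; rewrite ?inE ?eqxx ?orbT // adj_sym.
have s2 : side f y b by apply: s; rewrite ?inE ?eqxx ?orbT // adj_sym.
have s3 : side f b t by apply: s; rewrite ?inE ?eqxx ?orbT // adj_sym.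
have s4 : side f x a by apply: s; rewrite ?inE ?eqxx ?orbT.
have s5 : side f a t by apply: s; rewrite ?inE ?eqxx ?orbT.
apply: rh_trans (rh_face_path2 _ s1 s2) _.
apply: rh_trans (rh_cons _ (rh_face_skip _ s3)) _.
exact/rh_sym/rh_face_path2.
Qed.

Variable v : G.

Fixpoint descent (x : G) (l : seq G) : Prop :=
  if l is y :: l' then par v x y /\ descent y l' else x = v.

Lemma descent_exists x : exists l, descent x l.
Proof.
move: {2}(gdist v x) (erefl (gdist v x)) => k; elim: k x => [|k IH] x dx.
  by exists [::]; rewrite /= (gdist_eq0 hc dx).
have [y xy] := par_exists hc dx; have [|l yl] := IH y; last by exists (y :: l).
by case: xy => _; lia.
Qed.

(** By INC two first steps y, y' are equal, or adjacent with a common parent z. In the latter case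
    both descents are compared with one through z, and two triangles fill the gap. *)
Lemma descent_unique x l l' : descent x l -> descent x l' ->
  rhX (nodes (x :: l)) (nodes (x :: l')).
Proof.
move: {2}(gdist v x) (erefl (gdist v x)) => k; elim: k x l l' => [|k IH] x [|y l] [|y' l'] dx //=.
- by move=> _ _; exact: rh_refl.
- by move=> _ [[_]]; rewrite dx addn1.
- by move=> [[_]]; rewrite dx addn1.
- by move=> [[_]]; rewrite dx addn1.
- by move=> xv; move: dx; rewrite xv gdistxx.
- by move=> xv; move: dx; rewrite xv gdistxx.
- by move=> _ xv; move: dx; rewrite xv gdistxx.
move=> [xy yl] [xy' yl'].
have dy : gdist v y = k by case: xy => _; lia.
have dy' : gdist v y' = k by case: xy' => _; lia.
case: (inc xy xy') => [e|[yy' [z [yz y'z]]]].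
  by subst y'; apply: rh_cons; exact: IH.
have [m zm] := descent_exists z.
have y'y : adj y' y by rewrite adj_sym.
apply: rh_trans (rh_cons _ (IH y l (z :: m) dy yl (conj yz zm))) _.
apply: rh_trans (rh_cons _ (IH y' (z :: m) l' dy' (conj y'z zm) yl')).
apply: rh_trans (rh_sym (rh_triangle (z :: m) xy'.1 y'y xy.1)) _.
exact: (rh_cons _ (rh_triangle m y'y yz.1 y'z.1)).
Qed.

(** An edge leading up cancels against a descent through x, an edge leading down is the start of a
    descent, and a level edge is pushed down across the triangle or pentagon given by TPC. *)
Lemma walk_descent x w : path adj x w -> last x w = v -> forall l, descent x l ->
  rhX (nodes (x :: w)) (nodes (x :: l)).
Proof.
elim: w x => [|y w IH] x /=; first by move=> _ -> l; exact: (@descent_unique v [::]).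
move=> /andP[xy yw] lw l xl.
suff [m [ym h]] : exists m, descent y m /\ rhX (nodes [:: x, y & m]) (nodes (x :: l)).
  by apply: rh_trans h; apply: rh_cons; exact: IH.
have yx : adj y x by rewrite adj_sym.
have := gdist_step hc v xy; have := gdist_step hc v yx.
case: (ltngtP (gdist v x) (gdist v y)) => d d1 d2.
- exists (x :: l); split; first by split=> //; split=> //; lia.
  apply: rh_backtrack; exists [:: inl x; inl y]; first exact: SEdge.
  by rewrite !inE !eqxx ?orbT.
- have [m ym] := descent_exists y; exists m; split=> //.
  by apply: descent_unique => //; split=> //; split=> //; lia.
- case: (tpc xy d) => [[z [xz yz]]|[a [t [b [xa at_ yb bt pe]]]]].
    have [m zm] := descent_exists z; exists (z :: m); split=> //.
    apply: rh_trans (rh_triangle _ xy yz.1 xz.1) _.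
    exact: (@descent_unique x (z :: m)).
  have [m tm] := descent_exists t; exists [:: b, t & m]; split=> //.
  apply: rh_trans (rh_pentagon _ pe) _.
  exact: (@descent_unique x [:: a, t & m]).
Qed.

End Geodesics.

Lemma convex_null_walks (G : sgraph) : (forall u v : G, exists n, has_walk u v n) ->
  convex_balls G -> forall (a : node (tp_complex G)) p, nwalk a p -> last a p = a ->
  rh (@ntri (tp_complex G)) (a :: p) [:: a].
Proof.
move=> hc cb.
have cbn n : convex_balls_upto G n by move=> r v _; exact: cb.
(* Level k is treated with balls of radius up to k + 3, the shift making the radius at least 3. *)
have key k := @conv_incp_tpcp G hc k.+3 isT (cbn _) k.
have le4 k : k <= k.+4 by rewrite ltnW // ltnW // ltnW.
have inc (v u : G) : incp v u by have [h _] := key _ (le4 (gdist v u)); apply: h.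
have tpc (v x y : G) : adj x y -> gdist v x = gdist v y -> tpcp v x y.
  by move=> xy d; have [_ h] := key _ (le4 (gdist v y)); apply: h.
apply: node_walks_null; first exact: tp_side_dist2.
by move=> u w uw lw; apply: (@walk_descent G hc inc tpc u u w uw lw [::]).
Qed.

(** * The equivalences and the universal cover *)

Lemma convex_local_conditions (G : sgraph) : (forall u v : G, exists n, has_walk u v n) ->
  convex_balls_upto G 3 -> local_conditions G.
Proof.
move=> hc conv; have key k := @conv_incp_tpcp G hc 3 isT conv k.
split; last exact: (pp_close_PP1 hc (conv_PP1 hc conv)).
  by have [h _] := key 3 isT; exact: h.
move=> v x y xy d d3; have [_ h] := key (gdist v x) (leqW d3).
by apply: h.
Qed.

Lemma tp_face_dist2 (G : sgraph) (f : face (tp_complex G)) x y : incident f x -> incident f y ->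
  [\/ x = y, adj x y | exists z, adj x z /\ adj z y].
Proof.
move=> fx fy; case: (tp_side_dist2 fx fy) => [->|h|[z [h1 h2]]]; first by constructor 1.
  by constructor 2; exact: side_adj h.
by constructor 3; exists z; rewrite (side_adj h1) (side_adj h2).
Qed.

(** Adjacent vertices have adjacent, hence distinct, images, so p embeds a clique of the covering as
    a clique of G. *)
Lemma covering_admissible (G : sgraph) (Y : cell_complex)
    (p : skeleton Y -> skeleton (tp_complex G)) q :
  covering p q -> admissible_graph G -> connected_graph (skeleton Y) ->
  admissible_graph (skeleton Y).
Proof.
move=> cov [_ fin] cY; split=> // A clA.
have im : clique (p @` A).
  move=> _ _ [a Aa <-] [b Ab <-] ne; apply: (cov_adj cov); apply: clA => // e.
  by apply: ne; rewrite e.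
have inj : {in A &, injective p}.
  move=> a b /set_mem Aa /set_mem Ab e; apply: contrapT => ne.
  by have := cov_adj cov (clA a b Aa Ab ne); rewrite e adj_irr.
by rewrite -(eq_finite_set (inj_card_eq inj)); exact: fin.
Qed.

Theorem theorem4p1 (R : realType) (G : sgraph) (hG : admissible_graph G) :
  ((CB_graph G <->
     [/\ simply_connected R (tp_complex G), TPC0_upto G 3, INC_upto G 3
       & PP1_diameter_le G 3]) /\
   (CB_graph G <->
     simply_connected R (tp_complex G) /\ convex_balls_upto G 3)) /\
  (convex_balls_upto G 3 ->
   forall (Y : cell_complex) (p : skeleton Y -> skeleton (tp_complex G))
     (q : face Y -> face (tp_complex G)),
     universal_cover R p q -> CB_graph (skeleton Y)).
Proof.
have [cG _] := hG; have [_ hc] := cG.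
have local_sc : simply_connected R (tp_complex G) -> local_conditions G -> CB_graph G.
  move=> sc lc; split=> //; apply: (local_conditions_convex hc lc).
  exact: (simply_connected_near_sc (@tp_face_dist2 G) sc).
have upto : CB_graph G -> convex_balls_upto G 3 by move=> [_ cb] r v _; exact: cb.
have CB_sc : CB_graph G -> simply_connected R (tp_complex G).
  move=> [_ cb]; apply: null_walks_simply_connected => //.
  exact: (convex_null_walks hc cb).
split; [split; split|].
- move=> h; have [h1 h2 _] := convex_local_conditions hc (upto h); split.
  + exact: CB_sc.
  + exact/(tpcp_upto hc).
  + exact/(incp_upto hc).
  + exact: (conv_PP1 hc (upto h)).
- move=> [sc /(tpcp_upto hc) h1 /(incp_upto hc) h2 h3]; apply: local_sc => //.
  by split=> //; exact: pp_close_PP1.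
- by move=> h; split; [exact: CB_sc|exact: upto].
- by move=> [sc conv]; apply: local_sc => //; exact: convex_local_conditions.
- move=> conv Y p q [cov scY].
  have cY := path_connected_skeleton (cov_face_dist2 cov) scY.1.
  split; first exact: (covering_admissible cov hG cY).
  have nsc := simply_connected_near_sc (cov_face_dist2 cov) scY.
  apply: (local_conditions_convex cY.2 _ nsc).
  apply: (lift_local_conditions hc cY.2 (convex_local_conditions hc conv) (p := p)).
  + exact: (cov_adj cov).
  + exact: (cov_inj cov).
  + exact: (cov_triangle cov).
  + by move=> u g /(cov_edge cov)[v [h _]]; exists v.
  + by move=> c x1 x0 x3 x4; exact: (cov_pent cov).
Qed.
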